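(* $\mathsf{LinKaw}^*\subset\mathsf{Drop1}$.
   Context: Let $\mathcal{H}=\mathbb{Q}\langle x,y\rangle$, $\mathcal{H}^1=\mathbb{Q}+y\mathcal{H}$, $\mathcal{H}^0=\mathbb{Q}+y\mathcal{H}x$, $\mathcal{H}^{\ge2}=\mathbb{Q}+yx\,\mathbb{Q}\langle x,yx\rangle$, $e_k=yx^{k-1}$ (so words of $\mathcal{H}^1$ are the $e_{k_1}\cdots e_{k_r}$). Harmonic product $*$ on $\mathcal{H}^1$: $\mathbb{Q}$-bilinear, $w*1=1*w=w$, and $w_1e_{k_1}*w_2e_{k_2}=(w_1*w_2e_{k_2})e_{k_1}+(w_1e_{k_1}*w_2)e_{k_2}+(w_1*w_2)e_{k_1+k_2}$ for words $w_1,w_2$ and positive integers $k_1,k_2$. $\phi$ is the algebra automorphism of $\mathcal{H}$ with $\phi(x)=x+y$, $\phi(y)=-y$. Define $\mathsf{LinKaw}^*=\operatorname{span}_{\mathbb{Q}}\{(\phi(w_1*w_2)x)*w_3\mid w_1,w_2\in y\mathcal{H},\ w_3\in\mathcal{H}^{\ge2}\}$ and $\mathsf{Drop1}=\operatorname{span}_{\mathbb{Q}}\{w-\mathcal{D}(w)\mid w\in y\mathcal{H}x\}$, where $\mathcal{D}$ is defined as follows. Notation: $[n]=\{1,\dots,n\}$. For an index (tuple of positive integers) $\boldsymbol{c}=(c_1,\dots,c_r)$: $[r]^1_{\boldsymbol{c}}=\{i:c_i=1\}$, $[r]^{>1}_{\boldsymbol{c}}=\{i:c_i>1\}$; for $A\subset[r]$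 with $[r]\setminus A=\{i_1<\dots<i_t\}$, $\boldsymbol{c}_{(-A)}=(c_{i_1},\dots,c_{i_t})$ and for $B\subset[r]$, $\boldsymbol{c}_{(-A)}-\boldsymbol{\delta}_B=(c_{i_1}-\delta_{i_1\in B},\dots,c_{i_t}-\delta_{i_t\in B})$ ($\delta_{i\in B}=1$ if $i\in B$, else $0$). $A\subset[2s]$ is even-odd if (even $i\in A\Rightarrow i+1\in A$) and (odd $i\in A\Rightarrow i-1\in A$); odd-even if (odd $i\in A\Rightarrow i+1\in A$) and (even $i\in A\Rightarrow i-1\in A$). $\mathcal{D}\colon\mathcal{H}^0\to\mathcal{H}^{\ge2}$ is $\mathbb{Q}$-linear with $\mathcal{D}(1)=1$; writing $\mathfrak{D}(\boldsymbol{c})=\mathcal{D}(y^{c_1}x^{c_2}\cdots y^{c_{2s-1}}x^{c_{2s}})$ for even-depth $\boldsymbol{c}$ (every word of $y\mathcal{H}x$ is uniquely of this form) and $\mathfrak{D}(\varnothing)=1$, it satisfies the recursion \begin{align*} \mathfrak{D}(\boldsymbol{c})&=\sum_{\substack{A\subset[2s]^1_{\boldsymbol{c}}\\ A\text{ even-odd}}}\ \sum_{\substack{B\subset[2s]^{>1}_{\boldsymbol{c}},\ \#A+\#B\ge1\\ \{2r,2r+1\}\not\subset B\ (r\in[s-1])}}(-1)^{\#B-1}\mathfrak{D}(\boldsymbol{c}_{(-A)}-\boldsymbol{\delta}_B)\,x^{\#A+\#B}\\ &\quad+\sum_{\substack{A\subset[2s]^1_{\boldsymbol{c}}\\ A\text{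 even-odd}}}\ \sum_{\substack{B\subset[2s]^{>1}_{\boldsymbol{c}},\ \#A+\#B\ge2\\ \{2r,2r+1\}\not\subset B\ (r\in[s-1])}}(-1)^{\#B-1}\mathfrak{D}(\boldsymbol{c}_{(-A)}-\boldsymbol{\delta}_B)\,yx^{\#A+\#B-1}\\ &\quad+\sum_{\substack{A\subset[2s]^1_{\boldsymbol{c}}\\ A\text{ odd-even}}}\ \sum_{\substack{B\subset[2s]^{>1}_{\boldsymbol{c}},\ \#A+\#B\ge2\\ \{2r-1,2r\}\not\subset B\ (r\in[s])}}(-1)^{\#B}\mathfrak{D}(\boldsymbol{c}_{(-A)}-\boldsymbol{\delta}_B)\,yx^{\#A+\#B-1}. \end{align*} (The arguments on the right are even-depth indices of strictly smaller weight, so this determines $\mathcal{D}$.) *)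

(* Defs.v *)
(* Elements of H = Q<x,y> are represented as formal finite
   sums (lists of (coefficient, word)); two formal sums denote the same
   element of H iff they have the same coefficient function [coef]. *)
From mathcomp Require Import all_boot all_order all_algebra.
Set Implicit Arguments. Unset Strict Implicit. Unset Printing Implicit Defensive.
Import Order.TTheory GRing.Theory Num.Theory.
Local Open Scope ring_scope.

(* letters: false = x, true = y *)
Definition word := seq bool.
Definition Hpol := seq (rat * word).

Definition coef (p : Hpol) (w : word) : rat :=
  \sum_(t <- p) (if t.2 == w then t.1 else 0).

Definition one : Hpol := [:: (1, [::])].
Definition scale (c : rat) (p : Hpol) : Hpol := [seq (c * t.1, t.2) | t <- p].
Definition sub (p q : Hpol) : Hpol := p ++ scale (-1) q.

Definition lift2 (f : word -> word -> Hpol) (p q : Hpol) : Hpol :=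
  flatten [seq scale (a.1 * b.1) (f a.2 b.2) | a <- p, b <- q].
Definition lift1 (f : word -> Hpol) (p : Hpol) : Hpol :=
  flatten [seq scale a.1 (f a.2) | a <- p].

Definition mul : Hpol -> Hpol -> Hpol := lift2 (fun u v => [:: (1, u ++ v)]).
Definition mulw (p : Hpol) (v : word) : Hpol := [seq (t.1, t.2 ++ v) | t <- p].

Definition phi_letter (b : bool) : Hpol :=
  if b then [:: (-1, [:: true])] else [:: (1, [:: false]); (1, [:: true])].
Definition phi_word (w : word) : Hpol := foldr (fun b acc => mul (phi_letter b) acc) one w.
Definition phi : Hpol -> Hpol := lift1 phi_word.

(* words of H^1 <-> indices: e_k = y x^(k-1) *)
Definition word_of_idx (ks : seq nat) : word :=
  flatten [seq true :: nseq k.-1 false | k <- ks].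
Definition idx_of_word (w : word) : seq nat :=
  (foldr (fun b (p : nat * seq nat) => if b then (0%N, p.1.+1 :: p.2) else (p.1.+1, p.2))
         (0%N, [::]) w).2.

(* harmonic product on reversed indices (last letter e_k first) *)
Fixpoint hrev (a : seq nat) : seq nat -> seq (seq nat) :=
  match a with
  | [::] => fun b => [:: b]
  | k1 :: a' =>
      fix hb (b : seq nat) : seq (seq nat) :=
        match b with
        | [::] => [:: k1 :: a']
        | k2 :: b' =>
            [seq k1 :: t | t <- hrev a' b] ++ [seq k2 :: t | t <- hb b']
              ++ [seq (k1 + k2)%N :: t | t <- hrev a' b']
        end
  end.

Definition harm_word (u v : word) : Hpol :=
  [seq (1, word_of_idx (rev t)) | t <- hrev (rev (idx_of_word u)) (rev (idx_of_word v))].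
Definition harm : Hpol -> Hpol -> Hpol := lift2 harm_word.

Fixpoint subs (l : seq nat) : seq (seq nat) :=
  match l with
  | [::] => [:: [::]]
  | a :: l' => let r := subs l' in [seq a :: t | t <- r] ++ r
  end.

Definition even_odd (A : seq nat) : bool :=
  all (fun i => if odd i then i.-1 \in A else i.+1 \in A) A.
Definition odd_even (A : seq nat) : bool :=
  all (fun i => if odd i then i.+1 \in A else i.-1 \in A) A.

Definition sgnm1 (B : seq nat) : rat := - (-1) ^+ size B.
Definition sgn (B : seq nat) : rat := (-1) ^+ size B.

Fixpoint Dfuel (n : nat) (c : seq nat) : Hpol :=
  if c is [::] then one else
  match n with
  | 0%N => [::]
  | n'.+1 =>
    let s := (size c)./2 in
    let I := iota 1 (size c) in
    let ci i := nth 0%N c i.-1 in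
    let ones := [seq i <- I | ci i == 1%N] in
    let bigs := [seq i <- I | (1 < ci i)%N] in
    let arg A B := [seq (ci i - (i \in B))%N | i <- I & i \notin A] in
    let condB1 B := all (fun r => ~~ (((2 * r)%N \in B) && ((2 * r).+1 \in B))) (iota 1 s.-1) in
    let condB3 B := all (fun r => ~~ (((2 * r).-1 \in B) && ((2 * r)%N \in B))) (iota 1 s) in
    let Dn A B := Dfuel n' (arg A B) in
    flatten [seq flatten [seq
        scale (sgnm1 B) (mulw (Dn A B) (nseq (size A + size B) false))
      | B <- subs bigs & condB1 B && (1 <= size A + size B)%N] | A <- subs ones & even_odd A]
    ++ flatten [seq flatten [seq
        scale (sgnm1 B) (mulw (Dn A B) (true :: nseq (size A + size B).-1 false))
      | B <- subs bigs & condB1 B && (2 <= size A + size B)%N] | A <- subs ones & even_odd A]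
    ++ flatten [seq flatten [seq
        scale (sgn B) (mulw (Dn A B) (true :: nseq (size A + size B).-1 false))
      | B <- subs bigs & condB3 B && (2 <= size A + size B)%N] | A <- subs ones & odd_even A]
  end.

(* frakD(c), recursion terminates since weights strictly decrease *)
Definition frakD (c : seq nat) : Hpol := Dfuel (sumn c) c.

(* run lengths: y^{c1} x^{c2} ... y^{c_{2s-1}} x^{c_{2s}} |-> (c1,...,c2s) *)
Definition runs (w : word) : seq nat :=
  map snd (foldr (fun b (acc : seq (bool * nat)) =>
     match acc with
     | (b', k) :: r => if b == b' then (b, k.+1) :: r else (b, 1%N) :: acc
     | [::] => [:: (b, 1%N)]
     end) [::] w).

Definition D_word (w : word) : Hpol := frakD (runs w).
Definition D : Hpol -> Hpol := lift1 D_word.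

Definition word_yH (u : word) : bool := if u is true :: _ then true else false.
Definition word_yHx (u : word) : bool :=
  if u is true :: _ then last true u == false else false.
Fixpoint word_x_yx (u : word) : bool :=
  match u with
  | [::] => true
  | false :: v => word_x_yx v
  | true :: false :: v => word_x_yx v
  | _ => false
  end.
(* H^{>=2} = Q + yx Q<x,yx> *)
Definition word_Hge2 (u : word) : bool :=
  match u with
  | [::] => true
  | true :: false :: v => word_x_yx v
  | _ => false
  end.

Definition supported_in (P : word -> bool) (p : Hpol) : Prop :=
  forall u, coef p u != 0 -> P u.

Definition in_span (S : Hpol -> Prop) (p : Hpol) : Prop :=
  exists l : seq (rat * Hpol),
    (forall t, t \in l -> S t.2) /\
    coef p =1 coef (flatten [seq scale t.1 t.2 | t <- l]).

Definition LinKaw_gen (q : Hpol) : Prop :=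
  exists w1 w2 w3 : Hpol,
    [/\ supported_in word_yH w1, supported_in word_yH w2, supported_in word_Hge2 w3 &
        q = harm (mulw (phi (harm w1 w2)) [:: false]) w3].

Definition Drop1_gen (q : Hpol) : Prop :=
  exists w : Hpol, supported_in word_yHx w /\ q = sub w (D w).

Definition LinKaw : Hpol -> Prop := in_span LinKaw_gen.
Definition Drop1 : Hpol -> Prop := in_span Drop1_gen.

(* Main.v *)
(** For N >= 1 let F_N be the truncated multiple zeta value, that is the linear
    form on H^1 with F_N(e_k1 .. e_kr) = sum over 0 < n_1 < .. < n_r < N of
    prod n_i^-k_i, and let Z_N(w) be the coefficient of w in
    prod_(1 <= i < N) (1 - y/(N-i))^-1 (1 - x/i)^-1, a discretised iterated integral.
    Three identities hold.
    - F_N(D(w)) = Z_N(w) for w in yHx: the recursion defining D turns into a relation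
      between F_{N+1} o D and F_N o D which determines them, and Z_N satisfies the
      same relation.
    - Z_N(w * v) = Z_N(w) F_N(v) for w in yHx and v in H^{>=2}: on words ending in x,
      Z_N is proportional to a product of factors each of which preserves the property
      of being a module map over a character of H^{>=2}.
    - Z_N(phi(w1 * w2) x) = 0 for w1, w2 in yH: over the dual numbers Q[eps], the form
      w |-> -eps Z_N(phi(w) x) is, up to a unit, the restriction to yH of a character
      of the harmonic algebra.
    Hence F_N o D vanishes on LinKaw* for every N. The forms F_N separate the elements
    of H^1, because no rational function has C/X^A, with 0 <> C of degree < A, as its
    difference f(X+1) - f(X). So D(p) = 0 and p = p - D(p) for p in LinKaw*. *)

(* Keeping N finite serves twice: N is an induction variable for the recursion of D, and the forms
   F_N together detect an identity in H, where multiple zeta values would only give one between real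
   numbers. Characters are built from the series B_s = 1 + y (s - x)^-1 = 1 + sum of e_k / s^k:
   right multiplication by B_s or by its inverse preserves characters of the harmonic algebra. The
   third identity comes from the product over 0 < i < N, in increasing order, of B_(theta - i)^-1
   B_i. At theta = N it equals 1, the factors cancelling in pairs from the middle outwards; at theta
   = N + eps only an eps-part is added, and the eps-part of a character that is trivial at eps = 0
   kills every product of two nonempty words. Partial fractions expand the product over the partial
   products of Z_N o phi, which identifies this eps-part with Z_N(phi(w) x) up to a constant. The
   same technique relates Z_N to the module map of the second identity. *)
From HB Require Import structures.
Require Import Defs.
From mathcomp Require Import all_boot all_order all_algebra.
From mathcomp Require Import ring lra zify.
Set Implicit Arguments. Unset Strict Implicit. Unset Printing Implicit Defensive.
Import Order.TTheory GRing.Theory Num.Theory.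
Local Open Scope ring_scope.

(** * Linear forms on reversed words *)

(* Words are reversed: the head of a list is the last letter. A linear form is
   identified with the noncommutative power series having its values as coefficients;
   [fwd s p q] is right multiplication by s - p x - q y and [res s p q] by its inverse. *)
Section Operators.
Variable K : comUnitRingType.
Implicit Types (s p q : K) (f g : seq bool -> K) (w : seq bool).

Definition letc p q (b : bool) : K := if b then q else p.

Fixpoint res s p q f w : K :=
  s^-1 * (f w + if w is b :: w' then letc p q b * res s p q f w' else 0).

Definition fwd s p q f w : K :=
  s * f w - if w is b :: w' then letc p q b * f w' else 0.

Lemma resE s p q f w : s \is a GRing.unit ->
  s * res s p q f w = f w + if w is b :: w' then letc p q b * res s p q f w' else 0.
Proof. by move=> us; case: w => [|b w] /=; rewrite mulVKr. Qed.

Lemma fwd_res s p q f w : s \is a GRing.unit -> fwd s p q (res s p q f) w = f w.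
Proof. by move=> us; rewrite /fwd resE // addrK. Qed.

Lemma res_fwd s p q f w : s \is a GRing.unit -> res s p q (fwd s p q f) w = f w.
Proof.
move=> us; elim: w => [|b w IH] /=; rewrite /fwd ?subr0 ?addr0 ?mulKr //.
by rewrite IH subrK mulKr.
Qed.

Lemma eq_res s p q f g w : f =1 g -> res s p q f w = res s p q g w.
Proof. by move=> e; elim: w => [|b w IH] /=; rewrite e // IH. Qed.

Lemma eq_fwd s p q f g w : f =1 g -> fwd s p q f w = fwd s p q g w.
Proof. by move=> e; rewrite /fwd e; case: w => // b w; rewrite e. Qed.

Lemma res_lin s p q (a : K) f g w :
  res s p q (fun v => a * f v + g v) w = a * res s p q f w + res s p q g w.
Proof. by elim: w => [|b w IH] /=; [ring | rewrite IH; ring]. Qed.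

Lemma resZ s p q (a : K) f w : res s p q (fun v => a * f v) w = a * res s p q f w.
Proof. by elim: w => [|b w IH] /=; [ring | rewrite IH; ring]. Qed.

Lemma fwd_lin s p q (a : K) f g w :
  fwd s p q (fun v => a * f v + g v) w = a * fwd s p q f w + fwd s p q g w.
Proof. by rewrite /fwd; case: w => [|b w]; ring. Qed.

Lemma res_sum s p q n (a : nat -> K) (F : nat -> seq bool -> K) w :
  res s p q (fun v => \sum_(k < n) a k * F k v) w = \sum_(k < n) a k * res s p q (F k) w.
Proof.
elim: n => [|n IH].
  rewrite big_ord0; elim: w => [|b w IH] /=; rewrite big_ord0 ?IH; ring.
rewrite big_ord_recr /= -IH addrC -res_lin; apply: eq_res => v.
by rewrite big_ord_recr /= addrC.
Qed.

Lemma fwd_sum s p q n (a : nat -> K) (F : nat -> seq bool -> K) w :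
  fwd s p q (fun v => \sum_(k < n) a k * F k v) w = \sum_(k < n) a k * fwd s p q (F k) w.
Proof.
rewrite /fwd mulr_sumr; case: w => [|b w].
  by rewrite subr0; apply: eq_bigr => i _; ring.
rewrite mulr_sumr -sumrB; apply: eq_bigr => i _; ring.
Qed.

Lemma fwd_shift s s' p q f w : fwd s' p q f w = fwd s p q f w + (s' - s) * f w.
Proof. by rewrite /fwd; ring. Qed.

Lemma fwd_res_shift s s' p q f w : s \is a GRing.unit ->
  fwd s' p q (res s p q f) w = f w + (s' - s) * res s p q f w.
Proof. by move=> us; rewrite (fwd_shift s) fwd_res. Qed.

(* Partial fractions for the resolvents of one letter combination. *)
Lemma res_res s s' p q f w : s \is a GRing.unit -> s' \is a GRing.unit ->
  (s' - s) * res s' p q (res s p q f) w = res s p q f w - res s' p q f w.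
Proof.
move=> us us'.
have -> : res s p q f w = res s' p q (fun v => 1 * f v + (s' - s) * res s p q f v) w.
  rewrite -[LHS](res_fwd p q _ _ us'); apply: eq_res => v.
  by rewrite fwd_res_shift // mul1r.
by rewrite res_lin resZ; ring.
Qed.

(* Reversed words of H^1: empty, or with first letter y. *)
Definition rH1 w := last true w.

Lemma rH1_tl b w : rH1 (b :: w) -> rH1 w.
Proof. by rewrite /rH1 /=; case: w. Qed.

Lemma eqH_res s p q f g : (forall w, rH1 w -> f w = g w) ->
  forall w, rH1 w -> res s p q f w = res s p q g w.
Proof.
move=> e; elim=> [|b w IH] H /=; rewrite e // IH //; exact: rH1_tl H.
Qed.

Lemma eqH_fwd s p q f g : (forall w, rH1 w -> f w = g w) ->
  forall w, rH1 w -> fwd s p q f w = fwd s p q g w.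
Proof.
move=> e [|b w] H; rewrite /fwd e //; congr (_ - _ * _); apply: e; exact: rH1_tl H.
Qed.

Definition onef w : K := (w == [::])%:R.

(** The remaining coefficients of (s - x)^-1 sit on powers of x, outside H^1. This is why the
    product expansions below hold on [rH1] words only. *)
Lemma res_x_onef s w : rH1 w -> res s 1 0 onef w = s^-1 * onef w.
Proof.
elim: w => [|b w IH] H /=; rewrite /onef /= ?addr0 // add0r mulr0.
case: b H => H /=; first by rewrite mul0r mulr0.
rewrite IH ?(rH1_tl H) //; case: w H {IH} => // c w _.
by rewrite /onef /= !(mulr0, mulr0).
Qed.

Lemma fwd_x_onef s w : rH1 w -> fwd s 1 0 onef w = s * onef w.
Proof.
by case: w => [|[] [|c w]] // _; rewrite /fwd /onef /= !(mulr0, mul0r, subr0).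
Qed.

End Operators.

Section Chi.
Variable K : comUnitRingType.
Implicit Types (s : K) (f g : seq bool -> K).

(** Right multiplication by (s - x + y) (s - x)^-1 = 1 + y (s - x)^-1, that is by 1 + sum of e_k /
    s^k: evaluation of quasi-symmetric functions at the single variable 1/s. [chiV s] multiplies by
    the inverse series. *)
Definition chi s f := res s 1 0 (fwd s 1 (-1) f).
Definition chiV s f := res s 1 (-1) (fwd s 1 0 f).

Lemma chi_chiV s f w : s \is a GRing.unit -> chi s (chiV s f) w = f w.
Proof.
move=> us; rewrite -[RHS](res_fwd 1 0 f w us); apply: eq_res => v; exact: fwd_res.
Qed.

Lemma chi_chiV_shift s s' f w : s \is a GRing.unit ->
  chi s' (chiV s f) w
  = res s' 1 0 (fwd s 1 0 f) w + (s' - s) * res s' 1 0 (res s 1 (-1) (fwd s 1 0 f)) w.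
Proof.
move=> us; rewrite addrC -res_lin; apply: eq_res => v.
by rewrite /chiV fwd_res_shift // addrC.
Qed.

Lemma eqH_chi s f g : (forall w, rH1 w -> f w = g w) ->
  forall w, rH1 w -> chi s f w = chi s g w.
Proof. by move=> e; apply: eqH_res; apply: eqH_fwd. Qed.

Lemma eqH_chiV s f g : (forall w, rH1 w -> f w = g w) ->
  forall w, rH1 w -> chiV s f w = chiV s g w.
Proof. by move=> e; apply: eqH_res; apply: eqH_fwd. Qed.

Lemma chi_sum s n (a : nat -> K) (F : nat -> seq bool -> K) w :
  chi s (fun v => \sum_(k < n) a k * F k v) w = \sum_(k < n) a k * chi s (F k) w.
Proof. rewrite -(res_sum _ _ _ _ a (fun k => fwd s 1 (-1) (F k))); apply: eq_res => v; exact: fwd_sum. Qed.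

Lemma chiV_sum s n (a : nat -> K) (F : nat -> seq bool -> K) w :
  chiV s (fun v => \sum_(k < n) a k * F k v) w = \sum_(k < n) a k * chiV s (F k) w.
Proof. rewrite -(res_sum _ _ _ _ a (fun k => fwd s 1 0 (F k))); apply: eq_res => v; exact: fwd_sum. Qed.

Lemma eq_chi s f g w : f =1 g -> chi s f w = chi s g w.
Proof. by move=> e; apply: eq_res => v; apply: eq_fwd. Qed.
End Chi.

(** * A character over the dual numbers *)

(* Used at theta = N + eps over the dual numbers, where [Pn theta N.-1] is a
   character whose value on every nonempty word is a multiple of eps. *)
Section ProductExpansion.
Variables (K : comUnitRingType) (theta : K) (N : nat).
Hypothesis natU : forall i, (0 < i)%N -> (i%:R : K) \is a GRing.unit.
Hypothesis thU : forall i, (0 < i < N)%N -> (theta - i%:R) \is a GRing.unit.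

(** For theta = N these are, up to the constant [nrm], the partial products of Z_N transported by
    phi, which turns a factor N - k - y into N - k - x + y. *)
Fixpoint Qk (k : nat) : seq bool -> K :=
  if k is k'.+1 then res k%:R 1 0 (res (theta - k%:R) 1 (-1) (Qk k')) else @onef K.

Fixpoint Pn (n : nat) : seq bool -> K :=
  if n is n'.+1 then chi n%:R (chiV (theta - n%:R) (Pn n')) else @onef K.

(** For theta = N + eps and n = N - 1 the factor [theta - n%:R - 1 - k'%:R] at k' = 0 is eps, so
    every coefficient except that of the empty product is a multiple of eps. *)
Fixpoint lamP (n k : nat) : K :=
  if k is k'.+1 then - (n%:R - k'%:R) * (theta - n%:R - 1 - k'%:R) * lamP n k'
  else \prod_(m < n) ((theta - m.+1%:R) / m.+1%:R).

Lemma lamP_rec n k : (k <= n)%N ->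
  (n.+1%:R - k%:R) * lamP n.+1 k = (theta - n%:R - 1 - k%:R) * lamP n k.
Proof.
elim: k => [|k IH] kn /=.
  have u := natU (ltn0Sn n).
  rewrite big_ord_recr /= !subr0 mulrC -mulrA divrK // -natr1; ring.
have := IH (ltnW kn); rewrite -!natr1 => e.
rewrite (_ : _ * _ = - (n%:R - k%:R) * (theta - n%:R - 1 - (k%:R + 1)) *
   ((n%:R + 1 - k%:R) * lamP n.+1 k)); last by ring.
rewrite e; ring.
Qed.

Arguments lamP : simpl never.
Arguments Qk : simpl never.

Definition opP n f := chi n.+1%:R (chiV (theta - n.+1%:R) f) : seq bool -> K.

(** Partial fractions separate the new denominators from those of index k. Apart from a multiple of
    [Q], only the new pair of factors applied to [g] and to [Q] remains; over consecutive k these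
    terms telescope. *)
Lemma opP_step n k (g : seq bool -> K) w : (0 < k <= n)%N -> (n.+1 < N)%N ->
  let a' := res n.+1%:R 1 0 in let b' := res (theta - n.+1%:R) 1 (-1) in
  let Q := res k%:R 1 0 (res (theta - k%:R) 1 (-1) g) in
  let c := n.+1%:R - (theta - n.+1%:R) in
  let e := theta - n.+1%:R - k%:R in
  (n.+1%:R - k%:R) * opP n Q w
  = e * Q w + c * a' (b' g) w + (n.+1%:R - k%:R) * (e * c) * a' (b' Q) w.
Proof.
move=> /andP[k0 kn] nN a' b' Q c e.
have uk := natU k0; have un := natU (ltn0Sn n).
have utk : theta - k%:R \is a GRing.unit by apply: thU; lia.
have utn : theta - n.+1%:R \is a GRing.unit by apply: thU; lia.
set h := res (theta - k%:R) 1 (-1) g in Q *.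
rewrite /opP chi_chiV_shift //.
have eA v : fwd (theta - n.+1%:R) 1 0 Q v = 1 * h v + e * Q v.
  by rewrite /Q fwd_res_shift // mul1r.
rewrite (eq_res _ _ _ _ eA).
have eB v : res (theta - n.+1%:R) 1 (-1) (fwd (theta - n.+1%:R) 1 0 Q) v
   = 1 * b' h v + e * b' Q v.
  rewrite (eq_res _ _ _ _ eA) res_lin -/b'; congr (_ + _); exact: resZ.
rewrite (eq_res _ _ _ _ eB) -/a'.
have l1 : a' (fun v => 1 * h v + e * Q v) w = a' h w + e * a' Q w.
  by rewrite /a' res_lin resZ mul1r.
have l2 : a' (fun v => 1 * b' h v + e * b' Q v) w = a' (b' h) w + e * a' (b' Q) w.
  by rewrite /a' res_lin resZ mul1r.
rewrite l1 l2.
have r1 : (n.+1%:R - k%:R) * a' Q w = Q w - a' h w by exact: res_res.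
have r2 : (n.+1%:R - k%:R) * a' (b' h) w = a' (b' g) w - a' h w.
  rewrite -[LHS]resZ.
  have -> : a' (b' g) w - a' h w = a' (fun v => (-1) * h v + b' g v) w.
    by rewrite /a' res_lin; ring.
  apply: eq_res => v.
  have := res_res 1 (-1) g v utk utn; rewrite -/b' -/h => r.
  have -> : -1 * h v + b' g v = - (h v - b' g v) by ring.
  rewrite -r /b' /h; ring.
rewrite (_ : _ * _ = (n.+1%:R - k%:R) * a' h w + e * ((n.+1%:R - k%:R) * a' Q w)
   + c * ((n.+1%:R - k%:R) * a' (b' h) w) + (n.+1%:R - k%:R) * (e * c) * a' (b' Q) w);
  last by rewrite /c; ring.
rewrite r1 r2 /c /e; ring.
Qed.

Lemma opP_one n w : rH1 w -> (n.+1 < N)%N ->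
  let a' := res n.+1%:R 1 0 in let b' := res (theta - n.+1%:R) 1 (-1) in
  let c := n.+1%:R - (theta - n.+1%:R) in
  let e := theta - n.+1%:R in
  n.+1%:R * opP n (@onef K) w
  = e * onef K w + n.+1%:R * (e * c) * a' (b' (@onef K)) w.
Proof.
move=> Hw nN a' b' c e.
have un := natU (ltn0Sn n).
have utn : theta - n.+1%:R \is a GRing.unit by apply: thU; lia.
rewrite /opP chi_chiV_shift // -/e.
have eA v : rH1 v -> fwd e 1 0 (@onef K) v = e * onef K v by exact: fwd_x_onef.
have -> : res n.+1%:R 1 0 (fwd e 1 0 (@onef K)) w = e * (n.+1%:R^-1 * onef K w).
  by rewrite (eqH_res _ _ _ eA) // resZ res_x_onef.
have -> : res n.+1%:R 1 0 (res e 1 (-1) (fwd e 1 0 (@onef K))) w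
    = e * a' (b' (@onef K)) w.
  rewrite -[RHS]resZ; apply: eqH_res Hw => v Hv.
  by rewrite (eqH_res _ _ _ eA) // resZ.
rewrite mulrDr mulrCA mulVKr // /c /e; ring.
Qed.

Lemma Pn_expansion n w : (n < N)%N -> rH1 w ->
  Pn n w = \sum_(k < n.+1) lamP n k * Qk k w.
Proof.
elim: n w => [|n IH] w nN Hw.
  by rewrite big_ord1 /lamP /= big_ord0 mul1r.
have {}IH v : rH1 v -> Pn n v = \sum_(k < n.+1) lamP n k * Qk k v.
  by move=> Hv; apply: IH => //; apply: ltnW.
rewrite [LHS](_ : _ = opP n (Pn n) w) //.
rewrite [LHS](eqH_chi _ (eqH_chiV _ IH)) //.
rewrite (eq_chi _ _ (chiV_sum _ _ _ Qk)) (chi_sum _ _ _ (fun k => chiV (theta - n.+1%:R) (Qk k))).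
pose Y k := res n.+1%:R 1 0 (res (theta - n.+1%:R) 1 (-1) (Qk k)) w.
pose c : K := n.+1%:R - (theta - n.+1%:R).
(* Up to index m the telescoping leaves one boundary term, a multiple of [Y m]. At m = n it is the
   new top term, since [Y n] is [Qk n.+1 w]. *)
have key m : (m <= n)%N -> \sum_(k < m.+1) lamP n k * opP n (Qk k) w
    = \sum_(k < m.+1) lamP n.+1 k * Qk k w
      + c * (theta - n.+1%:R - m%:R) * lamP n m * Y m.
  elim: m => [|m IHm] mn.
    rewrite !big_ord1 /=; apply: (mulrI (natU (ltn0Sn n))).
    rewrite mulrCA opP_one // -/(Y 0) -/c.
    have := lamP_rec (leq0n n); rewrite !subr0.
    move: (lamP n.+1 0) (lamP n 0) => l' l e.
    rewrite [RHS]mulrDr [n.+1%:R * (l' * _)]mulrA e -natr1 /=; ring.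
  rewrite big_ord_recr /= (IHm (ltnW mn)) [in RHS]big_ord_recr /= -[LHS]addrA -[RHS]addrA.
  congr (_ + _).
  have u : (n.+1%:R - m.+1%:R : K) \is a GRing.unit.
    by rewrite -natrB ?natU //; lia.
  apply: (mulrI u).
  have mn' : (0 < m.+1 <= n)%N by lia.
  have := opP_step (Qk m) w mn' nN.
  rewrite /= -/c -/(Qk m.+1) -/(Y m.+1) -/(Y m) => st.
  rewrite mulrDr [X in _ + X = _]mulrCA st.
  have := lamP_rec mn; have : lamP n m.+1 = - (n%:R - m%:R) * (theta - n%:R - 1 - m%:R) * lamP n m by [].
  move: (lamP n.+1 m.+1) (lamP n m.+1) (lamP n m) => l2 l1 l0 e1 e.
  rewrite [RHS]mulrDr [X in _ = X + _]mulrA e e1 -!natr1; ring.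
rewrite -[LHS]/(\sum_(k < n.+1) lamP n k * opP n (Qk k) w) key // [in RHS]big_ord_recr.
congr (_ + _); rewrite -[Qk n.+1 w]/(Y n); congr (_ * _).
have -> : lamP n.+1 n.+1 = - (n.+1%:R - n%:R) * (theta - n.+1%:R - 1 - n%:R) * lamP n.+1 n by [].
have := lamP_rec (leqnn n); rewrite -natr1 (addrC _ 1) addrK mul1r => ->.
by rewrite /c -natr1; ring.
Qed.
End ProductExpansion.

(** * Harmonic product *)

(** Indices are reversed as well, so that the recursion of [hrev] works at the head, the end at
    which [chi] multiplies. *)
Fixpoint rwd (r : seq nat) : seq bool :=
  if r is k :: r' then nseq k.-1 false ++ true :: rwd r' else [::].

Lemma rH1_rwd r : rH1 (rwd r).
Proof.
rewrite /rH1; elim: r => [|k r IH] //=.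
rewrite last_cat /=; move: IH; by case: (rwd r).
Qed.

Lemma hrev_cons k1 a k2 b : hrev (k1 :: a) (k2 :: b)
  = [seq k1 :: t | t <- hrev a (k2 :: b)] ++ [seq k2 :: t | t <- hrev (k1 :: a) b]
     ++ [seq (k1 + k2)%N :: t | t <- hrev a b].
Proof. by []. Qed.

Lemma hrev_nil a : hrev a [::] = [:: a].
Proof. by case: a. Qed.

Definition posn (r : seq nat) := all (leq 1) r.

Section Characters.
Variable K : comUnitRingType.
Implicit Types (s : K) (f g : seq bool -> K).

Definition hmul f a b : K := \sum_(t <- hrev a b) f (rwd t).

Lemma hmul_cons f k1 a k2 b : hmul f (k1 :: a) (k2 :: b)
  = \sum_(t <- hrev a (k2 :: b)) f (rwd (k1 :: t))
    + \sum_(t <- hrev (k1 :: a) b) f (rwd (k2 :: t))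
    + \sum_(t <- hrev a b) f (rwd ((k1 + k2)%N :: t)).
Proof. by rewrite /hmul hrev_cons !big_cat !big_map /= addrA. Qed.

Definition is_char f := f [::] = 1 /\
  forall a b, posn a -> posn b -> hmul f a b = f (rwd a) * f (rwd b).

(** Only one e_k ends a given word of H^1, so a single coefficient of 1 + sum of e_k / s^k
    contributes. *)
Lemma chi_block s f j w : s \is a GRing.unit ->
  chi s f (nseq j false ++ true :: w) = f (nseq j false ++ true :: w) + s^-1 ^+ j.+1 * f w.
Proof.
move=> us; elim: j => [|j IH].
  by rewrite /chi /= /fwd /= mul0r addr0 expr1 mulN1r opprK mulrDr mulKr.
have E v : chi s f (false :: v) = s^-1 * (s * f (false :: v) - 1 * f v + 1 * chi s f v) by [].
rewrite [nseq j.+1 _ ++ _]/= E IH (exprS _ j.+1).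
rewrite (_ : _ + _ = s * f (false :: nseq j false ++ true :: w) + s^-1 ^+ j.+1 * f w); last by ring.
by rewrite mulrDr mulKr // mulrA.
Qed.

Lemma chi_rwd s f k r : s \is a GRing.unit -> (0 < k)%N ->
  chi s f (rwd (k :: r)) = f (rwd (k :: r)) + s^-1 ^+ k * f (rwd r).
Proof. by move=> us; case: k => // k _; exact: chi_block. Qed.

Lemma chi_nil s f : s \is a GRing.unit -> chi s f [::] = f [::].
Proof. by move=> us; rewrite /chi /= /fwd subr0 addr0 mulKr. Qed.

Lemma posn_cons k r : posn (k :: r) = (0 < k)%N && posn r. Proof. by []. Qed.

(** Convolution with the character e_k -> s^-k: the three terms of the recursion of the harmonic
    product bring the factors s^-k1, s^-k2 and s^-(k1+k2), and the last is the product of the first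
    two. *)
Lemma is_char_chi s f : s \is a GRing.unit -> is_char f -> is_char (chi s f).
Proof.
move=> us [f1 fm]; split; first by rewrite chi_nil.
case=> [|k1 a] [|k2 b] pa pb.
- by rewrite /hmul /= big_seq1 /= chi_nil // f1 mulr1.
- by rewrite /hmul /= big_seq1 (chi_nil _ us) f1 mul1r.
- by rewrite /hmul big_seq1 (chi_nil _ us) f1 mulr1.
have := fm _ _ pa pb; rewrite hmul_cons hmul_cons.
move: (pa) (pb); rewrite !posn_cons => /andP[k1p pa'] /andP[k2p pb'].
have -> : \sum_(t <- hrev a (k2 :: b)) chi s f (rwd (k1 :: t)) =
    \sum_(t <- hrev a (k2 :: b)) f (rwd (k1 :: t)) + s^-1 ^+ k1 * hmul f a (k2 :: b).
  by rewrite mulr_sumr -big_split; apply: eq_bigr => t _; rewrite chi_rwd.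
have -> : \sum_(t <- hrev (k1 :: a) b) chi s f (rwd (k2 :: t)) =
    \sum_(t <- hrev (k1 :: a) b) f (rwd (k2 :: t)) + s^-1 ^+ k2 * hmul f (k1 :: a) b.
  by rewrite mulr_sumr -big_split; apply: eq_bigr => t _; rewrite chi_rwd.
have -> : \sum_(t <- hrev a b) chi s f (rwd ((k1 + k2)%N :: t)) =
    \sum_(t <- hrev a b) f (rwd ((k1 + k2)%N :: t)) + s^-1 ^+ (k1 + k2) * hmul f a b.
  rewrite mulr_sumr -big_split; apply: eq_bigr => t _; rewrite chi_rwd //; lia.
rewrite !fm // !chi_rwd // exprD => e.
set X := \sum_(t <- _) _ in e *; set Y := \sum_(t <- _) _ in e *; set Z := \sum_(t <- _) _ in e *.
rewrite [LHS](_ : _ = (X + Y + Z) + s^-1 ^+ k1 * (f (rwd a) * f (rwd (k2 :: b)))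
  + s^-1 ^+ k2 * (f (rwd (k1 :: a)) * f (rwd b)) + s^-1 ^+ k1 * s^-1 ^+ k2 * (f (rwd a) * f (rwd b)));
  last by ring.
by rewrite e; ring.
Qed.

(** [chi_rwd] expresses g on an index through f and through g on its tail, so multiplicativity
    passes back from f to g by induction on the total depth. *)
Lemma is_char_chi_inv s f g : s \is a GRing.unit ->
  (forall w, chi s g w = f w) -> is_char f -> is_char g.
Proof.
move=> us gf [f1 fm].
have gr k r : (0 < k)%N -> g (rwd (k :: r)) = f (rwd (k :: r)) - s^-1 ^+ k * g (rwd r).
  by move=> kp; rewrite -gf chi_rwd // addrK.
have g1 : g [::] = 1 by rewrite -f1 -gf chi_nil.
split=> // a b; move: {2}(size a + size b)%N (leqnn (size a + size b)) => n.
elim: n a b => [|n IH] [|k1 a] [|k2 b] //= sz pa pb;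
  rewrite ?[hmul _ [::] _]big_seq1 ?[hmul _ _ [::]]big_seq1 ?g1 ?mul1r ?mulr1 //.
have := fm (k1 :: a) (k2 :: b) pa pb; rewrite !hmul_cons.
move: (pa) (pb) => /andP[k1p pa'] /andP[k2p pb'].
have -> : \sum_(t <- hrev a (k2 :: b)) g (rwd (k1 :: t)) =
    \sum_(t <- hrev a (k2 :: b)) f (rwd (k1 :: t)) - s^-1 ^+ k1 * hmul g a (k2 :: b).
  by rewrite mulr_sumr -sumrB; apply: eq_bigr => t _; rewrite gr.
have -> : \sum_(t <- hrev (k1 :: a) b) g (rwd (k2 :: t)) =
    \sum_(t <- hrev (k1 :: a) b) f (rwd (k2 :: t)) - s^-1 ^+ k2 * hmul g (k1 :: a) b.
  by rewrite mulr_sumr -sumrB; apply: eq_bigr => t _; rewrite gr.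
have -> : \sum_(t <- hrev a b) g (rwd ((k1 + k2)%N :: t)) =
    \sum_(t <- hrev a b) f (rwd ((k1 + k2)%N :: t)) - s^-1 ^+ (k1 + k2) * hmul g a b.
  rewrite mulr_sumr -sumrB; apply: eq_bigr => t _; rewrite gr //; lia.
rewrite !IH //=; try lia; rewrite -?[nseq k1.-1 _ ++ _]/(rwd (k1 :: a)) -?[nseq k2.-1 _ ++ _]/(rwd (k2 :: b)).
rewrite !gr // exprD => e.
set X := \sum_(t <- _) _ in e *; set Y := \sum_(t <- _) _ in e *; set Z := \sum_(t <- _) _ in e *.
rewrite [LHS](_ : _ = (X + Y + Z) - s^-1 ^+ k1 * (g (rwd a) * (f (rwd (k2 :: b)) - s^-1 ^+ k2 * g (rwd b)))
  - s^-1 ^+ k2 * ((f (rwd (k1 :: a)) - s^-1 ^+ k1 * g (rwd a)) * g (rwd b))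
  - s^-1 ^+ k1 * s^-1 ^+ k2 * (g (rwd a) * g (rwd b)));
  last by ring.
by rewrite e; ring.
Qed.

Lemma is_char_chiV s f : s \is a GRing.unit -> is_char f -> is_char (chiV s f).
Proof. by move=> us; apply: (is_char_chi_inv us) => w; exact: chi_chiV. Qed.

Lemma is_char_onef : is_char (@onef K).
Proof.
have e0 k r : onef K (rwd (k :: r)) = 0.
  by rewrite /onef /=; case: k.-1.
split=> // -[|k1 a] [|k2 b] _ _; rewrite ?[hmul _ [::] _]big_seq1 ?[hmul _ _ [::]]big_seq1;
  rewrite ?e0 ?mulr0 ?mul0r //; first by rewrite mulr1.
by rewrite hmul_cons !big1 ?addr0 // => t _; exact: e0.
Qed.

Lemma is_char_Pn theta N n : (forall i, (0 < i)%N -> (i%:R : K) \is a GRing.unit) ->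
  (forall i, (0 < i < N)%N -> (theta - i%:R) \is a GRing.unit) ->
  (n < N)%N -> is_char (Pn theta n).
Proof.
move=> natU thU; elim: n => [|n IH] nN; first exact: is_char_onef.
rewrite [Pn _ _]/(chi n.+1%:R (chiV (theta - n.+1%:R) (Pn theta n))).
apply: is_char_chi; first exact: natU.
apply: is_char_chiV; first by apply: thU; lia.
by apply: IH; lia.
Qed.
End Characters.

(** * Z_N(phi(u * v) x) = 0 *)

Definition dual : Type := (rat * rat)%type.
HB.instance Definition _ := GRing.Zmodule.copy dual (rat * rat)%type.

Definition dmul (a b : dual) : dual := (a.1 * b.1, a.1 * b.2 + a.2 * b.1).
Definition dunit : dual := (1, 0).

Lemma dualP (a b : dual) : a.1 = b.1 -> a.2 = b.2 -> a = b.
Proof. by case: a b => [? ?] [? ?] /= -> ->. Qed.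

Lemma dmulA : associative dmul.
Proof. by move=> a b c; apply: dualP => /=; ring. Qed.
Lemma dmulC : commutative dmul.
Proof. by move=> a b; apply: dualP => /=; ring. Qed.
Lemma dmul1 : left_id dunit dmul.
Proof. by move=> a; apply: dualP => /=; ring. Qed.
Lemma dmulDl : left_distributive dmul +%R.
Proof. by move=> a b c; apply: dualP => /=; ring. Qed.
Lemma dunit_neq0 : dunit != 0.
Proof. by []. Qed.
HB.instance Definition _ :=
  GRing.Zmodule_isComNzRing.Build dual dmulA dmulC dmul1 dmulDl dunit_neq0.

Definition dinv (a : dual) : dual :=
  if a.1 != 0 then (a.1^-1, - a.2 / a.1 ^+ 2) else a.

Lemma dmulVx : {in [pred a : dual | a.1 != 0], left_inverse 1 dinv *%R}.
Proof.
move=> a; rewrite inE => a0; rewrite /dinv a0.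
by apply: dualP => /=; field.
Qed.
Lemma dunitP : forall a b : dual, b * a = 1 -> a.1 != 0.
Proof.
move=> a b /(congr1 fst) /= e; apply: contra_eq_neq e => ->.
by rewrite mulr0 eq_sym.
Qed.
Lemma dinv_out : {in [predC [pred a : dual | a.1 != 0]], dinv =1 id}.
Proof. by move=> a; rewrite !inE /dinv => /negbTE ->. Qed.
HB.instance Definition _ :=
  GRing.ComNzRing_hasMulInverse.Build dual dmulVx dunitP dinv_out.

Lemma dual_unitE (a : dual) : (a \is a GRing.unit) = (a.1 != 0).
Proof. by []. Qed.

Lemma dual_fst_mul (a b : dual) : (a * b).1 = a.1 * b.1.
Proof. by []. Qed.
Lemma dual_snd_mul (a b : dual) : (a * b).2 = a.1 * b.2 + a.2 * b.1.
Proof. by []. Qed.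
Lemma dual_fst_inv (a : dual) : a.1 != 0 -> a^-1.1 = a.1^-1.
Proof. by move=> a0; rewrite /GRing.inv /= /dinv a0. Qed.
Lemma dual_natr n : (n%:R : dual) = (n%:R, 0).
Proof. by elim: n => // n IH; rewrite -!natr1 IH; apply: dualP => /=; ring. Qed.

Fixpoint ckw (n k : nat) : rat :=
  match k with
  | 0%N => 0
  | 1%N => n%:R
  | k'.+1 => (n%:R - k'%:R) * k'%:R * ckw n k'
  end.

(** The eps-part of the character [Pn] at theta = N + eps, divided by the constant -L of [lamP_eps];
    [Kfun_ph] recognises it as Z_N(phi(w) x). *)
Definition Kfun (N : nat) (w : seq bool) : rat :=
  \sum_(k < N) ckw N.-1 k * Qk (N%:R : rat) k w.

Lemma natU_rat i : (0 < i)%N -> (i%:R : rat) \is a GRing.unit.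
Proof. by move=> i0; rewrite unitfE pnatr_eq0 -lt0n. Qed.

Lemma natB_neq0 (N i : nat) : (i < N)%N -> (N%:R - i%:R : rat) != 0.
Proof. by move=> iN; rewrite -natrB ?pnatr_eq0; lia. Qed.

Lemma dual_fst_add (a b : dual) : (a + b).1 = a.1 + b.1.
Proof. by []. Qed.

Lemma dual_fst_natr n : (n%:R : dual).1 = n%:R.
Proof. by rewrite dual_natr. Qed.

Lemma res_fst (s p q : dual) (f : seq bool -> dual) w : s.1 != 0 ->
  (res s p q f w).1 = res s.1 p.1 q.1 (fun v => (f v).1) w.
Proof.
move=> s0; elim: w => [|b w IH].
  have -> : res s p q f [::] = s^-1 * (f [::] + 0) by [].
  by rewrite dual_fst_mul dual_fst_inv.
have -> : res s p q f (b :: w) = s^-1 * (f (b :: w) + letc p q b * res s p q f w) by [].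
rewrite dual_fst_mul dual_fst_inv // dual_fst_add dual_fst_mul IH.
by case: b.
Qed.

Definition theta (N : nat) : dual := (N%:R, 1).

Lemma theta_subE N i : (theta N - i%:R).1 = N%:R - i%:R.
Proof. by rewrite dual_natr. Qed.

Lemma Qk_fst N k w : (k < N)%N -> (Qk (theta N) k w).1 = Qk (N%:R : rat) k w.
Proof.
elim: k w => [|k IH] w kN.
  by rewrite /Qk /onef dual_natr.
have -> : Qk (theta N) k.+1 = res k.+1%:R 1 0 (res (theta N - k.+1%:R) 1 (-1) (Qk (theta N) k)) by [].
rewrite res_fst ?dual_fst_natr ?pnatr_eq0 //; apply: eq_res => v.
rewrite res_fst ?theta_subE ?natB_neq0 //; apply: eq_res => u; apply: IH; lia.
Qed.

Lemma lamP_eps n : exists2 L : rat, L != 0 &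
  forall k, lamP (theta n.+1) n k.+1 = (0, - L * ckw n k.+1).
Proof.
(* L is the value at eps = 0 of [lamP n 0]; all its factors are nonzero because m.+1 < n.+1. *)
exists ((\prod_(m < n) ((theta n.+1 - m.+1%:R) / m.+1%:R)).1).
  have : forall m, (m <= n)%N ->
    (\prod_(i < m) ((theta n.+1 - i.+1%:R) / i.+1%:R)).1 != 0.
    elim=> [|m IH] mn; first by rewrite big_ord0.
    rewrite big_ord_recr dual_fst_mul mulf_neq0 ?IH //; first by lia.
    rewrite dual_fst_mul mulf_neq0 //; first by rewrite theta_subE natB_neq0.
    by rewrite dual_natr dual_fst_inv /= ?invr_eq0 pnatr_eq0.
  exact.
elim=> [|k' IH].
  rewrite /lamP; set p := \prod_(m < n) _.
  by rewrite !dual_natr; apply: dualP => /=; rewrite -natr1; ring.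
have -> : lamP (theta n.+1) n k'.+2 = - (n%:R - k'.+1%:R) * (theta n.+1 - n%:R - 1 - k'.+1%:R)
  * lamP (theta n.+1) n k'.+1 by [].
rewrite IH !dual_natr; apply: dualP => /=; rewrite -!natr1; ring.
Qed.

Lemma dual_fst_sum (I : Type) (r : seq I) (F : I -> dual) : (\sum_(i <- r) F i).1 = \sum_(i <- r) (F i).1.
Proof. by elim: r => [|i r IH]; rewrite ?big_nil // !big_cons -IH. Qed.
Lemma dual_snd_sum (I : Type) (r : seq I) (F : I -> dual) : (\sum_(i <- r) F i).2 = \sum_(i <- r) (F i).2.
Proof. by elim: r => [|i r IH]; rewrite ?big_nil // !big_cons -IH. Qed.

(** A character whose values on nonempty words are multiples of eps sends a product of two of them
    to a multiple of eps^2 = 0. *)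
Lemma Kfun_mul N a b : (0 < N)%N -> posn a -> posn b -> a != [::] -> b != [::] ->
  \sum_(t <- hrev a b) Kfun N (rwd t) = 0.
Proof.
case: N => // n _ pa pb a0 b0.
have natU : forall i, (0 < i)%N -> (i%:R : dual) \is a GRing.unit.
  by move=> i i0; rewrite dual_unitE dual_natr /= pnatr_eq0 -lt0n.
have thU : forall i, (0 < i < n.+1)%N -> (theta n.+1 - i%:R) \is a GRing.unit.
  by move=> i /andP[_ iN]; rewrite dual_unitE theta_subE natB_neq0.
have [L L0 lE] := lamP_eps n.
have PE r : r != [::] -> Pn (theta n.+1) n (rwd r) = (0, - L * Kfun n.+1 (rwd r)).
  move=> r0; rewrite (Pn_expansion natU thU) //; last exact: rH1_rwd.
  have one0 : onef dual (rwd r) = 0.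
    by rewrite /onef; case: r r0 => // k r _ /=; case: k.-1.
  rewrite big_ord_recl (one0 : Qk (theta n.+1) ord0 (rwd r) = 0) mulr0 add0r.
  rewrite /Kfun mulr_sumr big_ord_recl.
  have -> : ckw n.+1.-1 (ord0 : 'I_n.+1) = 0 by [].
  rewrite mul0r mulr0 add0r.
  have lEi (i : 'I_n) : lamP (theta n.+1) n (lift ord0 i) = (0, - L * ckw n (lift ord0 i)).
    by rewrite lift0 lE.
  apply: dualP.
    by rewrite dual_fst_sum big1 // => i _; rewrite lEi dual_fst_mul mul0r.
  rewrite dual_snd_sum; apply: eq_bigr => i _.
  rewrite lEi dual_snd_mul mul0r add0r Qk_fst ?mulrA //.
have [_ /(_ a b pa pb)] := is_char_Pn natU thU (ltnSn n).
rewrite !PE // => /(congr1 snd).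
rewrite /hmul dual_snd_sum dual_snd_mul mul0r mulr0 addr0.
have hne t : t \in hrev a b -> t != [::].
  move: a0 b0; case: a pa {pb} => // k1 a _; case: b => // k2 b _ _; rewrite hrev_cons !mem_cat.
  by move=> /or3P[] /mapP[u _ ->].
rewrite (eq_big_seq (fun t => - L * Kfun n.+1 (rwd t))); last first.
  by move=> t th; rewrite PE // hne.
rewrite -mulr_sumr => /eqP; rewrite mulf_eq0 oppr_eq0 (negbTE L0) /= => /eqP e.
exact: e.
Qed.

(** The transpose of phi on reversed words: [f] evaluated on phi of the word, letter by letter from
    the end. On series it is the substitution x -> x, y -> x - y. *)
Fixpoint ph (w : seq bool) (f : seq bool -> rat) : rat :=
  if w is b :: w' then
    if b then ph w' (fun u => - f (true :: u))
    else ph w' (fun u => f (false :: u) + f (true :: u))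
  else f [::].

Lemma eq_ph w f g : f =1 g -> ph w f = ph w g.
Proof.
elim: w f g => [|b w IH] f g e /=; first by rewrite e.
by case: b; apply: IH => u; rewrite !e.
Qed.

Lemma ph_lin w (a : rat) f g : ph w (fun u => a * f u + g u) = a * ph w f + ph w g.
Proof.
elim: w f g => [|b w IH] f g //=.
by case: b; rewrite -IH; apply: eq_ph => u; ring.
Qed.

Lemma phZ w (a : rat) f : ph w (fun u => a * f u) = a * ph w f.
Proof.
elim: w f => [|b w IH] f //=.
by case: b; rewrite -IH; apply: eq_ph => u; ring.
Qed.

Lemma ph_res_y s f w : ph w (res s 0 1 f) = res s 1 (-1) (fun v => ph v f) w.
Proof.
elim: w => [|b w IH] //=; rewrite -IH; case: b => /=.
  rewrite addrC -ph_lin -phZ; apply: eq_ph => u /=; ring.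
rewrite addrC -ph_lin -phZ; apply: eq_ph => u /=; ring.
Qed.

Lemma ph_res_x s f w : ph w (res s 1 0 f) = res s 1 0 (fun v => ph v f) w.
Proof.
elim: w => [|b w IH] //=; rewrite -IH; case: b => /=.
  rewrite mul0r addr0 -phZ; apply: eq_ph => u /=; ring.
rewrite addrC -ph_lin -phZ; apply: eq_ph => u /=; ring.
Qed.

Lemma ph_onef w : rH1 w -> ph w (@onef rat) = onef rat w.
Proof.
case: w => // b w _; rewrite /onef /=; case: b.
  by rewrite (@eq_ph _ _ (fun u => 0 * 0)) ?phZ ?mul0r // => u; rewrite oppr0 mul0r.
by rewrite (@eq_ph _ _ (fun u => 0 * 0)) ?phZ ?mul0r // => u; rewrite addr0 mul0r.
Qed.

(* The series prod_(1 <= i <= n) (1 - y/(N-i))^-1 (1 - x/i)^-1. *)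
Fixpoint Vphi (N n : nat) : seq bool -> rat :=
  if n is m.+1 then
    fun w => n%:R * (N%:R - n%:R) * res n%:R 1 0 (res (N%:R - n%:R) 0 1 (Vphi N m)) w
  else @onef rat.

Definition Zf (N : nat) := Vphi N N.-1.

(** A final x is either taken from the last factor (1 - x/(n+1))^-1 or, the y-factor before it being
    useless for it, from the first n pairs of factors. *)
Lemma Vphi_x N n u : (n.+1 < N)%N ->
  Vphi N n.+1 (false :: u) = Vphi N n (false :: u) + n.+1%:R^-1 * Vphi N n.+1 u.
Proof.
move=> nN; have n0 : (n.+1%:R : rat) != 0 by rewrite pnatr_eq0.
have s0 := natB_neq0 nN.
rewrite [Vphi N n.+1]/= /=; set g := Vphi N n; set r := res _ 1 0 _ _.
rewrite mul1r mul0r addr0; field; rewrite (addrC 1) natr1; exact/andP.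
Qed.

Lemma Vphi_nil N n : (n < N)%N -> Vphi N n [::] = 1.
Proof.
elim: n => [|n IH] nN //.
have n0 : (n.+1%:R : rat) != 0 by rewrite pnatr_eq0.
have s0 := natB_neq0 nN.
rewrite /Vphi -/Vphi /= !addr0 IH; last by lia.
by field; rewrite (addrC 1) natr1; exact/andP.
Qed.

Fixpoint nrm (N k : nat) : rat :=
  if k is j.+1 then k%:R * (N%:R - k%:R) * nrm N j else 1.

Lemma ph_Vphi N n w : rH1 w -> (n < N)%N -> ph w (Vphi N n) = nrm N n * Qk (N%:R : rat) n w.
Proof.
elim: n w => [|n IH] w Hw nN; first by rewrite mul1r ph_onef.
have -> : ph w (Vphi N n.+1) = n.+1%:R * (N%:R - n.+1%:R)
    * ph w (res n.+1%:R 1 0 (res (N%:R - n.+1%:R) 0 1 (Vphi N n))) by exact: phZ.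
have -> : nrm N n.+1 = n.+1%:R * (N%:R - n.+1%:R) * nrm N n by [].
rewrite -[RHS]mulrA; congr (_ * _).
rewrite ph_res_x (@eq_res _ _ _ _ _ (res (N%:R - n.+1%:R) 1 (-1) (fun v => ph v (Vphi N n)))).
  rewrite -resZ; apply: eqH_res Hw => v Hv; rewrite -resZ.
  by apply: eqH_res Hv => u Hu; apply: IH => //; lia.
by move=> v; exact: ph_res_y.
Qed.

Lemma nrm_ckw n k : ckw n k.+1 = k.+1%:R^-1 * nrm n.+1 k.+1.
Proof.
elim: k => [|k IH]; first by rewrite /= -natr1; field.
rewrite [ckw _ _]/= -/(ckw n k.+1) IH [nrm n.+1 k.+2]/= -/(nrm n.+1 k.+1).
have h1 : (k%:R + 1 : rat) != 0 by rewrite natr1 pnatr_eq0.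
have h2 : (k%:R + 1 + 1 : rat) != 0 by rewrite !natr1 pnatr_eq0.
by rewrite -!natr1; field; exact/andP.
Qed.

(** Iterating [Vphi_x] writes Z_N on a word ending in x as the sum over m of 1/m times the m-th
    partial product on the word without that x; the weights 1/m are the quotients in [nrm_ckw]. *)
Lemma Kfun_ph N w : (0 < N)%N -> rH1 w -> Kfun N w = ph w (fun u => Zf N (false :: u)).
Proof.
case: N => // n _ Hw; rewrite /Zf /=.
suff H m : (m <= n)%N -> ph w (fun u => Vphi n.+1 m (false :: u))
   = \sum_(k < m.+1) ckw n k * Qk (n.+1%:R : rat) k w.
  by rewrite H.
elim: m => [|m IH] mn.
  have -> : \sum_(k < 1) ckw n k * Qk (n.+1%:R : rat) k w = 0 by rewrite big_ord1 mul0r.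
  rewrite (@eq_ph _ _ (fun u => 0 * 0)) ?phZ ?mul0r // => u.
rewrite (@eq_ph _ _ (fun u => m.+1%:R^-1 * Vphi n.+1 m.+1 u + Vphi n.+1 m (false :: u))).
  rewrite ph_lin IH ?(ltnW mn) // [RHS]big_ord_recr [RHS]addrC; congr (_ + _).
  by rewrite ph_Vphi // mulrA (nrm_ckw n m).
by move=> u; rewrite Vphi_x // addrC.
Qed.

Lemma Zf_kawashima N a b : (0 < N)%N -> posn a -> posn b -> a != [::] -> b != [::] ->
  \sum_(t <- hrev a b) ph (rwd t) (fun u => Zf N (false :: u)) = 0.
Proof.
move=> N0 pa pb a0 b0; rewrite -[RHS](Kfun_mul N0 pa pb a0 b0).
by apply: eq_bigr => t _; rewrite Kfun_ph // rH1_rwd.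
Qed.

(** * Z_N(w * v) = Z_N(w) F_N(v) *)

Lemma sumS (F : nat -> rat) m : \sum_(k < m.+1) F k = \sum_(k < m) F k + F m.
Proof. exact: big_ord_recr. Qed.

Section SeriesForm.
Variable N : nat.
Notation rf := (seq bool -> rat).

Fixpoint Qv (k : nat) : rf :=
  if k is k'.+1 then res k%:R 1 0 (res (N%:R - k%:R) 0 1 (Qv k')) else @onef rat.
Definition hv (k : nat) : rf := res (N%:R - k.+1%:R) 0 1 (Qv k).

(** The product over i of (N - i - y)^-1 (1 + y (i - x)^-1). Unlike the factors of Z_N, each of
    these two preserves module maps. *)
Fixpoint Gh (n : nat) : rf :=
  if n is n'.+1 then chi n%:R (res (N%:R - n%:R) 0 1 (Gh n')) else @onef rat.

(** Solves the recursions in n and in k that the partial fractions of [Gh_expansion] impose. *)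
Fixpoint lamG (n k : nat) : rat :=
  if k is k'.+1 then - (n%:R - k'%:R) * (N%:R - k%:R) * lamG n k'
  else \prod_(m < n) - (m.+1%:R)^-1.

Lemma lamG_rec n k : (k <= n)%N -> (n.+1%:R - k%:R) * lamG n.+1 k = - lamG n k.
Proof.
elim: k => [|k IH] kn.
  have u : (n.+1%:R : rat) != 0 by rewrite pnatr_eq0.
  by rewrite /= big_ord_recr /= subr0 mulrN mulrN mulrCA divff // mulr1.
have := IH (ltnW kn); rewrite /= -!natr1 => e.
rewrite (_ : _ * _ = - (n%:R - k%:R) * (N%:R - (k%:R + 1)) *
   ((n%:R + 1 - k%:R) * lamG n.+1 k)); last by ring.
rewrite e; ring.
Qed.
Arguments lamG : simpl never.
Arguments Qv : simpl never.

Definition opG n (f : rf) : rf := chi n.+1%:R (res (N%:R - n.+1%:R) 0 1 f).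

Lemma chi_res_y (s m : rat) (f : rf) w : m \is a GRing.unit ->
  chi s (res m 0 1 f) w = m * res s 1 0 (res m 0 1 f) w - res s 1 0 f w
    + res s 1 0 (fwd s 1 0 (res m 0 1 f)) w.
Proof.
move=> um; rewrite /chi.
have -> : res s 1 0 (fwd s 1 (-1) (res m 0 1 f)) w = res s 1 0 (fun v => m * res m 0 1 f v +
   ((-1) * f v + fwd s 1 0 (res m 0 1 f) v)) w.
  apply: eq_res => v; rewrite -(fwd_res 0 1 f v um) /fwd; case: v => [|b v]; first by ring.
  by case: b => /=; ring.
by rewrite !res_lin; ring.
Qed.

(** Since (m - y)^-1 y = m (m - y)^-1 - 1, the factor y of 1 + y (s - x)^-1 is absorbed by the
    resolvent before it. *)
Lemma opGE n (f : rf) w : (n.+1 < N)%N -> opG n f w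
  = res (N%:R - n.+1%:R) 0 1 f w
    + (N%:R - n.+1%:R) * res n.+1%:R 1 0 (res (N%:R - n.+1%:R) 0 1 f) w
    - res n.+1%:R 1 0 f w.
Proof.
move=> nN; rewrite /opG chi_res_y; last by rewrite unitfE natB_neq0.
by rewrite res_fwd ?natU_rat //; ring.
Qed.

Lemma eqH_opG n (f g : rf) : (forall w, rH1 w -> f w = g w) ->
  forall w, rH1 w -> opG n f w = opG n g w.
Proof. by move=> e; apply: eqH_chi; apply: eqH_res. Qed.

Lemma opG_lin n a (f g : rf) w : opG n (fun v => a * f v + g v) w = a * opG n f w + opG n g w.
Proof.
rewrite /opG /chi -res_lin; apply: eq_res => v; rewrite -fwd_lin; apply: eq_fwd => u.
exact: res_lin.
Qed.

Lemma opG_sum n m (a : nat -> rat) (F : nat -> rf) w :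
  opG n (fun v => \sum_(k < m) a k * F k v) w = \sum_(k < m) a k * opG n (F k) w.
Proof.
rewrite /opG -(chi_sum _ _ _ (fun k => res (N%:R - n.+1%:R) 0 1 (F k))); apply: eq_chi => v.
exact: res_sum.
Qed.

(** The telescoping of [Pn_expansion] again, except that the first term of [opGE] lacks an x-factor;
    this produces the products [hv], cut after a y-factor. *)
Lemma Gh_expansion n w : (n < N)%N -> rH1 w ->
  Gh n w = \sum_(k < n.+1) lamG n k * Qv k w
         - \sum_(k < n) (n%:R - k%:R) * lamG n k * hv k w.
Proof.
elim: n w => [|n IH] w nN Hw.
  by rewrite big_ord1 big_ord0 subr0 /lamG /= big_ord0 mul1r.
have {}IH v : rH1 v -> Gh n v =
    (-1) * (\sum_(k < n) (n%:R - k%:R) * lamG n k * hv k v) + \sum_(k < n.+1) lamG n k * Qv k v.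
  by move=> Hv; rewrite mulN1r addrC; apply: IH => //; apply: ltnW.
rewrite [LHS](_ : _ = opG n (Gh n) w) // (eqH_opG _ IH) // opG_lin.
rewrite (opG_sum _ _ (fun k => (n%:R - k%:R) * lamG n k) hv) (opG_sum _ _ (lamG n) Qv).
rewrite mulN1r addrC.
pose E k := res (N%:R - n.+1%:R) 0 1 (Qv k) w.
pose F k := res n.+1%:R 1 0 (res (N%:R - n.+1%:R) 0 1 (Qv k)) w.
pose H k := res n.+1%:R 1 0 (hv k) w.
pose m' : rat := N%:R - n.+1%:R.
have um' : m' \is a GRing.unit by rewrite unitfE natB_neq0.
have opQ0 : n.+1%:R * opG n (Qv 0) w = n.+1%:R * (E 0 + m' * F 0) - Qv 0 w.
  rewrite opGE // mulrBr -/(E 0) -/m' -/(F 0); congr (_ - _).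
  by rewrite [Qv 0]/Qv res_x_onef // mulrA divff ?mul1r // pnatr_eq0.
have opQ k : (k < n)%N -> (n%:R - k%:R) * opG n (Qv k.+1) w
    = (n%:R - k%:R) * (E k.+1 + m' * F k.+1) - Qv k.+1 w + H k.
  move=> kn; rewrite opGE // mulrBr -/(E k.+1) -/m' -/(F k.+1).
  have := res_res 1 0 (hv k) w (natU_rat (ltn0Sn k)) (natU_rat (ltn0Sn n)).
  rewrite -[res k.+1%:R 1 0 (hv k)]/(Qv k.+1) -/(H k) -!natr1 => e.
  rewrite (_ : (n%:R + 1 - (k%:R + 1) : rat) = n%:R - k%:R) in e; last by ring.
  by rewrite e; ring.
have oph k : (k < n)%N -> (n%:R - k%:R) * opG n (hv k) w
    = E k - hv k w + m' * F k - m' * H k - (n%:R - k%:R) * H k.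
  move=> kn; rewrite opGE // mulrBr -/m' -/(H k).
  have uk : (N%:R - k.+1%:R : rat) \is a GRing.unit by rewrite unitfE natB_neq0 //; lia.
  have r v := res_res 0 1 (Qv k) v uk um'.
  have e1 : (n%:R - k%:R) * res m' 0 1 (hv k) w = E k - hv k w.
    have := r w; rewrite -/(hv k) -/(E k) => e.
    rewrite (_ : n%:R - k%:R = - (m' - (N%:R - k.+1%:R))); last by rewrite /m' -!natr1; ring.
    by rewrite [LHS]mulNr e; ring.
  have e2 : (n%:R - k%:R) * res n.+1%:R 1 0 (res m' 0 1 (hv k)) w = F k - H k.
    rewrite -resZ (_ : F k - H k = res n.+1%:R 1 0 (fun v => (-1) * hv k v + res m' 0 1 (Qv k) v) w).
      apply: eq_res => v; have := r v; rewrite -/(hv k) => e.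
      rewrite (_ : n%:R - k%:R = - (m' - (N%:R - k.+1%:R))); last by rewrite /m' -!natr1; ring.
      by rewrite [LHS]mulNr e; ring.
    by rewrite res_lin /F /H /m'; ring.
  rewrite mulrDr e1 mulrCA e2; ring.
have key m : (m <= n)%N ->
    \sum_(k < m.+1) lamG n k * opG n (Qv k) w
    - \sum_(k < m) (n%:R - k%:R) * lamG n k * opG n (hv k) w
  = \sum_(k < m.+1) lamG n.+1 k * Qv k w
    - \sum_(k < m) (n.+1%:R - k%:R) * lamG n.+1 k * hv k w
    + lamG n m * (E m + m' * F m).
  elim: m => [|m IHm] mn.
    rewrite !big_ord1 !big_ord0 !subr0 /=; apply: (mulrI (natU_rat (ltn0Sn n))).
    rewrite mulrCA opQ0.
    have := lamG_rec (leq0n n); rewrite subr0.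
    move: (lamG n.+1 0) (lamG n 0) => l' l e.
    rewrite [RHS]mulrDr [n.+1%:R * (l' * _)]mulrA e /=; ring.
  have := IHm (ltnW mn).
  pose f1 k := lamG n k * opG n (Qv k) w; pose f2 k := (n%:R - k%:R) * lamG n k * opG n (hv k) w.
  pose f3 k := lamG n.+1 k * Qv k w; pose f4 k := (n.+1%:R - k%:R) * lamG n.+1 k * hv k w.
  move=> eI; rewrite (sumS f1 m.+1) (sumS f2 m) (sumS f3 m.+1) (sumS f4 m) /f1 /f2 /f3 /f4.
  have u : (n%:R - m%:R : rat) != 0 by rewrite natB_neq0.
  have l1 : lamG n m.+1 = - (n%:R - m%:R) * (N%:R - m.+1%:R) * lamG n m by [].
  have l2 := lamG_rec (ltnW mn).
  have l3 : (n%:R - m%:R) * lamG n.+1 m.+1 = - lamG n m.+1.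
    rewrite -(lamG_rec mn) -!natr1; congr (_ * _); ring.
  move: (opQ m mn) (oph m mn) => eQ eh.
  rewrite l2; apply: (mulfI u).
  have eI' : \sum_(k < m.+1) lamG n k * opG n (Qv k) w =
    \sum_(k < m) (n%:R - k%:R) * lamG n k * opG n (hv k) w
    + (\sum_(k < m.+1) lamG n.+1 k * Qv k w
    - \sum_(k < m) (n.+1%:R - k%:R) * lamG n.+1 k * hv k w
    + lamG n m * (E m + m' * F m)) by rewrite -eI; ring.
  rewrite eI'.
  set A := \sum_(k < m) _; set B := \sum_(k < m.+1) _; set C := \sum_(k < m) _.
  rewrite [LHS](_ : _ = (n%:R - m%:R) * (B - C + lamG n m * (E m + m' * F m))
     + lamG n m.+1 * ((n%:R - m%:R) * opG n (Qv m.+1) w)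
     - (n%:R - m%:R) * lamG n m * ((n%:R - m%:R) * opG n (hv m) w)); last by ring.
  rewrite [RHS](_ : _ = (n%:R - m%:R) * (B - C) + ((n%:R - m%:R) * lamG n.+1 m.+1) * Qv m.+1 w
     + (n%:R - m%:R) * lamG n m * hv m w + (n%:R - m%:R) * lamG n m.+1 * (E m.+1 + m' * F m.+1));
    last by ring.
  rewrite l3 eQ eh l1 /m' -!natr1; ring.
rewrite key // (sumS (fun k => lamG n.+1 k * Qv k w) n.+1).
rewrite (sumS (fun k => (n.+1%:R - k%:R) * lamG n.+1 k * hv k w) n).
have l2 := lamG_rec (leqnn n); rewrite l2.
have l2' : lamG n.+1 n = - lamG n n by rewrite -l2 -natr1 (addrC _ 1) addrK mul1r.
have l1 : lamG n.+1 n.+1 = - (n.+1%:R - n%:R) * (N%:R - n.+1%:R) * lamG n.+1 n by [].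
rewrite l1 l2' -[Qv n.+1 w]/(F n) -[hv n w]/(E n) /m' -natr1; ring.
Qed.

End SeriesForm.

Lemma Vphi_Qv N n w : Vphi N n w = nrm N n * Qv N n w.
Proof.
elim: n w => [|n IH] w; first by rewrite mul1r.
rewrite [LHS](_ : _ = n.+1%:R * (N%:R - n.+1%:R) * res n.+1%:R 1 0 (res (N%:R - n.+1%:R) 0 1 (Vphi N n)) w) //.
rewrite [nrm _ _]/= -[RHS]mulrA; congr (_ * _); rewrite -resZ; apply: eq_res => v.
by rewrite -resZ; apply: eq_res => u; rewrite IH.
Qed.

Lemma lamG_diag n : lamG n.+1 n n != 0.
Proof.
suff H k : (k <= n)%N -> lamG n.+1 n k != 0 by apply: H.
elim: k => [|k IH] kn.
  rewrite /lamG prodf_seq_neq0; apply/allP => i _ /=.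
  by rewrite oppr_eq0 invr_eq0 pnatr_eq0.
rewrite [lamG _ _ _]/= -/(lamG n.+1 n k) !mulf_neq0 ?IH ?(ltnW kn) //.
  by rewrite oppr_eq0 natB_neq0.
by rewrite natB_neq0.
Qed.

(* At n = N - 1 the expansion of the series form collapses to its top term on
   words ending in x. *)
Lemma Gh_last_x n w : rH1 (false :: w) ->
  Gh n.+1 n (false :: w) = lamG n.+1 n n * Qv n.+1 n (false :: w).
Proof.
move=> Hw; rewrite Gh_expansion // (sumS (fun k => lamG n.+1 n k * Qv n.+1 k (false :: w)) n).
suff -> : \sum_(k < n) (n%:R - k%:R) * lamG n.+1 n k * hv n.+1 k (false :: w)
   = \sum_(k < n) lamG n.+1 n k * Qv n.+1 k (false :: w) by ring.
(* A final x cannot come from the y-factor that ends [hv], which thus only divides by N - (k+1). As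
   N = n + 1, this is n - k and cancels the coefficient. *)
apply: eq_bigr => k _; rewrite {1}/hv /= mul0r addr0.
have u : (n%:R - k%:R : rat) != 0 by rewrite natB_neq0.
rewrite (_ : n.+1%:R - k.+1%:R = n%:R - k%:R :> rat); last by rewrite -!natr1; ring.
by field.
Qed.

Lemma Zf_Gh N : (0 < N)%N -> exists c : rat, forall w, rH1 (false :: w) ->
  Zf N (false :: w) = c * Gh N N.-1 (false :: w).
Proof.
case: N => // n _; exists (nrm n.+1 n / lamG n.+1 n n) => w Hw.
rewrite /Zf /= Vphi_Qv Gh_last_x // mulrA divfK //; exact: lamG_diag.
Qed.

(* [g] is a module map over the character [u] of the words without e_1. *)
Definition semi_char (g u : seq bool -> rat) :=
  u [::] = 1 /\ forall a b, posn a -> all (leq 2) b ->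
    hmul g a b = g (rwd a) * u (rwd b).

Lemma posn2 b : all (leq 2) b -> posn b.
Proof. by apply: sub_all => i /ltnW. Qed.

(** As for characters: [g] and [u] are convolved with the same character e_k -> s^-k. *)
Lemma semi_char_chi s g u : s \is a GRing.unit -> semi_char g u ->
  semi_char (chi s g) (chi s u).
Proof.
move=> us [u1 gm]; split; first by rewrite chi_nil.
have g0 b : all (leq 2) b -> g (rwd b) = g [::] * u (rwd b).
  by move=> pb; have := gm [::] b isT pb; rewrite /hmul big_seq1.
have c0 b : all (leq 2) b -> chi s g (rwd b) = chi s g [::] * chi s u (rwd b).
  case: b => [|k b] pb; first by rewrite !chi_nil // u1 mulr1.
  have /andP[k2 pb'] := pb.
  rewrite !chi_rwd // 1?ltnW // chi_nil // !g0 //; ring.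
move=> [|k1 a] [|k2 b] pa pb.
- by rewrite /hmul /= big_seq1 /= !chi_nil // u1 mulr1.
- by rewrite /hmul /= big_seq1 c0.
- by rewrite /hmul big_seq1 (chi_nil _ us) u1 mulr1.
have := gm _ _ pa pb; rewrite hmul_cons hmul_cons.
have /andP[k1p pa'] := pa; have /andP[/ltnW k2p pb'] := pb.
have -> : \sum_(t <- hrev a (k2 :: b)) chi s g (rwd (k1 :: t)) =
    \sum_(t <- hrev a (k2 :: b)) g (rwd (k1 :: t)) + s^-1 ^+ k1 * hmul g a (k2 :: b).
  by rewrite mulr_sumr -big_split; apply: eq_bigr => t _; rewrite chi_rwd.
have -> : \sum_(t <- hrev (k1 :: a) b) chi s g (rwd (k2 :: t)) =
    \sum_(t <- hrev (k1 :: a) b) g (rwd (k2 :: t)) + s^-1 ^+ k2 * hmul g (k1 :: a) b.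
  by rewrite mulr_sumr -big_split; apply: eq_bigr => t _; rewrite chi_rwd.
have -> : \sum_(t <- hrev a b) chi s g (rwd ((k1 + k2)%N :: t)) =
    \sum_(t <- hrev a b) g (rwd ((k1 + k2)%N :: t)) + s^-1 ^+ (k1 + k2) * hmul g a b.
  rewrite mulr_sumr -big_split; apply: eq_bigr => t _; rewrite chi_rwd //; lia.
rewrite !gm // !chi_rwd // exprD => e.
set X := \sum_(t <- _) _ in e *; set Y := \sum_(t <- _) _ in e *; set Z := \sum_(t <- _) _ in e *.
rewrite [LHS](_ : _ = (X + Y + Z) + s^-1 ^+ k1 * (g (rwd a) * u (rwd (k2 :: b)))
  + s^-1 ^+ k2 * (g (rwd (k1 :: a)) * u (rwd b)) + s^-1 ^+ k1 * s^-1 ^+ k2 * (g (rwd a) * u (rwd b)));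
  last by ring.
by rewrite e; ring.
Qed.

Lemma res_y_rwd m (g : seq bool -> rat) k r : m \is a GRing.unit -> (0 < k)%N ->
  m * res m 0 1 g (rwd (k :: r))
  = g (rwd (k :: r)) + (if k == 1%N then res m 0 1 g (rwd r) else 0).
Proof.
move=> um; case: k => // -[|k] _; rewrite resE //=; first by rewrite mul1r.
by rewrite mul0r.
Qed.

(** The factor (m - y)^-1 strips final letters e_1. The parts of b are at least 2 and merged parts
    are larger still, so such a letter in the product can only come from a. *)
Lemma semi_char_res_y m g u : m \is a GRing.unit -> semi_char g u ->
  semi_char (res m 0 1 g) u.
Proof.
move=> um [u1 gm]; split=> // a b pa pb.
have m0 : m != 0 by rewrite -unitfE.
have c0 : hmul (res m 0 1 g) [::] b = res m 0 1 g [::] * u (rwd b).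
  apply: (mulfI m0); rewrite mulrA resE //= addr0.
  have := gm [::] b isT pb; rewrite /hmul !big_seq1 => <-.
  case: b pb => [|k b] /= pb; first by rewrite addr0 mulVKr.
  have /andP[k2 _] := pb.
  have := res_y_rwd g b um (ltnW k2); rewrite /= => ->.
  by rewrite gtn_eqF // addr0.
elim: a pa => [|k1 a IH] pa; first by [].
have {}IH := IH (andP pa).2; have k1p := (andP pa).1.
case: b pb gm c0 IH => [|k2 b] pb gm c0 IH.
  by rewrite /hmul big_seq1 u1 mulr1.
have k2p : (1 < k2)%N by case/andP: pb.
apply: (mulfI m0); rewrite [LHS](_ : _ = hmul g (k1 :: a) (k2 :: b)
   + (if k1 == 1%N then hmul (res m 0 1 g) a (k2 :: b) else 0)).
  by rewrite gm // IH mulrA res_y_rwd //; case: (k1 == 1%N); ring.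
rewrite !hmul_cons !mulrDr !mulr_sumr.
have -> : \sum_(t <- hrev a (k2 :: b)) m * res m 0 1 g (rwd (k1 :: t))
   = \sum_(t <- hrev a (k2 :: b)) g (rwd (k1 :: t))
     + (if k1 == 1%N then hmul (res m 0 1 g) a (k2 :: b) else 0).
  rewrite (eq_bigr _ (fun t _ => res_y_rwd g t um k1p)) big_split /=.
  by case: (k1 == 1%N) => //; rewrite big1_eq.
have -> : \sum_(t <- hrev (k1 :: a) b) m * res m 0 1 g (rwd (k2 :: t))
   = \sum_(t <- hrev (k1 :: a) b) g (rwd (k2 :: t)).
  apply: eq_bigr => t _; rewrite res_y_rwd ?(ltnW k2p) //.
  by rewrite (gtn_eqF k2p) addr0.
have -> : \sum_(t <- hrev a b) m * res m 0 1 g (rwd ((k1 + k2)%N :: t))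
   = \sum_(t <- hrev a b) g (rwd ((k1 + k2)%N :: t)).
  apply: eq_bigr => t _; rewrite res_y_rwd //; last by lia.
  by rewrite (_ : (k1 + k2 == 1)%N = false) ?addr0 //; lia.
by ring.
Qed.

(** The truncated multiple zeta values F_n: one factor [chi m] for each 0 < m < n, hence the shift,
    and the empty product for n = 0 and n = 1. *)
Fixpoint Ff (n : nat) : seq bool -> rat :=
  if n is m.+1 then if m is 0 then @onef rat else chi m%:R (Ff m) else @onef rat.

Lemma semi_char_Gh N n : (n < N)%N -> semi_char (Gh N n) (Ff n.+1).
Proof.
elim: n => [|n IH] nN.
  have [e1 e2] := is_char_onef rat; split => // a b pa pb; apply: e2 => //; exact: posn2.
apply: semi_char_chi; first exact: natU_rat.
by apply: semi_char_res_y; [rewrite unitfE natB_neq0 | apply: IH; lia].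
Qed.

(** * The recursion of Z_N along runs *)

Definition oif (b : bool) (x : rat) : rat := if b then x else 0.

Lemma lin1 (a b e f : rat) : a = b -> e - f = a - b -> e = f.
Proof. move=> -> h; lra. Qed.

Lemma lin2 (a b c d e f : rat) : a = b -> c = d -> e - f = (a - b) + (c - d) -> e = f.
Proof. move=> -> -> h; lra. Qed.

Section Scalar.
Variable N : nat.
Variable t : rat.
Hypothesis tN : t * N%:R = 1.

(** The arithmetic core of the recursion: 1/(d M) = (1/N) (1/d + 1/M) when d + M = N. It is applied
    to the y-denominator d = N - i and the x-denominator M = i of the same factor. *)
Lemma gap_step (d M q : rat) : d != 0 -> M != 0 -> d + M = N%:R ->
  q / d / M - t * (q / M) = t * (q / d).
Proof.
move=> d0 M0 e; rewrite -(mulr1 (q / d / M)) -tN -e; field; exact/andP.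
Qed.

(* [f] and [g] record the values on words with last runs y^a x^b and x^b; the first
   argument is the number of factors of the product defining Z_N. *)
Lemma gap_yx (f : nat -> nat -> nat -> rat) (g : nat -> nat -> rat) (o : nat -> rat) a :
  (0 < a)%N ->
  (forall m a b, (m.+1 < N)%N -> f m.+1 a b.+1 = f m a b.+1 + f m.+1 a b / m.+1%:R) ->
  (forall m, (m.+1 < N)%N ->
     f m.+1 a 0%N = f m a 0%N + (if a == 1%N then o m else f m.+1 a.-1 0%N) / (N%:R - m.+1%:R)) ->
  (forall m b, (m.+1 < N)%N -> g m.+1 b.+1 = g m b.+1 + g m.+1 b / m.+1%:R) ->
  (forall m, (m < N)%N -> g m.+1 0%N = f m a 0%N + oif (a == 1%N) (t * o m)) ->
  (forall a b, f 0%N a b.+1 = 0) -> f 0%N a 0%N = 0 ->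
  (forall b, g 0%N b.+1 = 0) ->
  forall b m, (0 < b)%N -> (m < N)%N ->
    f m a b - oif (1 < a)%N (t * f m a.-1 b) - oif (1 < b)%N (t * f m a b.-1)
     + oif ((a == 1%N) && (b == 1%N)) (t ^+ 2 * o m)
    = g m b + oif (b == 1%N) (t * g m.+1 0%N).
Proof.
move=> a0 F1 F2 G1 H2 f0 fa0 g0; case=> // b m _; elim: b m => [|b IHb] m mN.
  rewrite /oif andbT /= subr0; elim: m mN => [|m IHm] mN.
    rewrite !f0 g0 H2 // fa0 /oif.
    by case: (a == 1%N); case: (1 < a)%N; ring.
  have {}IHm := IHm (ltnW mN).
  have m0 : (m.+1%:R : rat) != 0 by rewrite pnatr_eq0.
  have d0 : (N%:R - m.+1%:R : rat) != 0 by rewrite natB_neq0.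
  have dM : N%:R - m.+1%:R + m.+1%:R = N%:R :> rat by rewrite subrK.
  rewrite (F1 _ a _ mN) (F1 _ a.-1 _ mN) (G1 _ _ mN) (H2 _ mN) (F2 _ mN).
  rewrite (H2 _ (ltnW mN)) in IHm *; rewrite /oif in IHm *.
  case: (ltngtP a 1%N) a0 IHm => // [a1|a1] _ IHm.
    have s := gap_step (f m.+1 a.-1 0%N) d0 m0 dM.
    apply: (lin2 IHm s); ring.
  have s := gap_step (o m) d0 m0 dM.
  apply: (lin2 IHm s); ring.
rewrite /= /oif andbF /= !addr0; elim: m mN => [|m IHm] mN.
  by rewrite !f0 g0; case: (1 < a)%N; case: b {IHb} => [|b]; rewrite ?f0 ?fa0; ring.
have {}IHm := IHm (ltnW mN); have {IHb} IHb := IHb _ mN.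
rewrite (F1 _ a b.+1 mN) (F1 _ a.-1 b.+1 mN) (G1 _ b.+1 mN).
have hX : t * f m.+1 a b.+1 = t * (f m a b.+1 + f m.+1 a b / m.+1%:R) by rewrite -F1.
(* The induction hypothesis in b, made uniform: when the x-run has length 1 its boundary terms
   cancel by [H2]. *)
have e0 : f m.+1 a b.+1 - oif (1 < a)%N (t * f m.+1 a.-1 b.+1) - t * f m.+1 a b = g m.+1 b.+1.
  move: IHb; case: b {IHm hX} => [|b]; last by rewrite /oif andbF /= !addr0.
  rewrite /oif andbT /= subr0 (H2 _ mN) /oif; case: (a == 1%N) => IHb; apply: (lin1 IHb); ring.
rewrite -{}e0 /oif in IHm *; case: (1 < a)%N IHm => IHm; apply: (lin2 IHm (esym hX)); ring.
Qed.

(** The counterpart of [gap_yx] for an x-run followed by a y-run. [F] and [G] belong to N + 1 and N;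
    comparing m.+1 factors with m makes the y-denominators agree, as (N + 1) - (m + 1) = N - m. *)
Lemma gap_xy (F : nat -> nat -> nat -> rat) (G : nat -> nat -> rat) (k : nat -> rat) b :
  (0 < b)%N ->
  (forall m, (m < N)%N -> F m.+1 b 0%N = F m b 0%N
     + (if b == 1%N then k m.+1 else F m.+1 b.-1 0%N) / m.+1%:R) ->
  (forall m b a, (m < N)%N -> F m.+1 b.+1 a.+1 = F m b.+1 a.+1
     + (if a == 0%N then F m b.+1 0%N else F m.+1 b.+1 a) / (N%:R - m%:R)) ->
  (forall m a, (m.+1 < N)%N -> G m.+1 a.+1 = G m a.+1
     + (if a == 0%N then G m 0%N else G m.+1 a) / (N%:R - m.+1%:R)) ->
  (forall m, (m < N)%N -> G m 0%N = F m b 0%N + oif (b == 1%N) (t * k m.+1)) ->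
  (forall b a, F 0%N b.+1 a = 0) -> (forall a, G 0%N a.+1 = 0) ->
  forall a m, (0 < a)%N -> (m < N)%N ->
    F m.+1 b a - oif (1 < b)%N (t * F m.+1 b.-1 a) - oif (1 < a)%N (t * F m.+1 b a.-1)
     + oif ((b == 1%N) && (a == 1%N)) (t ^+ 2 * k m.+1)
    = G m a + oif (a == 1%N) (t * G m 0%N).
Proof.
move=> b0 Fx Fy Gy H1 F0 G0.
have F1 b' a' : (0 < N)%N -> F 1%N b'.+1 a'.+1 = 0.
  move=> n0; elim: a' => [|a' IH]; rewrite Fy // !F0 ?IH /=; ring.
have Fyb m' a' : (m' < N)%N -> (1 < b)%N -> F m'.+1 b.-1 a'.+1
   = F m' b.-1 a'.+1 +
       (if a' == 0%N then F m' b.-1 0%N else F m'.+1 b.-1 a') / (N%:R - m'%:R).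
  by case: b {b0 Fx H1} => [|[|b']] // h _; rewrite Fy.
have {}Fy m' a' : (m' < N)%N -> F m'.+1 b a'.+1 = F m' b a'.+1
     + (if a' == 0%N then F m' b 0%N else F m'.+1 b a') / (N%:R - m'%:R).
  by case: b b0 {Fyb Fx H1} => // b' _; exact: Fy.
have {}F1 a : (0 < N)%N -> F 1%N b a.+1 = 0 /\ ((1 < b)%N -> F 1%N b.-1 a.+1 = 0).
  by move=> n0; case: b b0 {Fyb Fx H1 Fy} => // -[|b'] _; rewrite !F1.
have Fb0 : F 0%N b 0%N = 0 by case: b b0 {Fyb Fx H1 Fy F1} => // b' _; rewrite F0.
case=> // a m _; elim: a m => [|a IHa] m mN.
  rewrite /oif /= andbT subr0; elim: m mN => [|m IHm] mN.
    have [F1a F1b] := F1 0%N mN; rewrite F1a G0 H1 // Fb0.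
    case: (ltngtP b 1%N) b0 F1b => // [b1|b1] _; rewrite /oif /=; last by move=> _; ring.
    by move=> ->; ring.
  have {}IHm := IHm (ltnW mN).
  have m0 : (m.+1%:R : rat) != 0 by rewrite pnatr_eq0.
  have d0 : (N%:R - m.+1%:R : rat) != 0 by rewrite natB_neq0.
  have dM : N%:R - m.+1%:R + m.+1%:R = N%:R :> rat by rewrite subrK.
  rewrite (Fy _ _ mN) (Gy _ _ mN) (H1 _ mN) /=.
  have fx := Fx _ (ltnW mN).
  have h1 := H1 _ (ltnW mN).
  case: (ltngtP b 1%N) b0 IHm fx h1 => // [b1|b1] _; rewrite /oif /= => IHm fx h1.
    have s := gap_step (F m.+1 b.-1 0%N) d0 m0 dM.
    rewrite (Fyb _ _ mN b1) fx h1 /=; rewrite h1 in IHm.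
    apply: (lin2 IHm s); ring.
  have s := gap_step (k m.+1) d0 m0 dM.
  rewrite fx h1 /=; rewrite h1 in IHm.
  apply: (lin2 IHm s); ring.
rewrite /= /oif andbF /= !addr0; elim: m mN => [|m IHm] mN.
  have [-> F1b] := F1 a.+1 mN; have [e _] := F1 a mN; rewrite e G0.
  case: (ltngtP b 1%N) b0 F1b => // [b1|b1] _; last by move=> _; ring.
  by move=> ->; ring.
have {}IHm := IHm (ltnW mN); have {}IHa := IHa _ mN.
have hX : t * F m.+2 b a.+1 = t * (F m.+1 b a.+1 + (if a == 0%N then F m.+1 b 0%N else F m.+2 b a) / (N%:R - m.+1%:R)).
  by rewrite -Fy.
have e0 : F m.+2 b a.+1 - oif (1 < b)%N (t * F m.+2 b.-1 a.+1)
     - t * (if a == 0%N then F m.+1 b 0%N else F m.+2 b a) = G m.+1 a.+1.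
  move: IHa; case: a {IHm hX} => [|a]; last by rewrite /oif andbF /= !addr0.
  have fx := Fx _ mN; have h1 := H1 _ mN.
  rewrite /oif andbT /= subr0 h1 /oif; case: (b == 1%N) => IHa; apply: (lin1 IHa); ring.
rewrite (Fy _ _ mN) (Gy _ a.+1 mN) /=.
have hb : (1 < b)%N -> F m.+2 b.-1 a.+2 = F m.+1 b.-1 a.+2 + F m.+2 b.-1 a.+1 / (N%:R - m.+1%:R).
  by move=> b1; rewrite Fyb.
rewrite -{}e0 /oif in IHm *.
case: (1 < b)%N hb IHm => [/(_ isT) ->|_] IHm; apply: (lin2 IHm (esym hX)); ring.
Qed.

(* The case of [gap_xy] where the x-run is absent. *)
Lemma gap_y (c d : nat -> nat -> rat) :
  (forall m a, (m < N)%N -> c m.+1 a.+1 = c m a.+1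
     + (if a == 0%N then 1 else c m.+1 a) / (N%:R - m%:R)) ->
  (forall m a, (m.+1 < N)%N -> d m.+1 a.+1 = d m a.+1
     + (if a == 0%N then 1 else d m.+1 a) / (N%:R - m.+1%:R)) ->
  (forall a, c 0%N a.+1 = 0) -> (forall a, d 0%N a.+1 = 0) ->
  forall a m, (0 < a)%N -> (m < N)%N ->
    c m.+1 a - oif (1 < a)%N (t * c m.+1 a.-1) = d m a + oif (a == 1%N) t.
Proof.
move=> Cy Dy c0 d0; case=> // a m _; elim: a m => [|a IHa] m mN.
  rewrite /oif /= subr0; elim: m mN => [|m IHm] mN.
    have n0 : (N%:R : rat) != 0 by rewrite pnatr_eq0 -lt0n.
    rewrite Cy // c0 d0 /= subr0 !add0r mul1r.
    by apply: (mulfI n0); rewrite divff // mulrC tN.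
  by rewrite (Cy _ _ mN) (Dy _ _ mN) (IHm (ltnW mN)) /=; ring.
rewrite /oif /= addr0; elim: m mN => [|m IHm] mN.
  rewrite Cy // c0 d0 /=; have := IHa _ mN; rewrite d0 => e.
  have n0 : (N%:R : rat) != 0 by rewrite pnatr_eq0 -lt0n.
  have eN : N%:R^-1 = t by apply: (mulfI n0); rewrite divff // mulrC tN.
  by rewrite subr0 add0r eN mulrC subrr.
have hX : t * c m.+2 a.+1 = t * (c m.+1 a.+1 + (if a == 0%N then 1 else c m.+2 a) / (N%:R - m.+1%:R)).
  by rewrite -Cy.
have e0 : c m.+2 a.+1 - t * (if a == 0%N then 1 else c m.+2 a) = d m.+1 a.+1.
  have := IHa _ mN; case: a {IHm IHa hX} => [|a]; rewrite /oif /= => e; apply: (lin1 e); ring.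
rewrite (Cy _ a.+1 mN) (Dy _ a.+1 mN) /= -e0.
apply: (lin2 (IHm (ltnW mN)) (esym hX)); ring.
Qed.
End Scalar.

(** * Deformation of words along pairs of adjacent runs *)

Arguments Vphi : simpl never.

(** The admissible treatments of two adjacent runs: keep both, shorten one of them, or delete both
    when each has length 1. Every affected run costs a factor t, and a shortening also a sign. *)
Definition pairsum (t : rat) (a b : nat) (F : nat -> nat -> rat) (G : rat) : rat :=
  F a b - oif (1 < a)%N (t * F a.-1 b) - oif (1 < b)%N (t * F a b.-1)
  + oif ((a == 1%N) && (b == 1%N)) (t ^+ 2 * G).

Lemma eq_pairsum t a b F F' G G' : (0 < a)%N -> (0 < b)%N ->
  (forall a' b', (0 < a')%N -> (0 < b')%N -> F a' b' = F' a' b') -> G = G' ->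
  pairsum t a b F G = pairsum t a b F' G'.
Proof.
move=> a0 b0 eF ->; rewrite /pairsum /oif eF //.
have -> : (if (1 < a)%N then t * F a.-1 b else 0) = if (1 < a)%N then t * F' a.-1 b else 0.
  by case: ifP => // a1; rewrite eF //; lia.
have -> : (if (1 < b)%N then t * F a b.-1 else 0) = if (1 < b)%N then t * F' a b.-1 else 0.
  by case: ifP => // b1; rewrite eF //; lia.
by [].
Qed.

Lemma pairsum_lin t a b c F F' G G' :
  pairsum t a b (fun x y => F x y + c * F' x y) (G + c * G')
  = pairsum t a b F G + c * pairsum t a b F' G'.
Proof. by rewrite /pairsum /oif; case: ifP; case: ifP; case: ifP => _ _ _; ring. Qed.

Local Notation X b := (nseq b false).
Local Notation Y a := (nseq a true).

(* [Ov t rc h] and [Ev t rc h] evaluate [h] on the deformed word of the reversed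
   run list [rc]; in [Ev] the last y-run is not yet followed by an x-run. *)
Fixpoint Ov (t : rat) (rc : seq nat) (h : seq bool -> rat) : rat :=
  match rc with
  | b :: a :: rc' => pairsum t a b (fun a' b' => Ov t rc' (fun w => h (X b' ++ Y a' ++ w)))
                       (Ov t rc' h)
  | _ => h [::]
  end.

Fixpoint Ev (t : rat) (rc : seq nat) (h : seq bool -> rat) : rat :=
  match rc with
  | [::] => h [::]
  | [:: a] => h (Y a) - oif (1 < a)%N (t * h (Y a.-1))
  | a :: b :: rc' => pairsum t b a (fun b' a' => Ev t rc' (fun w => h (Y a' ++ X b' ++ w)))
                       (Ev t rc' h)
  end.

Lemma seq2_ind (T : Type) (P : seq T -> Prop) : P [::] -> (forall x, P [:: x]) ->
  (forall x y s, P s -> P (x :: y :: s)) -> forall s, P s.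
Proof.
move=> P0 P1 P2 s; suff : P s /\ forall x, P (x :: s) by case.
by elim: s => [|y s [Ps IH]]; split=> // x; apply: P2.
Qed.

Lemma Ov_lin t rc c h h' : Ov t rc (fun w => h w + c * h' w) = Ov t rc h + c * Ov t rc h'.
Proof.
elim/seq2_ind: rc h h' => // b a rc IH h h' /=; rewrite -pairsum_lin.
by rewrite /pairsum !IH.
Qed.

Lemma Ev_lin t rc c h h' : Ev t rc (fun w => h w + c * h' w) = Ev t rc h + c * Ev t rc h'.
Proof.
elim/seq2_ind: rc h h' => // [a|a b rc IH] h h' /=.
  by rewrite /oif; case: ifP => _; ring.
by rewrite -pairsum_lin /pairsum !IH.
Qed.

(** [Ov] only meets words that are empty or end in x, and [Ev] below only words that end in y. This
    settles the case distinction of [Vphi_y]. *)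
Lemma eq_Ov t rc h h' : posn rc -> ~~ odd (size rc) ->
  (forall w, ~~ head false w -> h w = h' w) -> Ov t rc h = Ov t rc h'.
Proof.
elim/seq2_ind: rc h h' => [|x|b a rc IH] h h' //=; first by move=> _ _; apply.
rewrite negbK => /and3P[b0 a0 pr] od e; apply: eq_pairsum => // [a' b' a0' b0'|]; last exact: IH.
by apply: IH => // w hw; apply: e; case: b' b0'.
Qed.

Lemma eq_Ev t rc h h' : posn rc -> odd (size rc) ->
  (forall w, head false w -> h w = h' w) -> Ev t rc h = Ev t rc h'.
Proof.
elim/seq2_ind: rc h h' => [|a|a b rc IH] h h' //=.
  move=> /andP[a0 _] _ e; rewrite e; last by case: a a0.
  by rewrite /oif; case: ifP => // a1; rewrite e //; case: a a1 {a0} => // -[].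
rewrite negbK => /and3P[a0 b0 pr] od e; apply: eq_pairsum => // [b' a' b0' a0'|]; last exact: IH.
by apply: IH => // w hw; apply: e; case: a' a0'.
Qed.

Lemma Ov0 t rc h : (forall w, h w = 0) -> Ov t rc h = 0.
Proof.
elim/seq2_ind: rc h => [|x|b a rc IH] h e //=.
rewrite /pairsum !IH // /oif; case: ifP; case: ifP; case: ifP => _ _ _; ring.
Qed.

Lemma Ev0 t rc h : (forall w, h w = 0) -> Ev t rc h = 0.
Proof.
elim/seq2_ind: rc h => [|a|a b rc IH] h e //=.
  by rewrite !e /oif; case: ifP => _; ring.
rewrite /pairsum !IH // /oif; case: ifP; case: ifP; case: ifP => _ _ _; ring.
Qed.

(** Once a y is split off from the last y-factor, what remains may use that y-factor but not the
    x-factor after it. On a word ending in y this is the product with n+1 pairs of factors,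
    otherwise the one with n. *)
Lemma Vphi_y N n u : (n.+1 < N)%N ->
  Vphi N n.+1 (true :: u) = Vphi N n (true :: u)
    + (if head false u then Vphi N n.+1 u else Vphi N n u) / (N%:R - n.+1%:R).
Proof.
move=> nN; have n0 : (n.+1%:R : rat) != 0 by rewrite pnatr_eq0.
have s0 := natB_neq0 nN.
have un := natU_rat (ltn0Sn n).
have us : (N%:R - n.+1%:R : rat) \is a GRing.unit by rewrite unitfE.
set g := Vphi N n; set e := res (N%:R - n.+1%:R) 0 1 g.
have E v : Vphi N n.+1 v = (N%:R - n.+1%:R) * (n.+1%:R * res n.+1%:R 1 0 e v).
  rewrite /Vphi -/Vphi -/g -/e; ring.
have E1 v : Vphi N n.+1 (true :: v) = (N%:R - n.+1%:R) * e (true :: v).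
  by rewrite E resE //= mul0r addr0.
have E2 v : (N%:R - n.+1%:R) * e (true :: v) = g (true :: v) + e v.
  by rewrite /e resE //= mul1r.
rewrite E1 E2; congr (_ + _).
have E3 v : ~~ head false v -> e v = g v / (N%:R - n.+1%:R).
  by move=> hv; apply: (mulfI s0); rewrite resE // mulrC divfK //; case: v hv => [|[] v] //= _; rewrite ?mul0r addr0.
case: ifP => hu; last by rewrite E3 ?hu.
by case: u hu => [|[] u] //= _; rewrite E1 mulrC mulKr.
Qed.

Section Recursion.
Variable N : nat.
Hypothesis N0 : (0 < N)%N.
Let t : rat := N%:R^-1.
Let tN : t * N%:R = 1.
Proof. by rewrite /t mulVf // pnatr_eq0 -lt0n. Qed.

(** The x-denominators for N and N + 1 agree at equal numbers of factors, the y-denominators after a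
    shift by one. Hence m is compared with m when an x-run is appended, and m with m.+1 in
    [append_y]. *)
Definition append_x u := forall b m, (0 < b)%N -> (m < N)%N ->
  Ov t (b :: u) (Vphi N m)
  = Ev t u (fun w => Vphi N.+1 m (X b ++ w)) + oif (b == 1%N) (t * Ev t u (Vphi N.+1 m.+1)).
Definition append_y v := forall a m, (0 < a)%N -> (m < N)%N ->
  Ev t (a :: v) (Vphi N.+1 m.+1)
  = Ov t v (fun w => Vphi N m (Y a ++ w)) + oif (a == 1%N) (t * Ov t v (Vphi N m)).

Lemma Vphi0_cat M b w : (0 < size b)%N -> Vphi M 0 (b ++ w) = 0.
Proof. by case: b. Qed.

Lemma subSS1 m : N.+1%:R - m.+1%:R = N%:R - m%:R :> rat.
Proof. by rewrite -!natr1; ring. Qed.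

Lemma append_y_nil : append_y [::].
Proof.
move=> a m a0 mN; rewrite /= !cats0.
rewrite Vphi_nil // mulr1.
apply: (gap_y tN (c := fun m a => Vphi N.+1 m (Y a)) (d := fun m a => Vphi N m (Y a))) => //.
- move=> {a0 mN}m {}a mN /=; rewrite Vphi_y // subSS1; congr (_ + _ / _).
  by case: a => //=; rewrite Vphi_nil //; lia.
- move=> {a0 mN}m {}a mN /=; rewrite Vphi_y //; congr (_ + _ / _).
  by case: a => //=; rewrite Vphi_nil //; lia.
Qed.

Lemma append_x_step a v : (0 < a)%N -> posn v -> ~~ odd (size v) -> append_y v -> append_x (a :: v).
Proof.
move=> a0 pv ev h2 b m b0 mN.
have av : posn (a :: v) by rewrite posn_cons a0.
have oav : odd (size (a :: v)) by [].
apply: (gap_yx tN (f := fun m a b => Ov t v (fun w => Vphi N m (X b ++ Y a ++ w)))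
  (g := fun m b => Ev t (a :: v) (fun w => Vphi N.+1 m (X b ++ w)))
  (o := fun m => Ov t v (Vphi N m))) => //.
- move=> {}m a' {b0}b {}mN; rewrite mulrC -Ov_lin; apply: eq_Ov => // w _.
  exact: Vphi_x.
- move=> {}m {}mN; case: a a0 {av oav} => // a _ /=.
  rewrite mulrC.
  rewrite (_ : (if a == 0%N then _ else _) = Ov t v (fun w => if head false (Y a ++ w) then Vphi N m.+1 (Y a ++ w) else Vphi N m (Y a ++ w))).
    rewrite -Ov_lin; apply: eq_Ov => // w hw /=; rewrite Vphi_y // mulrC //.
  case: a => [|a] //=.
  by apply: eq_Ov => // w /negbTE hw /=; rewrite hw.
- move=> {}m {b0}b {}mN; rewrite mulrC -Ev_lin; apply: eq_Ev => // w _.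
  by rewrite [X b.+1 ++ _]/= Vphi_x // ltnW.
- by move=> {}m {}mN; exact: (h2 a).
- by move=> a' b'; rewrite Ov0.
- by rewrite Ov0 // => w; rewrite /= Vphi0_cat // size_nseq.
- by move=> b'; rewrite Ev0.
Qed.

Lemma append_y_step b u : (0 < b)%N -> posn u -> odd (size u) -> append_x u -> append_y (b :: u).
Proof.
move=> b0 pu ou h1 a m a0 mN.
have pbu : posn (b :: u) by rewrite posn_cons b0.
have ebu : ~~ odd (size (b :: u)) by rewrite /= negbK.
apply: (gap_xy tN (F := fun m b a => Ev t u (fun w => Vphi N.+1 m (Y a ++ X b ++ w)))
  (G := fun m a => Ov t (b :: u) (fun w => Vphi N m (Y a ++ w)))
  (k := fun m => Ev t u (Vphi N.+1 m))) => //.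
- move=> {}m {}mN; case: b b0 {pbu ebu} => // b _ /=.
  rewrite mulrC (_ : (if b == 0%N then _ else _) = Ev t u (fun w => Vphi N.+1 m.+1 (X b ++ w))).
    by rewrite -Ev_lin; apply: eq_Ev => // w _; rewrite /= Vphi_x.
  by case: b.
- move=> {}m b' a' {}mN; rewrite mulrC.
  rewrite (_ : (if a' == 0%N then _ else _) = Ev t u (fun w => if head false (Y a' ++ X b'.+1 ++ w)
     then Vphi N.+1 m.+1 (Y a' ++ X b'.+1 ++ w) else Vphi N.+1 m (Y a' ++ X b'.+1 ++ w))).
    rewrite -Ev_lin; apply: eq_Ev => // w _.
    by rewrite [Y a'.+1 ++ _]/= Vphi_y // subSS1 mulrC.
  by case: a' => [|a'].
- move=> {}m a' {}mN; rewrite mulrC.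
  rewrite (_ : (if a' == 0%N then _ else _) = Ov t (b :: u) (fun w => if head false (Y a' ++ w) then Vphi N m.+1 (Y a' ++ w) else Vphi N m (Y a' ++ w))).
    by rewrite -Ov_lin; apply: eq_Ov => // w _; rewrite [Y a'.+1 ++ _]/= Vphi_y // mulrC.
  case: a' => [|a'] //.
  by apply: eq_Ov => // w /negbTE hw /=; rewrite hw.
- by move=> {}m {}mN; exact: h1.
- by move=> b' a'; rewrite Ev0 // => w; rewrite catA Vphi0_cat // size_cat !size_nseq addnS.
- by move=> a'; rewrite Ov0.
Qed.

Lemma append_run rc : posn rc -> if odd (size rc) then append_x rc else append_y rc.
Proof.
elim: rc => [|x rc IH]; first by move=> _; exact: append_y_nil.
rewrite posn_cons => /andP[x0 pr]; have := IH pr; rewrite /=.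
case: ifP => o h; first exact: append_y_step.
by apply: append_x_step => //; rewrite o.
Qed.

Theorem Zf_recursion b u : (0 < b)%N -> posn u -> odd (size u) ->
  Ev t u (fun w => Zf N.+1 (X b ++ w)) - oif (1 < b)%N (t * Ev t u (fun w => Zf N.+1 (X b.-1 ++ w)))
  = Ov t (b :: u) (Zf N).
Proof.
move=> b0 pu ou; have := append_run pu; rewrite ou => h.
rewrite /Zf h //; last by rewrite prednK.
rewrite [N.+1.-1]/=.
case: b b0 => // b _ /=.
(* The last x-denominator for N + 1 is N = 1/t; its term is the shortening of the last x-run. *)
have -> : Ev t u (fun w => Vphi N.+1 N (false :: X b ++ w))
  = Ev t u (fun w => Vphi N.+1 N.-1 (false :: X b ++ w)) + t * Ev t u (fun w => Vphi N.+1 N (X b ++ w)).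
  rewrite -Ev_lin; apply: eq_Ev => // w _.
  by have := @Vphi_x N.+1 N.-1 (X b ++ w); rewrite (prednK N0); apply.
by rewrite (prednK N0); case: b => [|b]; rewrite /oif /=; ring.
Qed.
End Recursion.

(** * Choices of runs in the recursion of D *)

(* Every run is kept, deleted (index put in A) or shortened (index put in B);
   a triple (A, B, l) records the choices and the resulting run list l. *)
Local Notation choice := (seq nat * seq nat * seq nat)%type.
Definition keepc (x : nat) (q : choice) : choice := (q.1.1, q.1.2, x :: q.2).
Definition delc (i : nat) (q : choice) : choice := (i :: q.1.1, q.1.2, q.2).
Definition redc (i x : nat) (q : choice) : choice := (q.1.1, i :: q.1.2, x.-1 :: q.2).

Fixpoint chl (i : nat) (c : seq nat) : seq choice :=
  if c is x :: c' then
    let r := chl i.+1 c' in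
    map (keepc x) r ++ (if x == 1%N then map (delc i) r else [::])
      ++ (if (1 < x)%N then map (redc i x) r else [::])
  else [:: ([::], [::], [::])].

Definition onesf i c := [seq j <- iota i (size c) | nth 0%N c (j - i) == 1%N].
Definition bigsf i c := [seq j <- iota i (size c) | (1 < nth 0%N c (j - i))%N].
Definition argf i c (A B : seq nat) :=
  [seq (nth 0%N c (j - i) - (j \in B))%N | j <- iota i (size c) & j \notin A].

Lemma nth_shift x c i j : j \in iota i.+1 (size c) -> nth 0%N (x :: c) (j - i) = nth 0%N c (j - i.+1).
Proof. by rewrite mem_iota => /andP[ij _]; rewrite -(subnSK ij). Qed.

Lemma onesf_cons i x c : onesf i (x :: c) = (if x == 1%N then [:: i] else [::]) ++ onesf i.+1 c.
Proof.
rewrite /onesf /= subnn /=.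
rewrite (eq_in_filter (a2 := fun j => nth 0%N c (j - i.+1) == 1%N)); last by move=> j /(nth_shift x) ->.
by case: ifP.
Qed.

Lemma bigsf_cons i x c : bigsf i (x :: c) = (if (1 < x)%N then [:: i] else [::]) ++ bigsf i.+1 c.
Proof.
rewrite /bigsf /= subnn /=.
rewrite (eq_in_filter (a2 := fun j => 1 < nth 0%N c (j - i.+1))%N); last by move=> j /(nth_shift x) ->.
by case: ifP.
Qed.

Lemma subs_sub l A : A \in subs l -> {subset A <= l}.
Proof.
elim: l A => [|a l IH] A /=; first by rewrite inE => /eqP ->.
rewrite mem_cat => /orP[/mapP[A' /IH s ->]|/IH s] j.
  by rewrite !inE => /orP[->//|/s ->]; rewrite orbT.
by move/s; rewrite inE orbC => ->.
Qed.

Lemma argf_cons i x c A B : argf i (x :: c) A B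
  = (if i \in A then [::] else [:: (x - (i \in B))%N])
     ++ [seq (nth 0%N c (j - i.+1) - (j \in B))%N | j <- iota i.+1 (size c) & j \notin A].
Proof.
rewrite /argf /=; case: (i \in A) => /=; rewrite ?subnn; [|congr (_ :: _)];
  by apply/eq_in_map => j; rewrite mem_filter => /andP[_ /(nth_shift x) ->].
Qed.

Lemma argf_skip i c A A' B B' :
  (forall j, (i <= j)%N -> (j \in A) = (j \in A') /\ (j \in B) = (j \in B')) ->
  argf i c A B = argf i c A' B'.
Proof.
move=> e; rewrite /argf.
rewrite (eq_in_filter (a2 := fun j => j \notin A')).
  by apply/eq_in_map => j; rewrite mem_filter mem_iota => /andP[_ /andP[/e [_ ->]]].
by move=> j; rewrite mem_iota => /andP[/e [->]].
Qed.

Lemma mem_onesf i c j : j \in onesf i c -> (i <= j)%N.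
Proof. by rewrite mem_filter mem_iota => /and3P[]. Qed.
Lemma mem_bigsf i c j : j \in bigsf i c -> (i <= j)%N.
Proof. by rewrite mem_filter mem_iota => /and3P[]. Qed.

(** A run of length 1 can only lie in A and a longer one only in B, so the double sum over A and B
    is a single enumeration of choices run by run. *)
Lemma chl_perm i c :
  perm_eq [seq (A, B, argf i c A B) | A <- subs (onesf i c), B <- subs (bigsf i c)] (chl i c).
Proof.
elim: c i => [|x c IH] i //.
have sO A j : A \in subs (onesf i.+1 c) -> j \in A -> (i < j)%N.
  by move=> /subs_sub s /s /mem_onesf.
have sB B j : B \in subs (bigsf i.+1 c) -> j \in B -> (i < j)%N.
  by move=> /subs_sub s /s /mem_bigsf.
have nO A : A \in subs (onesf i.+1 c) -> i \notin A.
  by move=> h; apply/negP => /(sO _ _ h); rewrite ltnn.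
have nB B : B \in subs (bigsf i.+1 c) -> i \notin B.
  by move=> h; apply/negP => /(sB _ _ h); rewrite ltnn.
set L := [seq (A, B, argf i.+1 c A B) | A <- subs (onesf i.+1 c), B <- subs (bigsf i.+1 c)].
have keepE : [seq (A, B, argf i (x :: c) A B) | A <- subs (onesf i.+1 c), B <- subs (bigsf i.+1 c)]
   = map (keepc x) L.
  rewrite map_allpairs; apply/eq_in_allpairs => A B hA hB.
  by rewrite argf_cons (negbTE (nO _ hA)) (negbTE (nB _ hB)) subn0.
have step (s : seq choice) (f : choice -> choice) : perm_eq s (map f L) -> perm_eq s (map f (chl i.+1 c)).
  by move=> h; apply: perm_trans h _; apply: perm_map; apply: IH.
rewrite onesf_cons bigsf_cons [chl _ _]/=.
have [x1|x1] := eqVneq x 1%N.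
  rewrite x1 /= allpairs_cat allpairs_mapl cats0 perm_catC.
  rewrite x1 in keepE; apply: perm_cat; first by apply: step; rewrite keepE.
  apply: step; rewrite map_allpairs; apply/permP => P; congr (count P _).
  apply/eq_in_allpairs => A B hA hB.
  rewrite argf_cons inE eqxx /=; congr (_, _, _).
  apply: argf_skip => j ij; split=> //; rewrite inE gtn_eqF //.
rewrite cat0s; case: ifP => x2 /=; last by rewrite !cats0; apply: step; rewrite keepE.
rewrite (perm_allpairs_catr _ _ (fun=> map (cons i) _)).
rewrite perm_catC; apply: perm_cat; first by apply: step; rewrite keepE.
apply: step; rewrite allpairs_mapr map_allpairs; apply/permP => P; congr (count P _).
apply/eq_in_allpairs => A B hA hB.
rewrite argf_cons (negbTE (nO _ hA)) inE eqxx /= subn1; congr (_, _, _ :: _).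
apply: argf_skip => j ij; split=> //; rewrite inE gtn_eqF //.
Qed.

(* Deletions must come in pairs {i, i+1} with i of parity [p]; a pair must not be
   shortened at both ends. *)
Definition paired (p : bool) (A : seq nat) :=
  all (fun i => if odd i == p then i.+1 \in A else i.-1 \in A) A.
Definition unpaired (p : bool) (B : seq nat) :=
  all (fun j => (odd j != p) || (j.+1 \notin B)) B.
Definition admis p (q : choice) := paired p q.1.1 && unpaired p q.1.2.
Definition wgt (t : rat) (q : choice) : rat :=
  (-1) ^+ size q.1.2 * t ^+ (size q.1.1 + size q.1.2).

Definition csum t p i c (g : seq nat -> rat) : rat :=
  \sum_(q <- chl i c | admis p q) wgt t q * g q.2.

Lemma chl_ge i c q : q \in chl i c -> all (leq i) q.1.1 && all (leq i) q.1.2.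
Proof.
elim: c i q => [|x c IH] i q /=; first by rewrite inE => /eqP ->.
have W l : all (leq i.+1) l -> all (leq i) l by apply: sub_all => j /ltnW.
rewrite !mem_cat => /or3P[/mapP[q' /IH /andP[h1 h2] ->]| |] /=; first by rewrite !W.
  by case: eqP => // _ /mapP[q' /IH /andP[h1 h2] ->] /=; rewrite leqnn !W.
by case: ifP => // _ /mapP[q' /IH /andP[h1 h2] ->] /=; rewrite leqnn !W.
Qed.

Lemma notin_ge i j l : all (leq i) l -> (j < i)%N -> j \notin l.
Proof. by move=> /allP h ji; apply/negP => /h; rewrite leqNgt ji. Qed.

Lemma paired_skip p i A : all (leq i.+2) A -> odd i = p -> paired p (i :: i.+1 :: A) = paired p A.
Proof.
move=> hA op; rewrite /paired /= op eqxx !inE eqxx /= orbT /=.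
have -> : (~~ p == p) = false by case: p {op}.
rewrite eqxx /=; apply: eq_in_all => j jA; have ij := allP hA _ jA.
rewrite !inE; case: ifP => jp.
  have -> : (j.+1 == i) = false by lia.
  by have -> : (j.+1 == i.+1) = false by lia.
have -> : (j.-1 == i) = false by move: (ij : (i.+2 <= j)%N); lia.
have -> // : (j.-1 == i.+1) = false.
apply/negP => /eqP e; have ej : j = i.+2 by move: (ij : (i.+2 <= j)%N); lia.
by move: jp; rewrite ej /= negbK op eqxx.
Qed.

Lemma paired_no_first p i A : all (leq i.+2) A -> odd i = p -> paired p (i :: A) = false.
Proof.
by move=> hA op; rewrite /paired /= op eqxx inE gtn_eqF //= (negbTE (notin_ge hA (leqnn _))).
Qed.

Lemma paired_no_second p i A : all (leq i.+1) A -> odd i != p -> (0 < i)%N -> paired p (i :: A) = false.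
Proof.
move=> hA op i0; rewrite /paired /= (negbTE op) inE.
have -> : (i.-1 == i) = false by lia.
by rewrite (negbTE (notin_ge hA _)) //; lia.
Qed.

Lemma unpaired_cons p i B : all (leq i.+1) B ->
  unpaired p (i :: B) = ((odd i != p) || (i.+1 \notin B)) && unpaired p B.
Proof.
move=> hB; rewrite /unpaired /= inE gtn_eqF //=; congr (_ && _).
apply: eq_in_all => j jB; have ij := allP hB _ jB.
by rewrite inE (_ : (j.+1 == i) = false) //; lia.
Qed.

(* [Ov] for run lists that are not reversed. *)
Fixpoint OL (t : rat) (c : seq nat) (g : seq nat -> rat) : rat :=
  match c with
  | x :: y :: c' => pairsum t x y (fun x' y' => OL t c' (fun l => g (x' :: y' :: l))) (OL t c' g)
  | _ => g [::]
  end.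

Lemma chl_big (f : choice -> rat) i x c : \sum_(q <- chl i (x :: c)) f q
  = \sum_(q <- chl i.+1 c) f (keepc x q)
    + oif (x == 1%N) (\sum_(q <- chl i.+1 c) f (delc i q))
    + oif (1 < x)%N (\sum_(q <- chl i.+1 c) f (redc i x q)).
Proof.
rewrite /= !big_cat big_map /= -addrA /oif; congr (_ + (_ + _)).
  by case: ifP => _; rewrite ?big_nil ?big_map.
by case: ifP => _; rewrite ?big_nil ?big_map.
Qed.

(** Of the nine choices for two partnered runs, five violate the pairing conditions; the other four
    are the terms of [pairsum]. *)
Lemma csum_pair t p i x y d g : (0 < x)%N -> (0 < y)%N -> odd i = p ->
  csum t p i (x :: y :: d) g
  = pairsum t x y (fun x' y' => csum t p i.+2 d (fun l => g (x' :: y' :: l))) (csum t p i.+2 d g).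
Proof.
move=> x0 y0 op.
have ge q : q \in chl i.+2 d -> [/\ all (leq i.+2) q.1.1, all (leq i.+2) q.1.2, all (leq i.+1) q.1.1 & all (leq i.+1) q.1.2].
  by move=> /chl_ge /andP[h1 h2]; split=> //; [move: h1|move: h2]; apply: sub_all => j /ltnW.
pose f (q : choice) := if admis p q then wgt t q * g q.2 else 0.
have csE j c h : csum t p j c h = \sum_(q <- chl j c) (if admis p q then wgt t q * h q.2 else 0).
  by rewrite /csum big_mkcond.
have oip : odd i.+1 != p by rewrite /= op; case: p {op f csE}.
have KK : \sum_(q <- chl i.+2 d) f (keepc x (keepc y q)) = csum t p i.+2 d (fun l => g (x :: y :: l)).
  by rewrite csE.
have KD : \sum_(q <- chl i.+2 d) f (keepc x (delc i.+1 q)) = 0.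
  rewrite big_seq big1 // => q /ge[h1 _ _ _]; rewrite /f /admis /= paired_no_second //.
have KR : \sum_(q <- chl i.+2 d) f (keepc x (redc i.+1 y q)) = - t * csum t p i.+2 d (fun l => g (x :: y.-1 :: l)).
  rewrite csE mulr_sumr; apply: eq_big_seq => q /ge[h1 h2 h3 h4].
  rewrite /f /admis /= unpaired_cons // oip /=; case: ifP => _; rewrite ?mulr0 //.
  by rewrite /wgt /= addnS !exprS; ring.
have DK : \sum_(q <- chl i.+2 d) f (delc i (keepc y q)) = 0.
  by rewrite big_seq big1 // => q /ge[h1 _ _ _]; rewrite /f /admis /= paired_no_first.
have DD : \sum_(q <- chl i.+2 d) f (delc i (delc i.+1 q)) = t ^+ 2 * csum t p i.+2 d g.
  rewrite csE mulr_sumr; apply: eq_big_seq => q /ge[h1 h2 h3 h4].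
  rewrite /f /admis /= paired_skip //; case: ifP => _; rewrite ?mulr0 //.
  by rewrite /wgt /= !addSn !exprS; ring.
have DR : \sum_(q <- chl i.+2 d) f (delc i (redc i.+1 y q)) = 0.
  by rewrite big_seq big1 // => q /ge[h1 _ _ _]; rewrite /f /admis /= paired_no_first.
have RK : \sum_(q <- chl i.+2 d) f (redc i x (keepc y q)) = - t * csum t p i.+2 d (fun l => g (x.-1 :: y :: l)).
  rewrite csE mulr_sumr; apply: eq_big_seq => q /ge[h1 h2 h3 h4].
  rewrite /f /admis /= unpaired_cons // (notin_ge h2) // orbT /=; case: ifP => _; rewrite ?mulr0 //.
  by rewrite /wgt /= addnS !exprS; ring.
have RD : \sum_(q <- chl i.+2 d) f (redc i x (delc i.+1 q)) = 0.
  by rewrite big_seq big1 // => q /ge[h1 _ _ _]; rewrite /f /admis /= paired_no_second.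
have RR : \sum_(q <- chl i.+2 d) f (redc i x (redc i.+1 y q)) = 0.
  rewrite big_seq big1 // => q /ge[h1 h2 h3 h4]; rewrite /f /admis /=.
  by rewrite unpaired_cons /= ?leqnn // op eqxx inE eqxx /= andbF.
have -> : csum t p i (x :: y :: d) g = \sum_(q <- chl i (x :: y :: d)) f q by rewrite csE.
rewrite chl_big (chl_big (fun q => f (keepc x q))) (chl_big (fun q => f (delc i q))).
rewrite (chl_big (fun q => f (redc i x q))) KK KD KR DK DD DR RK RD RR /pairsum /oif.
case: (ltngtP x 1%N) x0 => // _ _; case: (ltngtP y 1%N) y0 => // _ _ /=; ring.
Qed.

Lemma csum_OL t p i m d g : posn m -> ~~ odd (size m) -> odd i = p ->
  csum t p i (m ++ d) g = OL t m (fun l => csum t p (i + size m) d (fun l' => g (l ++ l'))).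
Proof.
elim/seq2_ind: m i g => [|x|x y m IH] i g //=; first by rewrite addn0.
rewrite negbK => /and3P[x0 y0 pm] em oi; rewrite csum_pair //.
have e2 : (i + (size m).+2)%N = (i.+2 + size m)%N by lia.
have oi2 : odd i.+2 = p by rewrite /= negbK.
rewrite e2; apply: eq_pairsum => // [x' y' _ _|]; exact: IH.
Qed.

Lemma csum_last t p i b g : (0 < b)%N -> odd i = p ->
  csum t p i [:: b] g = g [:: b] - oif (1 < b)%N (t * g [:: b.-1]).
Proof.
move=> b0 oi; rewrite /csum big_mkcond chl_big /= !big_seq1 /admis /=.
rewrite (@paired_no_first p i [::]) // unpaired_cons // in_nil orbT /= /wgt /= /oif.
by case: (ltngtP b 1%N) b0 => // _ _; rewrite ?(expr0, expr1); ring.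
Qed.

Lemma eq_OL t m g g' : (forall l, g l = g' l) -> OL t m g = OL t m g'.
Proof.
move=> e; elim/seq2_ind: m g g' e => [|x|x y m IH] g g' e //=.
by rewrite /pairsum !(IH _ _ (fun l => e _)).
Qed.

Lemma csum_O t c g : posn c -> ~~ odd (size c) -> csum t true 1 c g = OL t c g.
Proof.
move=> pc ec; rewrite -{1}(cats0 c) csum_OL //; apply: eq_OL => l.
by rewrite /csum big_mkcond big_seq1 /= /wgt /= ?expr0 ?mul1r cats0.
Qed.

Lemma csum_first t a c g : (0 < a)%N ->
  csum t false 1 (a :: c) g
  = csum t false 2 c (fun l => g (a :: l)) - oif (1 < a)%N (t * csum t false 2 c (fun l => g (a.-1 :: l))).
Proof.
move=> a0; rewrite /csum big_mkcond chl_big /= /oif.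
(* For this parity the partner of run 1 would be run 0, so run 1 cannot be deleted. *)
have D0 : \sum_(q <- chl 2 c) (if admis false (delc 1 q) then wgt t (delc 1 q) * g q.2 else 0) = 0.
  rewrite big_seq big1 // => q /chl_ge /andP[h1 _].
  rewrite /admis /= {1}/paired /= inE /=.
  by rewrite (negbTE (notin_ge h1 _)).
have R : \sum_(q <- chl 2 c) (if admis false (redc 1 a q) then wgt t (redc 1 a q) * g (a.-1 :: q.2) else 0)
  = - (t * csum t false 2 c (fun l => g (a.-1 :: l))).
  rewrite /csum mulr_sumr [in RHS]big_mkcond -sumrN /=; apply: eq_big_seq => q /chl_ge /andP[_ h2].
  rewrite /admis /= unpaired_cons //=; case: ifP => _; rewrite ?mulr0 ?oppr0 //.
  by rewrite /wgt /= addnS !exprS; ring.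
rewrite D0 R /csum [in RHS]big_mkcond /=.
by case: (ltngtP a 1%N) a0 => // _ _; ring.
Qed.

Lemma csum_E t a m b g : (0 < a)%N -> (0 < b)%N -> posn m -> ~~ odd (size m) ->
  csum t false 1 (a :: m ++ [:: b]) g
  = OL t m (fun l => g (a :: l ++ [:: b]) - oif (1 < b)%N (t * g (a :: l ++ [:: b.-1])))
    - oif (1 < a)%N (t * OL t m (fun l => g (a.-1 :: l ++ [:: b])
         - oif (1 < b)%N (t * g (a.-1 :: l ++ [:: b.-1])))).
Proof.
move=> a0 b0 pm em; rewrite csum_first // !csum_OL //.
have ev : odd (2 + size m) = false by rewrite /= negbK; exact: negbTE.
have E h : OL t m (fun l => csum t false (2 + size m) [:: b] (fun l' => h (l ++ l')))
   = OL t m (fun l => h (l ++ [:: b]) - oif (1 < b)%N (t * h (l ++ [:: b.-1]))).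
  by apply: eq_OL => l; rewrite csum_last.
by rewrite (E (fun l => g (a :: l))) (E (fun l => g (a.-1 :: l))).
Qed.

(* The reversed word with reversed run list [rc], whose last run consists of letters [s]. *)
Fixpoint rwf (s : bool) (rc : seq nat) : seq bool :=
  if rc is k :: r then nseq k s ++ rwf (~~ s) r else [::].

Lemma OL_lin t m c g g' : OL t m (fun l => g l + c * g' l) = OL t m g + c * OL t m g'.
Proof.
elim/seq2_ind: m g g' => [|x|x y m IH] g g' //=.
by rewrite -pairsum_lin /pairsum !IH.
Qed.

Lemma OL_cat t m x y g : ~~ odd (size m) ->
  OL t (m ++ [:: x; y]) g
  = OL t m (fun l => pairsum t x y (fun x' y' => g (l ++ [:: x'; y'])) (g l)).
Proof.
elim/seq2_ind: m g => [|z|z z' m IH] g //=.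
by rewrite negbK => em; rewrite /pairsum !IH.
Qed.

Lemma OL_pairsum t m x y (F : nat -> nat -> seq nat -> rat) G :
  OL t m (fun l => pairsum t x y (fun x' y' => F x' y' l) (G l))
  = pairsum t x y (fun x' y' => OL t m (F x' y')) (OL t m G).
Proof.
have D g g' : OL t m (fun l => g l + g' l) = OL t m g + OL t m g'.
  by have := OL_lin t m 1 g g'; rewrite mul1r => <-; apply: eq_OL => l; rewrite mul1r.
have Z c g : OL t m (fun l => c * g l) = c * OL t m g.
  transitivity (OL t m (fun l => g l + (c - 1) * g l)); first by apply: eq_OL => l; ring.
  by rewrite OL_lin; ring.
pose w (b : bool) c : rat := if b then c else 0.
have E (f : nat -> nat -> rat) g0 : pairsum t x y f g0 = f x y + (w (1 < x)%N (- t) * f x.-1 y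
    + (w (1 < y)%N (- t) * f x y.-1 + w ((x == 1%N) && (y == 1%N)) (t ^+ 2) * g0)).
  by rewrite /pairsum /oif /w; case: ifP; case: ifP; case: ifP => *; ring.
rewrite E -!Z -!D; apply: eq_OL => l; exact: E.
Qed.

Lemma rev_pairs_ind (P : seq nat -> Prop) : P [::] ->
  (forall m x y, ~~ odd (size m) -> P m -> P (m ++ [:: x; y])) ->
  forall m, ~~ odd (size m) -> P m.
Proof.
move=> P0 PS m; have [n] := ubnP (size m); elim: n m => // n IH m.
case/lastP: m => [|m y] //; case/lastP: m => [|m x] //.
rewrite !size_rcons /= negbK => sz em.
rewrite -!cats1 -catA; apply: PS => //; apply: IH => //; lia.
Qed.

Lemma eq_pairsum' t x y F F' G G' : (forall a b, F a b = F' a b) -> G = G' ->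
  pairsum t x y F G = pairsum t x y F' G'.
Proof. by move=> e ->; rewrite /pairsum !e. Qed.

Lemma OL_Ov t c h : ~~ odd (size c) ->
  OL t c (fun l => h (rwf false (rev l))) = Ov t (rev c) h.
Proof.
move=> ec; elim/rev_pairs_ind: ec h => // m x y em IH h.
rewrite rev_cat [rev [:: x; y]]/rev /= OL_cat // OL_pairsum.
apply: eq_pairsum'; last exact: IH.
move=> x' y'; rewrite -IH; apply: eq_OL => l.
by rewrite rev_cat.
Qed.

Lemma OL_Ev t a m h : ~~ odd (size m) ->
  OL t m (fun l => h (rwf true (rev (a :: l))))
    - oif (1 < a)%N (t * OL t m (fun l => h (rwf true (rev (a.-1 :: l)))))
  = Ev t (rev (a :: m)) h.
Proof.
move=> em; elim/rev_pairs_ind: em h => [|m' x y em IH] h.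
  by rewrite /= /rev /= !cats0.
have -> : rev (a :: m' ++ [:: x; y]) = y :: x :: rev (a :: m').
  by rewrite -cat_cons rev_cat.
rewrite /= -/Ev !OL_cat // !OL_pairsum.
have S (F F' : nat -> nat -> rat) G G' : pairsum t x y F G - oif (1 < a)%N (t * pairsum t x y F' G')
  = pairsum t x y (fun u v => F u v - oif (1 < a)%N (t * F' u v)) (G - oif (1 < a)%N (t * G')).
  by rewrite /pairsum /oif; case: ifP; case: ifP; case: ifP; case: ifP => *; ring.
rewrite S; apply: eq_pairsum'; last exact: IH.
move=> x' y'; rewrite -IH; congr (_ - _); first by apply: eq_OL => l; rewrite -cat_cons rev_cat.
rewrite /oif; case: ifP => // _; congr (_ * _).
by apply: eq_OL => l; rewrite -cat_cons rev_cat.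
Qed.

(** [Zf_recursion] in terms of choices: parity [true] pairs each y-run with the x-run after it, as
    [Ov] does; parity [false] pairs each x-run with the next y-run and leaves the first and last
    runs alone. *)
Theorem Zf_csum N c : (0 < N)%N -> posn c -> ~~ odd (size c) -> c != [::] ->
  csum N%:R^-1 false 1 c (fun l => Zf N.+1 (rwf false (rev l)))
  = csum N%:R^-1 true 1 c (fun l => Zf N (rwf false (rev l))).
Proof.
move=> N0 pc ec c0; rewrite csum_O // OL_Ov //.
case: c c0 pc ec => // a m _; case/lastP: m => // m b; rewrite -cats1.
move=> pc /=; rewrite size_cat addn1 /= negbK => em.
have /and3P[a0 pm b0] : [&& (0 < a)%N, posn m & (0 < b)%N].
  by move: pc; rewrite /posn /= all_cat /= andbT.
rewrite csum_E //.
have -> : rev (a :: m ++ [:: b]) = b :: rev (a :: m) by rewrite -cat_cons rev_cat.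
rewrite -Zf_recursion //; last 2 first.
- by rewrite /posn all_rev /= a0.
- by rewrite size_rev /= em.
have E a' : OL N%:R^-1 m (fun l => Zf N.+1 (rwf false (rev (a' :: l ++ [:: b])))
     - oif (1 < b)%N (N%:R^-1 * Zf N.+1 (rwf false (rev (a' :: l ++ [:: b.-1])))))
  = OL N%:R^-1 m (fun l => Zf N.+1 (X b ++ rwf true (rev (a' :: l))))
     - oif (1 < b)%N (N%:R^-1 * OL N%:R^-1 m (fun l => Zf N.+1 (X b.-1 ++ rwf true (rev (a' :: l))))).
  pose w : rat := if (1 < b)%N then - N%:R^-1 else 0.
  have W z : - oif (1 < b)%N (N%:R^-1 * z) = w * z by rewrite /oif /w; case: ifP => _; ring.
  rewrite W -OL_lin; apply: eq_OL => l; rewrite W.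
  by rewrite -!cat_cons !rev_cat.
rewrite !E -!OL_Ev // /oif; case: ifP => _; case: ifP => _; ring.
Qed.

(** * F_N(D(w)) = Z_N(w) *)

Definition ext (h : seq bool -> rat) (p : Hpol) : rat := \sum_(u <- p) u.1 * h u.2.

Lemma ext_cat h p q : ext h (p ++ q) = ext h p + ext h q.
Proof. exact: big_cat. Qed.

Lemma ext_flatten h s : ext h (flatten s) = \sum_(p <- s) ext h p.
Proof. by elim: s => [|p s IH] /=; rewrite ?big_nil ?big_cons ?ext_cat ?IH // /ext big_nil. Qed.

Lemma ext_scale h c p : ext h (Defs.scale c p) = c * ext h p.
Proof. by rewrite /ext big_map mulr_sumr; apply: eq_bigr => u _ /=; rewrite mulrA. Qed.

Lemma ext_mulw h p v : ext h (mulw p v) = ext (fun w => h (w ++ v)) p.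
Proof. by rewrite /ext big_map. Qed.

Lemma ext_lin h h' c p : ext (fun w => h w + c * h' w) p = ext h p + c * ext h' p.
Proof. by rewrite /ext mulr_sumr -big_split /=; apply: eq_bigr => u _; ring. Qed.

Lemma even_oddE A : even_odd A = paired false A.
Proof. by apply: eq_all => i; case: (odd i). Qed.
Lemma odd_evenE A : odd_even A = paired true A.
Proof. by apply: eq_all => i; case: (odd i). Qed.

Lemma big_chl (P : pred (seq nat)) (Q : seq nat -> seq nat -> bool)
    (G : seq nat -> seq nat -> seq nat -> rat) c :
  \sum_(A <- [seq A <- subs (onesf 1 c) | P A]) \sum_(B <- [seq B <- subs (bigsf 1 c) | Q A B])
     G A B (argf 1 c A B)
  = \sum_(q <- chl 1 c | P q.1.1 && Q q.1.1 q.1.2) G q.1.1 q.1.2 q.2.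
Proof.
rewrite -(perm_big _ (chl_perm 1 c)) big_flatten big_map big_filter [LHS]big_mkcond /=.
apply: eq_bigr => A _; rewrite big_map big_filter /=.
by case: (P A) => //=; rewrite big_pred0.
Qed.

Lemma chl_props i c q : q \in chl i c -> posn c ->
  posn q.2 /\ (sumn q.2 + (size q.1.1 + size q.1.2) = sumn c)%N.
Proof.
elim: c i q => [|x c IH] i q /=; first by rewrite inE => /eqP ->.
move=> qin /andP[x0 pc]; move: qin; rewrite !mem_cat => /or3P[/mapP[q' /IH h ->]| |] /=.
- by have [h1 h2] := h pc; rewrite x0; split; [exact: h1 | by rewrite /= -addnA h2].
- case: eqP => // x1 /mapP[q' /IH h ->] /=.
  by have [h1 h2] := h pc; split; [exact: h1 | rewrite x1 addSn addnS h2].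
- case: ifP => // x1 /mapP[q' /IH h ->] /=.
  have [h1 h2] := h pc; split; last first.
    by rewrite !addnS -addnA h2 -addSn prednK.
  by rewrite -subn1 subn_gt0 x1; exact: h1.
Qed.

Lemma chl_nonempty c q : q \in chl 1 c -> c != [::] -> paired false q.1.1 -> q.2 != [::].
Proof.
case: c => // x c /=; rewrite !mem_cat => /or3P[/mapP[q' _ ->]| |] //.
  case: eqP => // x1 /mapP[q' /chl_ge /andP[h1 _] ->] _ /=.
  by rewrite /paired /= inE /= (negbTE (notin_ge h1 _)).
by case: ifP => // x1 /mapP[q' _ ->].
Qed.

Lemma chl_lt i c q : q \in chl i c -> all (fun j => (j < i + size c)%N) q.1.2.
Proof.
elim: c i q => [|x c IH] i q /=; first by rewrite inE => /eqP ->.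
rewrite !mem_cat => /or3P[/mapP[q' /IH h ->]| |] /=; first by rewrite addnS.
  by case: eqP => // x1 /mapP[q' /IH h ->] /=; rewrite addnS.
by case: ifP => // x1 /mapP[q' /IH h ->] /=; rewrite addnS h andbT; lia.
Qed.

Definition condB1 (s : nat) (B : seq nat) := all (fun r => ~~ (((2 * r)%N \in B) && ((2 * r).+1 \in B))) (iota 1 s.-1).
Definition condB3 (s : nat) (B : seq nat) := all (fun r => ~~ (((2 * r).-1 \in B) && ((2 * r)%N \in B))) (iota 1 s).

Lemma condB1E c q : q \in chl 1 c -> ~~ odd (size c) ->
  condB1 (size c)./2 q.1.2 = unpaired false q.1.2.
Proof.
move=> qc ec; have /andP[_ /allP ge1] := chl_ge qc; have /allP ltc := chl_lt qc.
apply/allP/allP => H.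
  move=> j jB; have [//|jo] := boolP (odd j); apply/negP => j1B.
  have := H j./2; rewrite mem_iota mul2n.
  have -> : j./2.*2 = j by rewrite -[RHS]odd_double_half (negbTE jo).
  rewrite jB j1B /= => h; apply: notF; apply: h.
  have := ltc _ j1B; have := ge1 _ jB; have := odd_double_half (size c); have := odd_double_half j.
  by rewrite (negbTE jo) (negbTE ec) -!mul2n; lia.
move=> r; rewrite mem_iota => r1; apply/negP => /andP[h1 h2].
by have := H _ h1; rewrite h2 oddM.
Qed.

Lemma condB3E c q : q \in chl 1 c -> ~~ odd (size c) ->
  condB3 (size c)./2 q.1.2 = unpaired true q.1.2.
Proof.
move=> qc ec; have /andP[_ /allP ge1] := chl_ge qc; have /allP ltc := chl_lt qc.
apply/allP/allP => H.
  move=> j jB; have [jo|//] := boolP (odd j); apply/negP => j1B.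
  have := H j.+1./2; rewrite mem_iota mul2n.
  have e := odd_double_half j.+1; rewrite /= jo add0n in e.
  have -> : j.+1./2.*2 = j.+1 by rewrite -[RHS](odd_double_half j.+1) /= jo.
  rewrite /= jB j1B /= => h; apply: notF; apply: h.
  have := ltc _ j1B; have := ge1 _ jB; have := odd_double_half (size c); have := odd_double_half j.+1.
  by rewrite /= jo (negbTE ec) /= -!mul2n; lia.
move=> r; rewrite mem_iota => r1; apply/negP => /andP[h1 h2].
have := H _ h1.
have -> : (2 * r).-1.+1 = (2 * r)%N by lia.
rewrite h2 orbF; have : odd (2 * r).-1.+1 = false by rewrite prednK ?oddM //; lia.
by rewrite /= => /negbFE ->.
Qed.

Lemma Dfuel_ext h n c : c != [::] -> ~~ odd (size c) ->
  let kk (q : choice) := (size q.1.1 + size q.1.2)%N in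
  ext h (Dfuel n.+1 c) =
    \sum_(q <- chl 1 c | admis false q && (1 <= kk q)%N)
      sgnm1 q.1.2 * ext (fun w => h (w ++ nseq (kk q) false)) (Dfuel n q.2)
  + \sum_(q <- chl 1 c | admis false q && (2 <= kk q)%N)
      sgnm1 q.1.2 * ext (fun w => h (w ++ true :: nseq (kk q).-1 false)) (Dfuel n q.2)
  + \sum_(q <- chl 1 c | admis true q && (2 <= kk q)%N)
      sgn q.1.2 * ext (fun w => h (w ++ true :: nseq (kk q).-1 false)) (Dfuel n q.2).
Proof.
move=> c0 ec kk.
have s1 j : (j - 1)%N = j.-1 by rewrite subn1.
have onesE : onesf 1 c = [seq i <- iota 1 (size c) | nth 0%N c i.-1 == 1%N].
  by apply: eq_filter => j; rewrite s1.
have bigsE : bigsf 1 c = [seq i <- iota 1 (size c) | (1 < nth 0%N c i.-1)%N].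
  by apply: eq_filter => j; rewrite s1.
have argE A B : argf 1 c A B = [seq (nth 0%N c i.-1 - (i \in B))%N | i <- iota 1 (size c) & i \notin A].
  by apply: eq_map => j; rewrite s1.
have T (P P' : pred (seq nat)) (R R' : pred (seq nat)) m (S : seq nat -> rat) (V : nat -> word) :
   (forall q, q \in chl 1 c -> P q.1.1 && R q.1.2 = P' q.1.1 && R' q.1.2) ->
   ext h (flatten [seq flatten [seq Defs.scale (S B) (mulw (Dfuel n (argf 1 c A B)) (V (size A + size B)%N))
      | B <- subs (bigsf 1 c) & R B && (m <= size A + size B)%N] | A <- subs (onesf 1 c) & P A])
   = \sum_(q <- chl 1 c | P' q.1.1 && R' q.1.2 && (m <= kk q)%N)
      S q.1.2 * ext (fun w => h (w ++ V (kk q))) (Dfuel n q.2).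
  move=> PR; rewrite ext_flatten big_map.
  under eq_bigr => A _ do rewrite ext_flatten big_map.
  under eq_bigr => A _ do (under eq_bigr => B _ do rewrite ext_scale ext_mulw).
  rewrite (big_chl P (fun A B => R B && (m <= size A + size B)%N)
     (fun A B l => S B * ext (fun w => h (w ++ V (size A + size B)%N)) (Dfuel n l))).
  rewrite big_seq_cond [RHS]big_seq_cond; apply: eq_bigl => q.
  by have [qc|//] := boolP (q \in chl 1 c); rewrite /= andbA PR.
case: c c0 ec @kk onesE bigsE argE T => // x c _ ec kk onesE bigsE argE T.
rewrite [Dfuel _ _]/Dfuel -/Dfuel -onesE -bigsE.
rewrite !ext_cat addrA; congr (_ + _ + _).
- rewrite -(T even_odd (paired false) (condB1 (size (x :: c))./2) (unpaired false) 1%N sgnm1 (fun k => nseq k false)).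
    congr ext; congr flatten; apply: eq_map => A; congr flatten; apply: eq_map => B.
    by rewrite argE.
  by move=> q qc; rewrite even_oddE condB1E.
- rewrite -(T even_odd (paired false) (condB1 (size (x :: c))./2) (unpaired false) 2%N sgnm1 (fun k => true :: nseq k.-1 false)).
    congr ext; congr flatten; apply: eq_map => A; congr flatten; apply: eq_map => B.
    by rewrite argE.
  by move=> q qc; rewrite even_oddE condB1E.
- rewrite -(T odd_even (paired true) (condB3 (size (x :: c))./2) (unpaired true) 2%N sgn (fun k => true :: nseq k.-1 false)).
    congr ext; congr flatten; apply: eq_map => A; congr flatten; apply: eq_map => B.
    by rewrite argE.
  by move=> q qc; rewrite odd_evenE condB3E.
Qed.

Lemma eq_OL_even t m g g' : ~~ odd (size m) -> (forall l, ~~ odd (size l) -> g l = g' l) ->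
  OL t m g = OL t m g'.
Proof.
elim/seq2_ind: m g g' => [|x|x y m IH] g g' //=; first by move=> _; apply.
rewrite negbK => em e; apply: eq_pairsum'; last exact: IH.
by move=> x' y'; apply: IH => // l el; apply: e; rewrite /= negbK.
Qed.

Lemma chl_sumn i c q : q \in chl i c -> posn c -> (1 <= size q.1.1 + size q.1.2)%N ->
  (sumn q.2 < sumn c)%N.
Proof.
move=> qc pc k1; have [_ <-] := chl_props qc pc.
by rewrite -[in ltnLHS](addn0 (sumn q.2)) ltn_add2l.
Qed.

Definition evenpart (g : seq nat -> rat) (l : seq nat) : rat := if odd (size l) then 0 else g l.

(** In the pairwise form given by [csum_O] and [csum_E], [g] is only evaluated at lists of even
    length. *)
Lemma csum_even t p c g : posn c -> ~~ odd (size c) -> c != [::] ->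
  csum t p 1 c g = csum t p 1 c (evenpart g).
Proof.
move=> pc ec c0; case: p.
  by rewrite !csum_O //; apply: eq_OL_even => // l /negbTE el; rewrite /evenpart el.
case: c c0 pc ec => // a m _; case/lastP: m => // m b; rewrite -cats1.
move=> pc /=; rewrite size_cat addn1 /= negbK => em.
have /and3P[a0 pm b0] : [&& (0 < a)%N, posn m & (0 < b)%N].
  by move: pc; rewrite /posn /= all_cat /= andbT.
rewrite !csum_E //.
have E a' : OL t m (fun l => g (a' :: l ++ [:: b]) - oif (1 < b)%N (t * g (a' :: l ++ [:: b.-1])))
  = OL t m (fun l => evenpart g (a' :: l ++ [:: b]) - oif (1 < b)%N (t * evenpart g (a' :: l ++ [:: b.-1]))).
  by apply: eq_OL_even => // l /negbTE el; rewrite /evenpart /= !size_cat !addn1 /= el.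
by rewrite !E.
Qed.

Lemma chl_trivial (F : choice -> rat) i c :
  \sum_(q <- chl i c | (size q.1.1 + size q.1.2 == 0)%N) F q = F ([::], [::], c).
Proof.
elim: c i F => [|x c IH] i F; first by rewrite big_mkcond big_seq1.
rewrite big_mkcond chl_big /= -[RHS](IH i.+1 (fun q => F (keepc x q))) [in RHS]big_mkcond /=.
rewrite [Z in oif _ Z]big1 ?[Z in _ + oif _ Z]big1 ?/oif.
- by case: ifP; case: ifP => *; rewrite !addr0.
- by move=> q _; rewrite addnS.
by [].
Qed.

Lemma csum_split t p c g : posn c ->
  csum t p 1 c g = g c + \sum_(q <- chl 1 c | admis p q && (1 <= size q.1.1 + size q.1.2)%N) wgt t q * g q.2.
Proof.
move=> pc; rewrite /csum (bigID (fun q : choice => (size q.1.1 + size q.1.2 == 0)%N)) /=; congr (_ + _).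
  rewrite (eq_bigl (fun q : choice => (size q.1.1 + size q.1.2 == 0)%N)).
    by rewrite (chl_trivial (fun q => wgt t q * g q.2)) /wgt /= !expr0 !mul1r.
  move=> [[A B] l] /=; rewrite andbC; case: eqP => //= e.
  by have [-> ->] : A = [::] /\ B = [::] by split; apply/nilP; rewrite /nilp; lia.
by apply: eq_bigl => q; rewrite lt0n.
Qed.

(** The empty choice contributes [g c], every other one a list of smaller weight. *)
Lemma csum_unique t c g g' : posn c -> ~~ odd (size c) -> c != [::] ->
  (forall l, posn l -> ~~ odd (size l) -> (sumn l < sumn c)%N -> g l = g' l) ->
  csum t false 1 c g = csum t false 1 c g' -> g c = g' c.
Proof.
move=> pc ec c0 e; rewrite csum_even // [RHS]csum_even // !csum_split //.
rewrite {1 3}/evenpart (negbTE ec).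
rewrite [Z in _ + Z = _](_ : _ = \sum_(q <- chl 1 c | admis false q && (1 <= size q.1.1 + size q.1.2)%N) wgt t q * evenpart g' q.2).
  exact: addIr.
rewrite big_seq_cond [RHS]big_seq_cond; apply: eq_bigr => q /and3P[qc _ k1].
have [pq _] := chl_props qc pc; have sq := chl_sumn qc pc k1; congr (_ * _); rewrite /evenpart.
by case: ifP => // /negbT oq; exact: e.
Qed.

Lemma chl_size i c q : q \in chl i c -> (size q.2 + size q.1.1)%N = size c.
Proof.
elim: c i q => [|x c IH] i q /=; first by rewrite inE => /eqP ->.
rewrite !mem_cat => /or3P[/mapP[q' /IH h ->]| |] /=; first by rewrite addSn h.
  by case: eqP => // _ /mapP[q' /IH h ->] /=; rewrite addnS h.
by case: ifP => // _ /mapP[q' /IH h ->] /=; rewrite addSn h.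
Qed.

(* With t = -1 all choices leaving an odd number of runs have weight -1. *)
Lemma admis_even p c q : posn c -> ~~ odd (size c) -> c != [::] -> q \in chl 1 c -> admis p q ->
  ~~ odd (size q.2).
Proof.
move=> pc ec c0 qc aq; apply/negP => oq.
pose g (l : seq nat) : rat := if odd (size l) then 1 else 0.
have : csum (-1) p 1 c g = 0.
  rewrite csum_even // /csum big1 // => q' _; rewrite /evenpart /g.
  by case: (odd _); rewrite mulr0.
rewrite /csum => e0.
have : \sum_(q' <- chl 1 c) (if admis p q' && odd (size q'.2) then 1 else 0 : rat) = 0.
  rewrite -[RHS]oppr0 -[in RHS]e0 -sumrN [in RHS]big_mkcond; apply: eq_big_seq => q' q'c.
  case: ifP => [/andP[a o]|].
    rewrite a /g o mulr1 /wgt exprD mulrCA -exprD addnn -mul2n exprM sqrrN !expr1n mulr1.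
    have : odd (size q'.1.1) by move: ec; rewrite -(chl_size q'c) oddD o /= negbK.
    by rewrite -signr_odd => ->; rewrite expr1 opprK.
  by case: (admis p q') => //=; rewrite /g => ->; rewrite mulr0 oppr0.
have nn : forall q', q' \in chl 1 c -> 0 <= (if admis p q' && odd (size q'.2) then 1 else 0 : rat).
  by move=> q' _; case: ifP.
rewrite (big_rem q qc) /= aq oq /= => /eqP.
rewrite paddr_eq0 ?oner_eq0 //.
by rewrite sumr_ge0 // => q' _; case: ifP.
Qed.

(** * Values of linear forms on D(c) *)

Definition zD h c := ext h (frakD c).

Lemma Dfuel_nil n : Dfuel n [::] = Defs.one.
Proof. by case: n. Qed.

Lemma Dfuel_enough h n m c : posn c -> ~~ odd (size c) -> (sumn c <= n)%N -> (sumn c <= m)%N ->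
  ext h (Dfuel n c) = ext h (Dfuel m c).
Proof.
elim: n m c h => [|n IH] m c h pc ec cn cm.
  have -> : c = [::] by case: c pc cn {cm ec} => // x c /andP[x0 _] /=; lia.
  by rewrite !Dfuel_nil.
have [->|c0] := eqVneq c [::]; first by rewrite !Dfuel_nil.
case: m cm => [|m] cm.
  by case: c pc cm {cn ec} c0 => // x c /andP[x0 _] /=; lia.
rewrite !Dfuel_ext //.
have E p k (q : choice) h' : q \in chl 1 c -> admis p q && (k.+1 <= size q.1.1 + size q.1.2)%N ->
   ext h' (Dfuel n q.2) = ext h' (Dfuel m q.2).
  move=> qc /andP[aq k1]; have [pq _] := chl_props qc pc.
  have sq := chl_sumn qc pc (leq_trans (ltn0Sn k) k1).
  by apply: IH => //; [exact: admis_even pc ec c0 qc aq | exact: leq_trans sq cn | exact: leq_trans sq cm].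
congr (_ + _ + _); rewrite big_seq_cond [RHS]big_seq_cond; apply: eq_bigr => q /andP[qc aq];
  congr (_ * _); exact: E aq.
Qed.

Lemma zD_rec h c : posn c -> ~~ odd (size c) -> c != [::] ->
  let kk (q : choice) := (size q.1.1 + size q.1.2)%N in
  zD h c =
    \sum_(q <- chl 1 c | admis false q && (1 <= kk q)%N)
      sgnm1 q.1.2 * zD (fun w => h (w ++ nseq (kk q) false)) q.2
  + \sum_(q <- chl 1 c | admis false q && (2 <= kk q)%N)
      sgnm1 q.1.2 * zD (fun w => h (w ++ true :: nseq (kk q).-1 false)) q.2
  + \sum_(q <- chl 1 c | admis true q && (2 <= kk q)%N)
      sgn q.1.2 * zD (fun w => h (w ++ true :: nseq (kk q).-1 false)) q.2.
Proof.
move=> pc ec c0 kk; rewrite /zD /frakD.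
have [n en] : exists n, sumn c = n.+1.
  by case: c pc c0 {ec} => // x c /andP[x0 _] _; exists (x.-1 + sumn c)%N; rewrite /=; lia.
rewrite en Dfuel_ext //.
have E p k (q : choice) h' : q \in chl 1 c -> admis p q && (k.+1 <= kk q)%N ->
   ext h' (Dfuel n q.2) = ext h' (Dfuel (sumn q.2) q.2).
  move=> qc /andP[aq k1]; have [pq _] := chl_props qc pc.
  have sq := chl_sumn qc pc (leq_trans (ltn0Sn k) k1).
  by apply: Dfuel_enough => //; [exact: admis_even pc ec c0 qc aq | rewrite -ltnS -en].
congr (_ + _ + _); rewrite big_seq_cond [RHS]big_seq_cond; apply: eq_bigr => q /andP[qc aq];
  congr (_ * _); exact: E aq.
Qed.

Lemma zD_nil h : zD h [::] = h [::].
Proof. by rewrite /zD /frakD /= /ext /Defs.one big_seq1 mul1r. Qed.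

(* Says that the words of D(c) start with y. *)
Lemma zD_y0 h c : posn c -> ~~ odd (size c) -> c != [::] ->
  (forall w, head false w -> h w = 0) -> zD h c = 0.
Proof.
have [n] := ubnP (sumn c); elim: n c h => // n IH c h sc pc ec c0 h0.
rewrite zD_rec // !big1_seq ?addr0 // => q /andP[/andP[aq k1] qc]; have [pq _] := chl_props qc pc;
  have sq := chl_sumn qc pc (leq_trans (ltn0Sn _) k1); have sn := leq_trans sq sc;
  have eq := admis_even pc ec c0 qc aq.
- have [q0|q0] := eqVneq q.2 [::]; first by rewrite q0 zD_nil h0 ?mulr0.
  by rewrite IH ?mulr0 //; case=> // b w /= hb; exact: h0.
- have [q0|q0] := eqVneq q.2 [::]; first by rewrite q0 zD_nil h0 ?mulr0.
  by rewrite IH ?mulr0 //; case=> // b w /= hb; exact: h0.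
- rewrite IH ?mulr0 //.
    by apply: chl_nonempty qc c0 _; case/andP: aq.
  by case=> // b w /= hb; exact: h0.
Qed.

Lemma eq_zD h h' c : posn c -> ~~ odd (size c) -> c != [::] ->
  (forall w, head false w -> h w = h' w) -> zD h c = zD h' c.
Proof.
move=> pc ec c0 e; apply/eqP; rewrite -subr_eq0; apply/eqP.
rewrite -[RHS](zD_y0 (h := fun w => h w + (-1) * h' w) pc ec c0).
  by rewrite /zD ext_lin mulN1r.
by move=> w /e ->; rewrite mulN1r subrr.
Qed.

Definition FD N (c : seq nat) := zD (fun w => Ff N (rev w)) c.

(** The difference keeps the summands whose largest variable equals N; raising the last exponent by
    k divides them by N^k. This needs a last exponent, hence a word that starts with y. *)
Lemma Ff_x N k w : (0 < N)%N -> head false w ->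
  Ff N.+1 (rev (w ++ nseq k false)) - Ff N (rev (w ++ nseq k false))
  = N%:R^-1 ^+ k * (Ff N.+1 (rev w) - Ff N (rev w)).
Proof.
case: N => // N _ hw; rewrite rev_cat; set s : rat := N.+1%:R.
have -> : Ff N.+2 = chi s (Ff N.+1) by [].
have us : s \is a GRing.unit by exact: natU_rat.
have [j [v ->]] : exists j v, rev w = nseq j false ++ true :: v.
  have : true \in rev w by rewrite mem_rev; case: w hw => // b w /= ->; rewrite inE eqxx.
  elim: (rev w) => // b v IH; rewrite inE; case: b => [_|/= /IH [j [u ->]]]; first by exists 0%N, v.
  by exists j.+1, u.
rewrite rev_nseq.
by rewrite catA -nseqD !chi_block // -addnS exprD; ring.
Qed.

Lemma Ff_y N k w : (0 < N)%N -> (0 < k)%N ->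
  Ff N.+1 (rev (w ++ true :: nseq k.-1 false)) - Ff N (rev (w ++ true :: nseq k.-1 false))
  = N%:R^-1 ^+ k * Ff N (rev w).
Proof.
case: N k => // N [|k] // _ _; rewrite rev_cat rev_cons; set s : rat := N.+1%:R.
have -> : Ff N.+2 = chi s (Ff N.+1) by [].
have us : s \is a GRing.unit by exact: natU_rat.
rewrite rev_nseq.
by rewrite cat_rcons chi_block //; ring.
Qed.

Lemma zDB h h' c : zD (fun w => h w - h' w) c = zD h c - zD h' c.
Proof.
have := ext_lin h h' (-1) (frakD c); rewrite mulN1r /zD => <-.
by apply: eq_bigr => u _; rewrite mulN1r.
Qed.

Lemma zDZ a h c : zD (fun w => a * h w) c = a * zD h c.
Proof. by rewrite /zD /ext mulr_sumr; apply: eq_bigr => u _; rewrite mulrCA. Qed.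

Lemma zDE h h' c : (forall w, h w = h' w) -> zD h c = zD h' c.
Proof. by move=> e; apply: eq_bigr => u _; rewrite e. Qed.

(** F_{N+1} - F_N is applied to the recursion of D: by [Ff_x] and [Ff_y], the right factors x^k and
    y x^(k-1) both become N^-k, which is the weight [wgt]. *)
Theorem FD_csum N c : (0 < N)%N -> posn c -> ~~ odd (size c) -> c != [::] ->
  csum N%:R^-1 false 1 c (FD N.+1) = csum N%:R^-1 true 1 c (FD N).
Proof.
move=> N0 pc ec c0; set t : rat := N%:R^-1.
have D : FD N.+1 c - FD N c =
    - (\sum_(q <- chl 1 c | admis false q && (1 <= size q.1.1 + size q.1.2)%N) wgt t q * (FD N.+1 q.2 - FD N q.2))
    - (\sum_(q <- chl 1 c | admis false q && (2 <= size q.1.1 + size q.1.2)%N) wgt t q * FD N q.2)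
    + \sum_(q <- chl 1 c | admis true q && (2 <= size q.1.1 + size q.1.2)%N) wgt t q * FD N q.2.
  rewrite /FD -zDB zD_rec // -!sumrN; congr (_ + _ + _);
    rewrite big_seq_cond [RHS]big_seq_cond; apply: eq_bigr => q /and3P[qc aq k1];
    have [pq _] := chl_props qc pc; have eq := admis_even pc ec c0 qc aq.
  - have q0 : q.2 != [::] by apply: chl_nonempty qc c0 _; case/andP: aq.
    rewrite (eq_zD pq eq q0 (fun w => @Ff_x N _ w N0)) zDZ zDB /sgnm1 /wgt exprD; ring.
  - rewrite (zDE _ (fun w => @Ff_y N _ w N0 (ltnW k1))) zDZ /sgnm1 /wgt; ring.
  - rewrite (zDE _ (fun w => @Ff_y N _ w N0 (ltnW k1))) zDZ /sgn /wgt; ring.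
rewrite !csum_split //.
pose S p m g := \sum_(q <- chl 1 c | admis p q && (m <= size q.1.1 + size q.1.2)%N) wgt t q * g q.2.
pose S1 p g := \sum_(q <- chl 1 c | admis p q && (size q.1.1 + size q.1.2 == 1)%N) wgt t q * g q.2.
have SS p g : S p 1%N g = S1 p g + S p 2%N g.
  rewrite /S (bigID (fun q : choice => (size q.1.1 + size q.1.2 == 1)%N)) /=; congr (_ + _).
    by apply: eq_bigl => q; rewrite -andbA; congr (_ && _); case: eqP => [->|_]; rewrite ?andbF.
  by apply: eq_bigl => q; rewrite -andbA; congr (_ && _); lia.
(* With one affected run, A is empty, as deletions come in pairs, and B is a singleton, admissible
   for both parities. So the terms with #A + #B = 1, absent from the last two sums of the recursion,
   would cancel there. *)
have S1E g : S1 false g = S1 true g.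
  rewrite /S1 big_seq_cond [RHS]big_seq_cond; apply: eq_bigl => -[[A B] l] /=.
  have [qc|//] := boolP (_ \in chl 1 c); have /andP[/= hA hB] := chl_ge qc.
  case: eqP => [e|_]; last by rewrite !andbF.
  rewrite !andbT /=; case: A B e hA hB {qc} => [|i [|? ?]] [|j [|? ?]] //= _ hA hB.
    by rewrite /admis /unpaired /= !inE gtn_eqF // !orbT.
  rewrite /admis /paired /= !inE; case: i hA => // i _ /=.
  have -> : (i == i.+1) = false by lia.
  have -> : (i.+2 == i.+1) = false by lia.
  by rewrite !if_same.
have D' : FD N.+1 c - FD N c = - (S false 1%N (FD N.+1) - S false 1%N (FD N)) - S false 2%N (FD N) + S true 2%N (FD N).
  rewrite D /S; congr (- _ - _ + _).
  by rewrite -sumrB; apply: eq_bigr => q _; rewrite mulrBr.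
rewrite -[X1 in _ + X1 = _]/(S false 1%N (FD N.+1)) -[X1 in _ = _ + X1]/(S true 1%N (FD N)).
move: D'; rewrite !SS !S1E => D'; apply: (lin1 D'); ring.
Qed.

Lemma Ff_nil N : Ff N [::] = 1.
Proof.
elim: N => [|[|N] IH] //.
have -> : Ff N.+2 = chi N.+1%:R (Ff N.+1) by [].
by rewrite chi_nil //; exact: natU_rat.
Qed.

Lemma rwf_neq0 s k r : (0 < k)%N -> rwf s (k :: r) != [::].
Proof. by case: k. Qed.

Theorem FD_Zf N c : (0 < N)%N -> posn c -> ~~ odd (size c) ->
  FD N c = Zf N (rwf false (rev c)).
Proof.
elim: N c => // N IHN c _ pc ec.
have [n] := ubnP (sumn c); elim: n c pc ec => // n IH c pc ec sc.
have [->|c0] := eqVneq c [::].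
  by rewrite /FD zD_nil Ff_nil /Zf Vphi_nil.
(* At N = 1 both F_1 and Z_1 are empty products and vanish on nonempty words. *)
case: N IHN IH => [|N] IHN IH.
  rewrite /FD zD_y0 // => [|w]; last first.
    by case: w => // b w _; rewrite /= /onef -size_eq0 size_rev.
  rewrite /Zf /= /onef; case/lastP: c pc c0 {ec sc} => // c k; rewrite /posn all_rcons => /andP[k0 _] _.
  by rewrite rev_rcons -[Vphi 1 0 _]/(onef rat _) /onef (negbTE (rwf_neq0 _ _ k0)).
apply: (csum_unique (t := N.+1%:R^-1) pc ec c0 (g' := fun l => Zf N.+2 (rwf false (rev l)))).
  by move=> l pl el sl; apply: IH => //; exact: leq_trans sl sc.
rewrite (FD_csum (N := N.+1)) // (Zf_csum (N := N.+1)) //.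
rewrite csum_even // [RHS]csum_even //.
rewrite /csum big_seq_cond [RHS]big_seq_cond; apply: eq_bigr => q /andP[qc aq].
congr (_ * _); rewrite /evenpart; case: ifP => // /negbT oq.
by apply: IHN => //; have [] := chl_props qc pc.
Qed.

(** * Independence of the forms F_N *)

Definition sh (p : {poly rat}) : {poly rat} := p \Po ('X + 1).

Lemma horner_sh p x : (sh p).[x] = p.[x + 1].
Proof. by rewrite /sh horner_comp !hornerE. Qed.

Lemma shM p q : sh (p * q) = sh p * sh q.
Proof. exact: comp_polyM. Qed.

Lemma size_X1 : size ('X + 1 : {poly rat}) = 2%N.
Proof. by rewrite -[1]/(1%:P) size_XaddC. Qed.

Lemma size_sh p : size (sh p) = size p.
Proof. by apply: size_comp_poly2; exact: size_X1. Qed.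

Lemma sh_eq0 p : (sh p == 0) = (p == 0).
Proof. by rewrite -!size_poly_eq0 size_sh. Qed.

Lemma lead_coef_sh p : lead_coef (sh p) = lead_coef p.
Proof.
by rewrite lead_coef_comp ?size_X1 // -[1]/(1%:P) lead_coefXaddC expr1n mulr1.
Qed.

Lemma poly0_of_roots (p : {poly rat}) (a : nat -> rat) :
  injective a -> (forall n, root p (a n)) -> p = 0.
Proof.
move=> ia ra; apply: (@roots_geq_poly_eq0 _ _ [seq a n | n <- iota 0 (size p)]).
- by apply/allP => _ /mapP[n _ ->].
- by rewrite map_inj_uniq // iota_uniq.
- by rewrite size_map size_iota.
Qed.

Lemma injD (c : rat) : injective (fun n : nat => c + n%:R).
Proof. by move=> m n /addrI/eqP; rewrite eqr_nat => /eqP. Qed.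

Lemma injB (c : rat) : injective (fun n : nat => c - n%:R).
Proof. by move=> m n /addrI/oppr_inj/eqP; rewrite eqr_nat => /eqP. Qed.

Lemma sh_fix p : sh p = p -> p = (p.[0])%:P.
Proof.
move=> sp; apply/eqP; rewrite -subr_eq0; apply/eqP.
apply: (poly0_of_roots (@injD 0)) => n; rewrite /root !hornerE ?add0r subr_eq0.
by apply/eqP; elim: n => // n <-; rewrite -{2}sp horner_sh natr1.
Qed.

Lemma coprime_parts (u v : {poly rat}) : v != 0 ->
  exists g u' v', [/\ u = u' * g, v = v' * g, g != 0, v' != 0 & coprimep u' v'].
Proof.
move=> v0; exists (gcdp u v), (u %/ gcdp u v), (v %/ gcdp u v).
have e : v %/ gcdp u v * gcdp u v = v by apply: divpK; exact: dvdp_gcdr.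
split=> //.
- by rewrite divpK // dvdp_gcdl.
- by rewrite gcdp_eq0 (negbTE v0) andbF.
- by apply: contraNneq v0 => h; rewrite -e h mul0r.
- by apply: coprimep_div_gcd; rewrite v0 orbT.
Qed.

(** In lowest terms the denominator divides its own shift, which has the same degree and leading
    coefficient; it is thus periodic, hence constant, and so is the numerator. *)
Lemma periodic_ratio u v : v != 0 -> sh u * v = u * sh v -> exists c, u = c *: v.
Proof.
move=> v0 e; have [g [u' [v' [eu ev g0 v0' cp]]]] := coprime_parts u v0.
have e' : sh u' * v' = u' * sh v'.
  apply: (mulIf g0); apply: (mulIf (_ : sh g != 0)); first by rewrite sh_eq0.
  have -> : sh u' * v' * g * sh g = sh u * v by rewrite eu ev shM; ring.
  by rewrite e eu ev shM; ring.
have shv : sh v' = v'.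
  have : v' %| sh v' by rewrite -(@Gauss_dvdpr _ _ u') 1?coprimep_sym // -e' dvdp_mull.
  by move/dvdp_size_eqp; rewrite size_sh eqxx => /esym/eqpfP; rewrite lead_coef_sh divff ?lead_coef_eq0 // scale1r.
have shu : sh u' = u' by apply: (mulIf v0'); rewrite e' shv.
move: v0'; rewrite eu ev (sh_fix shu) (sh_fix shv) polyC_eq0 => v0'.
by exists (u'.[0] / v'.[0]); rewrite !mul_polyC scalerA divfK.
Qed.

(* A pole of u/v at an integer other than 0 propagates to all integers on the same side of 0, and the pole of C/X^A at 0 forces one. *)
Lemma no_rational_antidifference A (u v C : {poly rat}) : C != 0 -> (size C <= A)%N -> v != 0 ->
  'X^A * (sh u * v - u * sh v) + v * sh v * C = 0 -> False.
Proof.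
move=> C0 sC v0 e; have [g [u' [v' [eu ev g0 v0' cp]]]] := coprime_parts u v0.
have {}e : 'X^A * (sh u' * v' - u' * sh v') + v' * sh v' * C = 0.
  apply: (mulIf g0); apply: (mulIf (_ : sh g != 0)); first by rewrite sh_eq0.
  by rewrite !mul0r -[RHS]e eu ev !shM; ring.
have ex x : x ^+ A * (u'.[x + 1] * v'.[x] - u'.[x] * v'.[x + 1]) + v'.[x] * v'.[x + 1] * C.[x] = 0.
  by move/(congr1 (fun p => p.[x])): e; rewrite !hornerE !horner_sh.
have cpr x : v'.[x] = 0 -> u'.[x] != 0.
  by move=> h; apply: (@coprimep_root _ v' u'); rewrite 1?coprimep_sym //; exact/eqP.
have up x : x != 0 -> v'.[x] = 0 -> v'.[x + 1] = 0.
  move=> x0 h; have := ex x; rewrite h !(mulr0, mul0r, addr0, sub0r) => /eqP.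
  by rewrite mulf_eq0 expf_eq0 (negbTE x0) andbF oppr_eq0 mulf_eq0 (negbTE (cpr _ h)) => /eqP.
have down x : x != 0 -> v'.[x + 1] = 0 -> v'.[x] = 0.
  move=> x0 h; have := ex x; rewrite h !(mulr0, mul0r, addr0, subr0) => /eqP.
  by rewrite mulf_eq0 expf_eq0 (negbTE x0) andbF mulf_eq0 (negbTE (cpr _ h)) => /eqP.
have : v'.[0] * v'.[1] = 0.
  have [k [C1 /implyP/(_ C0) C10 eC]] := multiplicity_XsubC C 0.
  have {}eC : C = C1 * 'X^k by rewrite eC subr0.
  have C1n : C1 != 0 by apply: contraNneq C0 => h; rewrite eC h mul0r.
  have kA : (k < A)%N.
    by apply: leq_trans sC; rewrite eC size_mulXn // -addn1 leq_add2l size_poly_gt0.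
  have {}e : 'X^(A - k) * (sh u' * v' - u' * sh v') + v' * sh v' * C1 = 0.
    apply: (mulIf (_ : 'X^k != 0)); first by rewrite -size_poly_gt0 size_polyXn.
    by rewrite mul0r -[RHS]e eC -{2}(subnK (ltnW kA)) exprD; ring.
  move/(congr1 (fun p => p.[0])): e; rewrite !hornerE !horner_sh add0r expr0n subn_eq0 leqNgt kA mul0r add0r => /eqP.
  by rewrite mulf_eq0 -[C1.[0] == 0]/(root C1 0) (negbTE C10) orbF => /eqP.
move/eqP; rewrite mulf_eq0 => /orP[]/eqP h; move/eqP: v0'; apply.
  apply: (poly0_of_roots (@injB 0)) => n; apply/eqP; elim: n => [|n IH].
    by rewrite subr0.
  apply: down; first by rewrite sub0r oppr_eq0 pnatr_eq0.
  by rewrite (_ : _ + 1 = 0 - n%:R) // -natr1; ring.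
apply: (poly0_of_roots (@injD 1)) => n; apply/eqP; elim: n => [|n IH].
  by rewrite addr0.
rewrite -natr1 addrA; apply: up => //.
by rewrite addrC natr1 pnatr_eq0.
Qed.

Lemma longest_exists (S : seq (seq nat)) : S != [::] ->
  exists2 s, s \in S & forall t, t \in S -> (size t <= size s)%N.
Proof.
elim: S => // s S IH _; have [->|/IH[t tS ht]] := eqVneq S [::].
  by exists s; rewrite ?mem_head // => t; rewrite inE => /eqP->.
have [st|ts] := leqP (size s) (size t).
  exists t; first by rewrite inE tS orbT.
  by move=> u; rewrite inE => /predU1P[->//|]; exact: ht.
exists s; first exact: mem_head.
by move=> u; rewrite inE => /predU1P[->//|/ht/leq_trans]; apply; exact: ltnW.
Qed.

(** * Independence over polynomials in N *)

Section Independence.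
Variable a : nat -> seq nat -> rat.
Hypothesis a_nil : forall N, a N [::] = 1.
Hypothesis a_cons : forall N k t, (0 < N)%N -> (0 < k)%N ->
  a N.+1 (k :: t) = a N (k :: t) + N%:R^-1 ^+ k * a N t.

Definition child (t t2 : seq nat) := (t2 != [::]) && (behead t2 == t).

(** Polynomial coefficients make the induction on S possible: a longest index s is eliminated from
    the relations at N and N + 1 with multipliers depending on N. *)
Lemma independence (S : seq (seq nat)) (r : seq nat -> {poly rat}) : uniq S ->
  (forall k t, k :: t \in S -> (0 < k)%N /\ t \in S) ->
  (forall N, (0 < N)%N -> \sum_(t <- S) (r t).[N%:R] * a N t = 0) ->
  forall t, t \in S -> r t = 0.
Proof.
have [n] := ubnP (size S); elim: n S r => // n IH S r sS uS clS rel.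
have [->//|/longest_exists[s sinS smax]] := eqVneq S [::].
have uS' : uniq (rem s S) by exact: rem_uniq.
have memS' t : (t \in rem s S) = (t != s) && (t \in S) by rewrite mem_rem_uniq.
have chS' k t : k :: t \in S -> t \in rem s S.
  move=> h; have [_ tS] := clS _ _ h; rewrite memS' tS andbT.
  by apply: contraTneq (smax _ h) => ->; rewrite -ltnNge /=.
have clS' k t : k :: t \in rem s S -> (0 < k)%N /\ t \in rem s S.
  by rewrite memS' => /andP[_ h]; split; [have [] := clS _ _ h | exact: chS' h].
have sS' : (size (rem s S) < n)%N by rewrite size_rem //; case: (S) sinS sS.
have allS : (forall t, t \in rem s S -> r t = 0) -> r s = 0 -> forall t, t \in S -> r t = 0.
  by move=> h1 h2 t tS; have [->//|ts] := eqVneq t s; apply: h1; rewrite memS' ts.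
suff rs0 : r s = 0.
  apply: allS => //; apply: IH => // N N0.
  by have := rel N N0; rewrite (big_rem s) //= rs0 horner0 mul0r add0r.
apply/eqP; apply: contraT => v0; exfalso; set v := r s in v0.
(* X^A clears the denominators N^k introduced by [a_cons]. *)
pose A := (\max_(t <- S) head 0%N t)%N.
have hA t : t \in S -> (head 0%N t <= A)%N by move=> tS; exact: leq_bigmax_seq.
(* The coefficients of N^A times v(N) (relation at N + 1) - v(N + 1) (relation at N). The one of s
   vanishes, because s, being longest, is the tail of no other index. *)
pose r' t := 'X^A * (sh (r t) * v - r t * sh v)
  + \sum_(t2 <- S | child t t2) 'X^(A - head 0%N t2) * v * sh (r t2).
have rel' N : (0 < N)%N -> \sum_(t <- rem s S) (r' t).[N%:R] * a N t = 0.
  move=> N0; set x : rat := N%:R.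
  have x0 : x != 0 by rewrite pnatr_eq0 -lt0n.
  have step t : t \in S -> a N.+1 t = a N t + (if t is k :: t' then x^-1 ^+ k * a N t' else 0).
    by case: t => [|k t] tS; rewrite ?a_nil ?addr0 // a_cons //; have [] := clS _ _ tS.
  have E1 : \sum_(t <- rem s S) ('X^A * (sh (r t) * v - r t * sh v)).[x] * a N t
          = \sum_(t <- S) x ^+ A * ((r t).[x + 1] * v.[x] - (r t).[x] * v.[x + 1]) * a N t.
    rewrite [RHS](big_rem s) //= -/v (mulrC v.[x]) subrr mulr0 mul0r add0r.
    by apply: eq_bigr => t _; rewrite !hornerE !horner_sh.
  have E2 : \sum_(t <- rem s S) (\sum_(t2 <- S | child t t2) 'X^(A - head 0%N t2) * v * sh (r t2)).[x] * a N t
          = \sum_(t2 <- S) x ^+ A * v.[x] * (r t2).[x + 1] * (if t2 is k :: t' then x^-1 ^+ k * a N t' else 0).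
    under eq_bigr => t _ do rewrite horner_sum mulr_suml.
    rewrite (exchange_big_dep xpredT) //= big_seq [RHS]big_seq; apply: eq_bigr => t2 t2S.
    case: t2 t2S => [|k t2] t2S; first by rewrite big_pred0_eq mulr0.
    rewrite (eq_bigl (pred1 t2)) => [|t]; last by rewrite /child /= eq_sym.
    rewrite -big_filter filter_pred1_uniq ?big_seq1 //; last exact: chS' t2S.
    rewrite /= !hornerE horner_sh -{2}(subnK (hA _ t2S)) /= exprD exprVn.
    by field; rewrite expf_neq0.
  rewrite /r'; under eq_bigr => t _ do rewrite hornerD mulrDl.
  rewrite big_split /= E1 E2 -big_split /=.
  have R1 := rel N.+1 isT; have R0 := rel N N0.
  transitivity (x ^+ A * (v.[x] * (\sum_(t <- S) (r t).[N.+1%:R] * a N.+1 t)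
    - v.[x + 1] * (\sum_(t <- S) (r t).[x] * a N t))); last by rewrite R1 R0; ring.
  rewrite !mulr_sumr -sumrB mulr_sumr big_seq [RHS]big_seq.
  by apply: eq_bigr => t tS; rewrite step // -natr1 -/x; case: t {tS} => [|k t] /=; ring.
have r'0 : forall t, t \in rem s S -> r' t = 0 by apply: IH.
case es : s => [|k0 t0].
  have S'0 : rem s S = [::].
    case e : (rem s S) => [//|t S1].
    have : t \in rem s S by rewrite e mem_head.
    by rewrite memS' => /andP[ts /smax]; rewrite es leqn0 size_eq0 -es (negbTE ts).
  move/eqP: v0; apply; apply: (poly0_of_roots (@injD 1)) => m; apply/eqP.
  have := rel m.+1 isT; rewrite (big_rem s) //= S'0 big_nil addr0 -/v [in a _ _]es a_nil mulr1.
  by rewrite -add1n natrD.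
have sk : k0 :: t0 \in S by rewrite -es.
have k00 : (0 < k0)%N by have [] := clS _ _ sk.
have t0S' : t0 \in rem s S by exact: chS' sk.
(* Siblings of s are also longest, so [r'] has no second sum there; its vanishing makes their ratio
   to v periodic, hence constant. *)
have rc t2 : t2 \in S -> child t0 t2 -> r t2 = (lead_coef (r t2) / lead_coef v) *: v.
  case: t2 => // k t2 tS /andP[_ /eqP /= e2]; rewrite {}e2 in tS *.
  have [<-|ne] := eqVneq s (k :: t0); first by rewrite -/v divff ?lead_coef_eq0 // scale1r.
  suff /(periodic_ratio v0)[c ->] : sh (r (k :: t0)) * v = r (k :: t0) * sh v.
    by rewrite lead_coefZ mulfK // lead_coef_eq0.
  have := r'0 (k :: t0); rewrite memS' tS eq_sym ne => /(_ isT).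
  rewrite /r' big_seq_cond big_pred0 ?addr0.
    by move/eqP; rewrite mulf_eq0 -size_poly_eq0 size_polyXn /= subr_eq0 => /eqP.
  move=> t3; apply/negbTE; apply/negP => /andP[t3S]; case: t3 t3S => // k3 t3 t3S /andP[_ /eqP /= e3].
  by have := smax _ t3S; rewrite e3 es /= ltnn.
pose c t2 := lead_coef (r t2) / lead_coef v.
(* Now [r' t0 = 0] says that f = r t0 / v satisfies f(X+1) - f(X) = - C / X^A. *)
pose C := \sum_(t2 <- S | child t0 t2) c t2 *: 'X^(A - head 0%N t2).
apply: (@no_rational_antidifference A (r t0) v C) => //.
(* Children of [t0] differ in their heads, so the exponent A - k0 comes from s alone, with
   coefficient v / v = 1. *)
- suff : C`_(A - k0) != 0 by apply: contra_neq => ->; rewrite coef0.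
  rewrite coef_sum big_mkcond (big_rem s) //= es /child /= eqxx coefZ coefXn eqxx mulr1.
  rewrite big_seq big1 ?addr0 => [|t].
    by rewrite /c -es -/v divff ?lead_coef_eq0 // oner_neq0.
  rewrite -es memS' => /andP[ts tS]; case: ifP => // /andP[]; case: t ts tS => // k t ts tS _ /= /eqP et.
  rewrite coefZ coefXn; case: eqP => [h|]; last by rewrite mulr0.
  have h1 := hA _ tS; have h2 := hA _ sk; rewrite /= in h1 h2.
  by move: ts; rewrite es et (_ : k = k0) ?eqxx //; lia.
- rewrite /C big_seq_cond; apply: (big_ind (fun p : {poly rat} => (size p <= A)%N)).
  + by rewrite size_poly0.
  + by move=> p q hp hq; apply: leq_trans (size_polyD _ _) _; rewrite geq_max hp.
  + case=> [|k t] /andP[tS /andP[//= _ _]]; apply: leq_trans (size_scale_leq _ _) _.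
    have [k0' _] := clS _ _ tS; have /= := hA _ tS; rewrite size_polyXn; lia.
- have := r'0 _ t0S'; rewrite /r' => <-; congr (_ + _).
  rewrite /C mulr_sumr big_seq_cond [RHS]big_seq_cond; apply: eq_bigr => t2 /andP[tS ch].
  rewrite [in RHS](rc _ tS ch) -/(c t2) /sh comp_polyZ -!mul_polyC; ring.
Qed.

End Independence.

(** * Words and indices *)

Lemma word_of_idx_cat a b : word_of_idx (a ++ b) = word_of_idx a ++ word_of_idx b.
Proof. by rewrite /word_of_idx map_cat flatten_cat. Qed.

Lemma rev_word_of_idx t : rev (word_of_idx (rev t)) = rwd t.
Proof.
elim: t => //= k t IH; rewrite rev_cons -cats1 word_of_idx_cat rev_cat IH.
by rewrite /word_of_idx /= cats0 rev_cons rev_nseq cat_rcons.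
Qed.

Lemma rwd_rev ks : rwd (rev ks) = rev (word_of_idx ks).
Proof. by rewrite -rev_word_of_idx revK. Qed.

Definition scan (w : seq bool) : nat * seq nat :=
  foldr (fun b (p : nat * seq nat) => if b then (0%N, p.1.+1 :: p.2) else (p.1.+1, p.2))
         (0%N, [::]) w.

Lemma scanP w : w = nseq (scan w).1 false ++ word_of_idx (scan w).2 /\ posn (scan w).2.
Proof.
elim: w => //= b w [IH1 IH2]; case: b => /=; last by rewrite {1}IH1.
by split; rewrite // {1}IH1.
Qed.

Lemma idxK w : head true w -> word_of_idx (idx_of_word w) = w.
Proof. by case: w => [|[] w] // _; have [e _] := scanP (true :: w); rewrite [RHS]e. Qed.

Lemma idx_posn w : posn (idx_of_word w).
Proof. by have [] := scanP w. Qed.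

Lemma scan_nseq j w : scan (nseq j false ++ w) = (j + (scan w).1, (scan w).2)%N.
Proof. by elim: j => [|j IH] /=; rewrite ?IH //; case: (scan w). Qed.

Lemma word_of_idxK ks : posn ks -> idx_of_word (word_of_idx ks) = ks.
Proof.
suff h : posn ks -> scan (word_of_idx ks) = (0%N, ks) by move=> /h e; rewrite /idx_of_word -/(scan _) e.
elim: ks => // k ks IH; rewrite posn_cons => /andP[k0 /IH e].
by rewrite /word_of_idx /= scan_nseq -/(word_of_idx ks) e /= addn0 prednK.
Qed.

Lemma idx_ge2 v : word_Hge2 v -> all (leq 2) (idx_of_word v).
Proof.
have h n w : (size w < n)%N -> word_x_yx w -> all (leq 2) (scan w).2.
  elim: n w => // n IH [|[]] //.
  by case=> // -[] // w /ltnW sw hw; apply: (IH w).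
by case: v => [|[] [|[] w]] //= hw; apply: (h (size w).+1).
Qed.

Lemma rev_idx_word w : head true w -> rwd (rev (idx_of_word w)) = rev w.
Proof. by move=> hw; rewrite rwd_rev idxK. Qed.

Lemma idx_neq0 w : word_yH w -> rev (idx_of_word w) != [::].
Proof. by case: w => [|[] w] // _; rewrite -size_eq0 size_rev. Qed.

Definition ge2head (t : seq nat) := (1 < head 0%N t)%N.

Lemma idx_x w : word_yH w -> ge2head (rev (idx_of_word (w ++ [:: false]))).
Proof.
move=> hw; have : rwd (rev (idx_of_word (w ++ [:: false]))) = false :: rev w.
  by rewrite rev_idx_word; [rewrite rev_cat | case: w hw => [|[]]].
by case: (rev _) => //= -[|[|k]].
Qed.

Lemma hrev_neq0 a b t : a != [::] -> t \in hrev a b -> t != [::].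
Proof.
case: a b => // k1 a [|k2 b] _; first by rewrite hrev_nil inE => /eqP->.
by rewrite hrev_cons !mem_cat => /or3P[] /mapP[u hu ->].
Qed.

Lemma hrev_ge2 a b t : ge2head a -> all (leq 2) b -> t \in hrev a b -> ge2head t.
Proof.
case: a b => // k1 a [|k2 b] h1; first by rewrite hrev_nil inE => _ /eqP->.
rewrite hrev_cons !mem_cat /= => /andP[h2 _] /or3P[] /mapP[u hu ->] //.
rewrite /ge2head /= in h1 *; lia.
Qed.

Lemma word_of_idx_yH t : t != [::] -> word_yH (word_of_idx (rev t)).
Proof. by case/lastP: t => // t k _; rewrite rev_rcons. Qed.

Lemma last_head_rev (T : Type) (x : T) s : last x s = head x (rev s).
Proof. by case/lastP: s => // s y; rewrite last_rcons rev_rcons. Qed.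

Lemma word_of_idx_yHx t : ge2head t -> word_yHx (word_of_idx (rev t)).
Proof.
move=> h; have t0 : t != [::] by case: t h.
have : last true (word_of_idx (rev t)) = false.
  rewrite last_head_rev rev_word_of_idx.
  by case: t h {t0} => [|[|[|k]] t].
by have := word_of_idx_yH t0; case: (word_of_idx _) => [|[] w] // _ /= ->.
Qed.

Lemma harm_word_yH a b u : word_yH a -> u \in harm_word a b -> word_yH u.2.
Proof.
by move=> ha /mapP[t ht ->]; apply: word_of_idx_yH; apply: hrev_neq0 ht; exact: idx_neq0.
Qed.

Lemma harm_word_yHx w c u : word_yH w -> word_Hge2 c ->
  u \in harm_word (w ++ [:: false]) c -> word_yHx u.2.
Proof.
move=> hw hc /mapP[t ht ->]; apply: word_of_idx_yHx; apply: hrev_ge2 ht; first exact: idx_x.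
by rewrite all_rev; exact: idx_ge2.
Qed.

Lemma phi_word_yH w u : word_yH w -> u \in phi_word w -> word_yH u.2.
Proof.
case: w => // -[] // w _ /=; rewrite /Defs.mul /lift2.
case/flattenP => s /allpairsP[[a b] /= [ha _ ->]]; rewrite inE => /eqP-> /=.
by move: ha; rewrite inE => /eqP->.
Qed.

Lemma ph_rcons v b f : ph (rcons v b) f =
  if b then - ph v (fun u => f (rcons u true))
  else ph v (fun u => f (rcons u false)) + ph v (fun u => f (rcons u true)).
Proof.
have phB f1 f2 : ph v (fun u => f1 u + f2 u) = ph v f1 + ph v f2.
  by rewrite -[ph v f1]mul1r -ph_lin; apply: eq_ph => u; rewrite mul1r.
rewrite -mulN1r -phB -phZ.
elim: v f {phB} => [|c v IH] f /=; first by case: b; rewrite ?mulN1r.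
by case: c; rewrite IH; case: b {IH}; apply: eq_ph => u /=; ring.
Qed.

Lemma ext_phi w f : ext (fun u => f (rev u)) (phi_word w) = ph (rev w) f.
Proof.
elim: w f => [|b w IH] f; first by rewrite /ext big_seq1 mul1r.
rewrite rev_cons ph_rcons /= /Defs.mul /lift2.
case: b; rewrite /= ?cats0 ?flatten_cat ?ext_cat !ext_flatten !big_map -!IH /ext -?sumrN;
  [|congr (_ + _)]; apply: eq_bigr => u _; rewrite big_seq1 /= rev_cons; ring.
Qed.

Lemma rwf_rcons s c k : rwf s (rcons c k) = rwf s c ++ nseq k (s (+) odd (size c)).
Proof.
elim: c s => [|j c IH] s /=; first by rewrite cats0 addbF.
by rewrite IH catA; congr (_ ++ nseq _ _); case: s (odd _) => [] [].
Qed.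

Lemma rev_rwf s c : rev (rwf s c) = rwf (s (+) ~~ odd (size c)) (rev c).
Proof.
elim: c s => [|k c IH] s //=.
rewrite rev_cat rev_nseq IH rev_cons rwf_rcons size_rev; congr (rwf _ _ ++ nseq _ _).
  by case: s (odd _) => [] [].
by case: s (odd _) => [] [].
Qed.

Lemma rwf_runs b w : rwf b (runs (b :: w)) = b :: w /\ posn (runs (b :: w)) /\ runs (b :: w) != [::].
Proof.
rewrite /runs; set R := foldr _ _.
have RE c u : R (c :: u) = match R u with
   | (b', k) :: r => if c == b' then (c, k.+1) :: r else (c, 1%N) :: R u
   | [::] => [:: (c, 1%N)] end by [].
suff [k [r [-> e pr]]] : exists k r, [/\ R (b :: w) = (b, k.+1) :: r, rwf b (k.+1 :: map snd r) = b :: w & posn (map snd r)].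
  by split; [exact: e|split].
elim: w b => [|b' w IH] b; first by exists 0%N, [::].
have [k [r [e1 e2 pr]]] := IH b'.
have -> : R [:: b, b' & w] = if b == b' then (b, k.+2) :: r else (b, 1%N) :: R (b' :: w).
  by rewrite RE e1.
case: eqP => [->|ne].
  by exists k.+1, r; split => //; rewrite -e2.
exists 0%N, (R (b' :: w)); rewrite e1; split => //.
by rewrite -e2; case: b b' ne {IH e1 e2} => [] [].
Qed.

Lemma runs_yHx w : word_yHx w ->
  [/\ posn (runs w), ~~ odd (size (runs w)), runs w != [::] & rev w = rwf false (rev (runs w))].
Proof.
case: w => [|[] w] // hw; have [e [p n0]] := rwf_runs true w.
have ev : ~~ odd (size (runs (true :: w))).
  apply/negP => o; move: e hw; case/lastP: (runs _) p n0 o => // c k.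
  rewrite /posn all_rcons => /andP[k0 _] _; rewrite size_rcons rwf_rcons /= => /negbTE-> e.
  have -> : last true w = last true (true :: w) by [].
  by rewrite -e last_cat; case: k k0 {e} => //= k _; elim: k.
by split=> //; rewrite -{1}e rev_rwf ev.
Qed.

(** * Linear forms and coefficient functions *)

Lemma coef_ext p u : coef p u = ext (fun w => (w == u)%:R) p.
Proof. by apply: eq_bigr => t _; case: eqP => _; rewrite ?mulr1 ?mulr0. Qed.

Lemma ext_coef h p (U : seq word) : uniq U -> (forall u, coef p u != 0 -> u \in U) ->
  ext h p = \sum_(u <- U) coef p u * h u.
Proof.
move=> uU hU; set U0 := undup (map snd p).
have h0 u : coef p u != 0 -> u \in U0.
  apply: contraR => hu; apply/eqP; rewrite /coef big1_seq // => t /andP[_ tp].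
  case: eqP => // e; case/negP: hu; rewrite mem_undup -e; exact: map_f.
have -> : ext h p = \sum_(u <- U0) coef p u * h u.
  under eq_bigr => u _ do rewrite /coef mulr_suml.
  rewrite exchange_big /= /ext big_seq [RHS]big_seq; apply: eq_bigr => t tp.
  rewrite (bigD1_seq t.2) ?undup_uniq //=; last by rewrite mem_undup map_f.
  rewrite eqxx big1 ?addr0 // => u; rewrite eq_sym => /negbTE->; exact: mul0r.
rewrite (bigID (fun u => coef p u == 0)) [RHS](bigID (fun u => coef p u == 0)) /=.
rewrite !(big1 _ (fun u => coef p u == 0)) ?add0r; try by move=> u /eqP->; rewrite mul0r.
rewrite -big_filter -[RHS]big_filter; apply: perm_big; apply: uniq_perm.
- by rewrite filter_uniq ?undup_uniq.
- by rewrite filter_uniq.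
- by move=> u; rewrite !mem_filter; case: eqP => //= /eqP n0; rewrite h0 // hU.
Qed.

(** A list supported in P may still contain words outside P whose coefficients cancel; a linear form
    only sees the coefficient function. *)
Lemma eq_ext_supp (P : word -> bool) h h' p : supported_in P p ->
  (forall u, P u -> h u = h' u) -> ext h p = ext h' p.
Proof.
move=> sp e; set U := undup (map snd p).
have hU u : coef p u != 0 -> u \in U.
  apply: contraR => hu; apply/eqP; rewrite /coef big1_seq // => t /andP[_ tp].
  case: eqP => // e'; case/negP: hu; rewrite mem_undup -e'; exact: map_f.
rewrite (ext_coef h (undup_uniq _) hU) (ext_coef h' (undup_uniq _) hU).
apply: eq_bigr => u _; have [->|/sp/e->//] := eqVneq (coef p u) 0.
by rewrite !mul0r.
Qed.

Lemma eq_ext_mem h h' p : (forall t, t \in p -> h t.2 = h' t.2) -> ext h p = ext h' p.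
Proof. by move=> e; apply: eq_big_seq => t /e->. Qed.

Lemma ext0 p : ext (fun=> 0) p = 0.
Proof. by rewrite /ext big1 // => t _; rewrite mulr0. Qed.

Lemma ext_lift1 h f p : ext h (lift1 f p) = ext (fun w => ext h (f w)) p.
Proof. by rewrite ext_flatten big_map; apply: eq_bigr => t _; rewrite ext_scale. Qed.

Lemma ext_lift2 h f p q :
  ext h (lift2 f p q) = ext (fun u => ext (fun v => ext h (f u v)) q) p.
Proof.
rewrite ext_flatten big_allpairs_dep /=; apply: eq_bigr => t _.
by rewrite /ext mulr_sumr; apply: eq_bigr => u _; rewrite -/(ext _ _) ext_scale mulrA.
Qed.

(** * Application to LinKaw and Drop1 *)

Lemma ext_LinKaw h G w1 w2 w3 :
  supported_in word_yH w1 -> supported_in word_yH w2 -> supported_in word_Hge2 w3 ->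
  (forall u v, word_yH u -> word_Hge2 v -> ext h (harm_word (u ++ [:: false]) v) = G u v) ->
  ext h (harm (mulw (phi (harm w1 w2)) [:: false]) w3)
  = ext (fun a => ext (fun b => ext (fun t => ext (fun u => ext (G u) w3) (phi_word t))
      (harm_word a b)) w2) w1.
Proof.
move=> s1 s2 s3 e.
rewrite {1}/harm ext_lift2 ext_mulw /phi ext_lift1 /harm ext_lift2.
apply: (eq_ext_supp s1) => a ha; apply: (eq_ext_supp s2) => b hb.
apply: eq_ext_mem => t /(harm_word_yH ha) ht; apply: eq_ext_mem => u /(phi_word_yH ht) hu.
by apply: (eq_ext_supp s3) => v hv; exact: e.
Qed.

Lemma LinKaw_gen_yHx p : LinKaw_gen p -> supported_in word_yHx p.
Proof.
case=> w1 [w2 [w3 [s1 s2 s3 ->]]] u; apply: contraR => hu; apply/eqP; rewrite coef_ext.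
(* The form is the coefficient of a word outside yHx, which already vanishes on each product of
   words. *)
rewrite (ext_LinKaw (G := fun _ _ => 0) s1 s2 s3) => [|v c hv hc].
  rewrite -[RHS](ext0 w1); apply: eq_ext_mem => a _; rewrite -[RHS](ext0 w2); apply: eq_ext_mem => b _.
  rewrite -[RHS](ext0 (harm_word a.2 b.2)); apply: eq_ext_mem => t _.
  by rewrite -[RHS](ext0 (phi_word t.2)); apply: eq_ext_mem => u' _; rewrite ext0.
rewrite -[RHS](ext0 (harm_word (v ++ [:: false]) c)); apply: eq_ext_mem => t /(harm_word_yHx hv hc).
by case: eqP => [->|//]; rewrite (negbTE hu).
Qed.

Lemma Zf_harm N u v : (0 < N)%N -> word_yH u -> word_Hge2 v ->
  ext (fun w => Zf N (rev w)) (harm_word (u ++ [:: false]) v)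
  = Zf N (false :: rev u) * Ff N (rev v).
Proof.
move=> N0 hu hv; have [c eZ] := Zf_Gh N0.
have hux : head true (u ++ [:: false]) by case: u hu => [|[]].
have hvy : head true v by case: (v) hv => [|[] ?].
have [_ char] := semi_char_Gh (N := N) (n := N.-1) ltac:(by rewrite prednK).
rewrite prednK // in char.
transitivity (c * hmul (Gh N N.-1) (rev (idx_of_word (u ++ [:: false]))) (rev (idx_of_word v))).
  rewrite /ext big_map /hmul mulr_sumr big_seq [RHS]big_seq; apply: eq_bigr => t ht /=.
  rewrite mul1r rev_word_of_idx.
  (* Z_N is proportional to [Gh] only on words ending in x. All terms of the product are such,
     because v contains no e_1. *)
  have g2 : ge2head t by apply: hrev_ge2 ht; [exact: idx_x | rewrite all_rev; exact: idx_ge2].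
  have := rH1_rwd t; case: t {ht} g2 => [|[|[|k]] t] //= _ hr; exact: eZ.
rewrite char ?/posn ?all_rev; last 2 first.
- exact: idx_posn.
- exact: idx_ge2.
rewrite !rev_idx_word // mulrA rev_cat /= -eZ //.
by case: u hu {hux} => [|[] u] // _; rewrite /rH1 rev_cons /= last_rcons.
Qed.

Lemma LinKaw_gen_Zf N p : (0 < N)%N -> LinKaw_gen p -> ext (fun w => Zf N (rev w)) p = 0.
Proof.
move=> N0 [w1 [w2 [w3 [s1 s2 s3 ->]]]].
rewrite (ext_LinKaw (G := fun u v => Zf N (false :: rev u) * Ff N (rev v)) s1 s2 s3); last first.
  by move=> u v; exact: Zf_harm.
rewrite -[RHS](ext0 w1); apply: (eq_ext_supp s1) => a ha.
rewrite -[RHS](ext0 w2); apply: (eq_ext_supp s2) => b hb.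
transitivity (ext (fun t => ext (fun v => Ff N (rev v)) w3 * ph (rev t) (fun u => Zf N (false :: u))) (harm_word a b)).
  apply: eq_ext_mem => t _; rewrite -ext_phi /ext mulr_sumr; apply: eq_bigr => u _.
  by rewrite mulrCA mulr_suml; congr (_ * _); apply: eq_bigr => v _; rewrite mulrCA mulrC.
rewrite /ext big_map /=; under eq_bigr => t _ do rewrite mul1r rev_word_of_idx.
rewrite -mulr_sumr Zf_kawashima ?mulr0 // ?/posn ?all_rev ?idx_neq0 //; exact: idx_posn.
Qed.

Lemma D_LinKaw_gen N p : (0 < N)%N -> LinKaw_gen p -> ext (fun w => Ff N (rev w)) (D p) = 0.
Proof.
move=> N0 hp; rewrite -[RHS](LinKaw_gen_Zf N0 hp) /D ext_lift1.
apply: (eq_ext_supp (LinKaw_gen_yHx hp)) => w /runs_yHx[pc ec c0 ->].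
exact: FD_Zf.
Qed.

Lemma D_y p u : supported_in word_yHx p -> ~~ word_yH u -> coef (D p) u = 0.
Proof.
move=> sp hu; rewrite coef_ext /D ext_lift1 -[RHS](ext0 p).
apply: (eq_ext_supp sp) => w /runs_yHx[pc ec c0 _].
by apply: zD_y0 => // v hv; case: eqP => // e; move: hu; rewrite -e; case: v hv {e} => [|[]].
Qed.

(** Removing heads of reversed indices; [independence] asks for a set closed under this
    operation. *)
Definition tails (t : seq nat) : seq (seq nat) := [seq drop i t | i <- iota 0 (size t).+1].

Lemma Ff_separates q : (forall u, ~~ word_yH u -> coef q u = 0) ->
  (forall N, (0 < N)%N -> ext (fun w => Ff N (rev w)) q = 0) -> forall u, coef q u = 0.
Proof.
move=> qy q0 u0; have [hu0|] := boolP (word_yH u0); last exact: qy.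
have [->//|cu0] := eqVneq (coef q u0) 0.
pose S := undup (flatten [seq tails (rev (idx_of_word t.2)) | t <- q]).
pose wd t := word_of_idx (rev t).
have memS t : (t \in S) -> posn t.
  rewrite mem_undup => /flattenP[_ /mapP[c _ ->] /mapP[i _ ->]].
  by apply/allP => k /mem_drop; rewrite mem_rev => kc; exact: (allP (idx_posn c.2)).
have wdK t : t \in S -> rev (idx_of_word (wd t)) = t.
  by move=> /memS pt; rewrite word_of_idxK ?revK // /posn all_rev.
have inS u : coef q u != 0 -> rev (idx_of_word u) \in S.
  move=> cu; have /hasP[t tq /eqP et] : has (fun t => t.2 == u) q.
    apply: contraR cu => /hasPn h; rewrite /coef big1_seq // => t /andP[_ /h /negbTE->] //.
  rewrite mem_undup; apply/flattenP; exists (tails (rev (idx_of_word t.2))).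
    by apply: (map_f (fun t => tails (rev (idx_of_word t.2)))).
  by rewrite et; apply/mapP; exists 0%N; rewrite ?drop0 // mem_iota.
have wdS u : coef q u != 0 -> wd (rev (idx_of_word u)) = u.
  move=> cu; rewrite /wd revK idxK //; have : word_yH u by apply: contraR cu => /qy->.
  by case: (u) => [|[]].
have := @independence (fun N t => Ff N (rwd t)) Ff_nil _ S (fun t => (coef q (wd t))%:P) (undup_uniq _) _ _ _ (inS _ cu0).
rewrite wdS // => h; apply/eqP; rewrite -polyC_eq0; apply/eqP; apply: h.
- move=> N k t N0 k0; case: N N0 => // N _; rewrite -[LHS]/(chi _ _ _) chi_rwd //; exact: natU_rat.
- move=> k t kt; split; first by have := memS _ kt; rewrite posn_cons => /andP[].
  move: kt; rewrite !mem_undup => /flattenP[_ /mapP[c cq ->] /mapP[i hi e]].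
  apply/flattenP; exists (tails (rev (idx_of_word c.2))).
    by apply: (map_f (fun t => tails (rev (idx_of_word t.2)))).
  have : (0 < size (drop i (rev (idx_of_word c.2))))%N by rewrite -e.
  rewrite size_drop subn_gt0 => hi'; apply/mapP; exists i.+1; first by rewrite mem_iota.
  by rewrite -add1n -drop_drop -e /= drop0.
- move=> N N0; rewrite -[RHS](q0 N N0) (@ext_coef _ _ (map wd S)).
  + rewrite big_map; apply: eq_bigr => t _; by rewrite hornerC /wd rev_word_of_idx.
  + rewrite map_inj_in_uniq ?undup_uniq // => s t /wdK es /wdK et e.
    by rewrite -es e et.
  + by move=> u cu; rewrite -(wdS _ cu) map_f // inS.
Qed.

Lemma coef_flatten_scale (l : seq (rat * Hpol)) u :
  coef (flatten [seq Defs.scale t.1 t.2 | t <- l]) u = \sum_(t <- l) t.1 * coef t.2 u.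
Proof.
rewrite coef_ext ext_flatten big_map; apply: eq_bigr => t _.
by rewrite ext_scale coef_ext.
Qed.

Theorem mainTheorem5 : forall p : Hpol, LinKaw p -> Drop1 p.
Proof.
move=> p [l [lg lp]]; exists [seq (t.1, Defs.sub t.2 (D t.2)) | t <- l]; split.
  by move=> _ /mapP[t /lg /LinKaw_gen_yHx st ->]; exists t.2.
move=> u; rewrite lp !coef_flatten_scale big_map big_seq [RHS]big_seq; apply: eq_bigr => t /lg tg /=.
congr (_ * _); rewrite [RHS]coef_ext ext_cat ext_scale -!coef_ext (@Ff_separates (D t.2)) ?mulr0 ?addr0 //.
  by move=> v; apply: D_y; exact: LinKaw_gen_yHx.
by move=> N N0; exact: D_LinKaw_gen.
Qed.
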